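(* Assume Assumptions A.1–A.6 and suppose $E(|e_1|^r)<\infty$ for some $r>0$. Consider the conditions: (i) there exists $\lambda:\Theta\to(0,\infty)$, bounded and bounded away from $0$, such that $$\sup_{\theta\in\Theta}E\Big(\frac{\lambda(\theta_1^* )}{\lambda(\theta)}(w(\theta,e_1))^r\,\Big|\,\theta_0^*=\theta\Big)<1;$$ (ii) $\displaystyle\limsup_{n\to\infty}\sup_{\theta\in\Theta}\Big(E\Big(\prod_{t=1}^n(w(\theta^*_{t-1},e_t))^r\,\Big|\,\theta_0^*=\theta\Big)\Big)^{1/n}<1.$ Then (i) and (ii) are equivalent, and each of them implies that $\{X_t\}$ is $V$-uniformly ergodic for some $V$ satisfying $K\|x\|^r\le V(x)\le L+M\|x\|^r$ for all $x$ (with some $K>0$ and $L,M<\infty$), and that the stationary distribution of $\{X_t\}$ has finite $r$th moment.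
   Context: Model: $\xi_t=a(X_{t-1})+b(X_{t-1})e_t$ with $X_t=(\xi_t,\dots,\xi_{t-p+1})\in\mathbb{R}^p$, $a,b$ measurable, $\{e_t\}$ i.i.d. independent of $X_0$. $\|\cdot\|$ Euclidean, $\Theta=\{\theta:\|\theta\|=1\}$, $\mathbb{R}^p_0=\mathbb{R}^p\setminus\{0\}$. A.1: $e_t$ has Lebesgue density $f$ locally bounded away from $0$; $b$ positive, locally bounded, locally bounded away from $0$. A.2: $\sup_u(1+|u|)f(u)<\infty$, $E|e_1|^{r_0}<\infty$ for some $r_0>0$. A.3: $a(x)/(1+\|x\|)$, $b(x)/(1+\|x\|)$ bounded. A.4: bounded $a_*,b_*$ on $\Theta$ with $\sup_{\theta}|a(w\theta)/w-a_*(\theta)|\to0$, $\sup_\theta|b(w\theta)/w-b_*(\theta)|\to0$ as $w\to\infty$; $a^*(x)=a_*(x/\|x\|)\|x\|$, $b^*(x)=b_*(x/\|x\|)\|x\|$, $a^*(0)=b^*(0)=0$. A.5: if $p>1$, $\max(|a^*|,b^* )$ locally bounded away from $0$ on $\mathbb{R}^p_0$ and $b^*$ locally bounded away from $0$ on $\mathbb{R}^p\setminus H_0$, $H_0=\{x:\min_i|x_i|=0\}$. A.6: if $p>1$, there are hyperplanes $H_1,\dots,H_m$ through the origin with $a^*,b^*$ continuous off $\bigcup_jH_j$. $z(x,u)=a^*(x)+b^*(x)u$, $w(x,u)=\|(z(x,u),x_1,\dots,x_{p-1})\|$; collapsed chain on $\Theta$: $\theta_t^*=(z(\theta^*_{t-1},e_t),\theta^*_{t-1,1},\dots,\theta^*_{t-1,p-1})/w(\theta^*_{t-1},e_t)$.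 $V$-uniform ergodicity: stationary $\Gamma$ and $M<\infty,\beta<1$ with $\sup_{|g|\le V}|E(g(X_n)\mid X_0=x)-\int g\,d\Gamma|\le M\beta^nV(x)$. *)

(* Defs.v *)
(* State space R^p is represented as [p.-tuple R],
   which carries the product (= Borel) sigma-algebra of MathComp-Analysis. *)
From HB Require Import structures.
From mathcomp Require Import all_boot all_order all_algebra.
From mathcomp Require Import all_classical all_reals all_analysis.
Set Implicit Arguments. Unset Strict Implicit. Unset Printing Implicit Defensive.
Import Order.TTheory GRing.Theory Num.Theory.
Import numFieldNormedType.Exports.
Local Open Scope classical_set_scope.
Local Open Scope ring_scope.

Section Defs.
Variables (R : realType) (p : nat).
Local Notation vec := (p.-tuple R).

Definition enorm (x : vec) : R := Num.sqrt (\sum_(i < p) (tnth x i) ^+ 2).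
Definition tscale (c : R) (x : vec) : vec := [tuple c * tnth x i | i < p].
Definition tdot (c x : vec) : R := \sum_(i < p) tnth c i * tnth x i.
Definition shift (x : vec) (z : R) : vec :=
  [tuple (if (i : nat) == 0%N then z else nth 0 x (i : nat).-1) | i < p].
Definition Theta : set vec := [set x | enorm x = 1].

Definition loc_bounded (D : set vec) (g : vec -> R) :=
  forall x, D x -> exists2 eps : R, 0 < eps & exists C : R,
    forall y, D y -> enorm [tuple tnth y i - tnth x i | i < p] < eps -> `|g y| <= C.
Definition loc_bdd_away0 (D : set vec) (g : vec -> R) :=
  forall x, D x -> exists2 eps : R, 0 < eps & exists2 c : R, 0 < c &
    forall y, D y -> enorm [tuple tnth y i - tnth x i | i < p] < eps -> c <= g y.
Definition cont_at (g : vec -> R) (x : vec) :=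
  forall e : R, 0 < e -> exists2 d : R, 0 < d &
    forall y, enorm [tuple tnth y i - tnth x i | i < p] < d -> `|g y - g x| < e.

Definition star (a_ : vec -> R) (x : vec) : R :=
  if enorm x == 0 then 0 else a_ (tscale (enorm x)^-1 x) * enorm x.

Definition H0 : set vec := [set x | exists i : 'I_p, tnth x i = 0].

Definition step (a b : vec -> R) (x : vec) (u : R) : vec := shift x (a x + b x * u).

(* E(g(X_n) | X_0 = x), the n-step transition operator applied to g, where
   the innovations have Lebesgue density f:  P^0 g = g, P^{n+1} g = P (P^n g). *)
Fixpoint Pn (a b : vec -> R) (f : R -> R) (n : nat) (g : vec -> \bar R) : vec -> \bar R :=
  match n with
  | 0%N => g
  | n'.+1 => fun x => (\int[lebesgue_measure]_u (Pn a b f n' g (step a b x u) * (f u)%:E))%E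
  end.

Definition zfun (as_ bs_ : vec -> R) (x : vec) (u : R) : R := star as_ x + star bs_ x * u.
Definition wfun (as_ bs_ : vec -> R) (x : vec) (u : R) : R := enorm (shift x (zfun as_ bs_ x u)).
Definition thnext (as_ bs_ : vec -> R) (x : vec) (u : R) : vec :=
  tscale (wfun as_ bs_ x u)^-1 (shift x (zfun as_ bs_ x u)).

(* Gn n theta = E( prod_{t=1}^n w(theta*_{t-1}, e_t)^r | theta*_0 = theta ),
   computed through the Markov property of the collapsed chain. *)
Fixpoint Gn (as_ bs_ : vec -> R) (f : R -> R) (r : R) (n : nat) : vec -> \bar R :=
  match n with
  | 0%N => fun _ => 1%E
  | n'.+1 => fun th => (\int[lebesgue_measure]_u
       ((powR (wfun as_ bs_ th u) r)%:E * Gn as_ bs_ f r n' (thnext as_ bs_ th u) * (f u)%:E))%E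
  end.

Definition stationary (a b : vec -> R) (f : R -> R) (G : probability vec R) :=
  forall A : set vec, measurable A ->
    G A = (\int[G]_x Pn a b f 1 (fun y => (\1_A y)%:E) x)%E.

Definition V_unif_ergodic_with (a b : vec -> R) (f : R -> R) (V : vec -> R)
    (G : probability vec R) :=
  stationary a b f G /\
  exists M beta : R, beta < 1 /\
    forall (n : nat) (x : vec) (g : vec -> R), measurable_fun setT g ->
      (forall y, `|g y| <= V y) ->
      (`| Pn a b f n (fun y => (g y)%:E) x - \int[G]_y (g y)%:E | <= (M * beta ^+ n * V x)%:E)%E.

End Defs.

Arguments Theta {R p}.
Arguments H0 {R p}.

(* Main.v *)
(** (i) and (ii): iterating (i) bounds the n-fold product expectation by
    (sup lambda / inf lambda) c^n on Theta; conversely, if the N-fold expectation is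
    at most rho^N uniformly, the sum over k < N of rho^-k times the k-fold
    expectation telescopes to a function lambda as in (i).

    Ergodicity: g0 x = lambda (x / |x|) |x|^r has a drift under the homogeneous
    chain with coefficients a*, b*.  For large |x| the coefficients a x / |x| and
    b x / |x| are close to a*, b*.  Where b* is bounded below this makes the
    one-step laws close in total variation with weight (1 + |u|)^r (approximate
    the density by a continuous function and change variables), so the drift passes
    to the original chain although lambda is only measurable.  For p > 1, b* may
    only be small where some coordinate of x / |x| is small; a penalty M^(p-i) for
    a small i-th coordinate provides the drift there, because one step moves a small
    coordinate one place further, and by A.5 a new small coordinate is unlikely.
    For p = 1 the function g0 is continuous and no such region has to be avoided.

    V = 1 + g then satisfies P V <= rho V + K, and P^p is minorized on the
    sublevel sets of V.  A contraction of the weighted oscillation seminorm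
    (Hairer and Mattingly) makes P^n phi converge to a constant L phi at a geometric
    rate, and the Daniell representation of L is the stationary distribution. *)

Require Import Defs.
From HB Require Import structures.
From mathcomp Require Import all_boot all_order all_algebra.
From mathcomp Require Import all_classical all_reals all_analysis.
From mathcomp Require Import measurable_realfun lra ring.
Import Order.TTheory GRing.Theory Num.Theory.
Import numFieldNormedType.Exports.
Set Implicit Arguments. Unset Strict Implicit. Unset Printing Implicit Defensive.
Local Open Scope classical_set_scope.
Local Open Scope ring_scope.

Local Notation shift := Defs.shift.
Local Notation step := Defs.step.

(** * Weighted expectations *)

(** The strict inequality in (i) leaves a margin of at least [(1 - rho) * c1], with [c1] the lower
    bound of [lam] on [Theta], and every approximation error is made smaller than a fraction of it.
    The obstacle is that [lam] has no continuity, so values at nearby next states cannot be compared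
    pointwise; closeness has to come from the density of the innovation, and this fails where the
    scale [bs_] degenerates. What saves those directions is that [|as_|] and [bs_] are never both
    small and that the density is bounded: together they make a value of [s + t * u] near 0
    improbable uniformly in [s] and [t], whether [t] is small or not.

    The ergodic part speaks of operators on functions bounded by a multiple of [V] instead of
    kernels: positivity, linearity and continuity along dominated null sequences are what the
    contraction and the Daniell step use, and iterates inherit them. The minorization takes [p]
    steps because the state is a window of the last [p] values: after [p] steps of the comparison
    chain nothing of the starting point is left, so one functional serves all of them. *)

Lemma measurable_normr_gt {R : realType} (A : R) : measurable [set v : R | A < `|v|].
Proof.
rewrite (_ : [set v | _] = setT `&` (Num.norm @^-1` `]A, +oo[)).
  exact: normr_measurable.
by apply/seteqP; split=> v /=; rewrite in_itv/= andbT// => -[].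
Qed.

Section weighted_integral.
Context {R : realType}.
Variable r : R.
Local Notation mu := (@lebesgue_measure R).

(** Taking [1 + |u|] instead of [|u|] makes the weight at least 1, so that constants are dominated,
    and lets an affine change of the argument cost only a constant factor. *)
Definition weight (u : R) : R := (1 + `|u|) `^ r.

Definition dominated (k : R -> R) :=
  measurable_fun setT k /\ exists D, forall u, `|k u| <= D * weight u.

(** Real valued, hence an honest expectation only for dominated [k]; [Ex_EFin] is the bridge to the
    extended-real integrals of the statement. *)
Definition Ex (f k : R -> R) : R := \int[mu]_u (k u * f u).

Definition weightable (f : R -> R) := [/\ measurable_fun setT f,
  forall u, 0 <= f u & mu.-integrable setT (EFin \o (fun u => weight u * f u))].

Lemma weight_ge0 u : 0 <= weight u. Proof. exact: powR_ge0. Qed.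

Lemma weight_gt0 u : 0 < weight u.
Proof. by rewrite powR_gt0// ltr_pwDl. Qed.

Lemma measurable_weight : measurable_fun setT weight.
Proof.
apply: (measurableT_comp (measurable_powR r)).
exact: measurable_funD.
Qed.

Lemma dominated_weight : dominated weight.
Proof.
split; first exact: measurable_weight.
by exists 1 => u; rewrite mul1r ger0_norm ?weight_ge0.
Qed.

Lemma dominatedD k l : dominated k -> dominated l -> dominated (k \+ l).
Proof.
move=> [mk [D hD]] [ml [E hE]]; split; first exact: measurable_funD.
exists (D + E) => u; rewrite (le_trans (ler_normD _ _))// mulrDl lerD//.
Qed.

Lemma dominatedZ c k : dominated k -> dominated (fun u => c * k u).
Proof.
move=> [mk [D hD]]; split; first exact: measurable_funM.
by exists (`|c| * D) => u; rewrite normrM -mulrA ler_wpM2l.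
Qed.

Lemma dominated_le (k l : R -> R) : measurable_fun setT k -> dominated l ->
  (forall u, `|k u| <= l u) -> dominated k.
Proof.
move=> mk [_ [D hD]] kl; split=> //; exists D => u.
by rewrite (le_trans (kl u))// (le_trans (ler_norm _)).
Qed.

Lemma dominated_indic (A : set R) k : measurable A -> dominated k ->
  dominated (fun u => k u * \1_A u).
Proof.
move=> mA [mk [D hD]]; split.
  by apply: measurable_funM => //; exact: measurable_indic.
exists `|D| => u; rewrite normrM indicE.
have hD' : `|k u| <= `|D| * weight u.
  by rewrite (le_trans (hD u))// ler_wpM2r ?weight_ge0// ler_norm.
by case: (u \in A); rewrite ?normr1 ?mulr1// normr0 mulr0 mulr_ge0// weight_ge0.
Qed.

Hypothesis r0 : 0 <= r.

Lemma weight_ge1 u : 1 <= weight u.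
Proof.
by rewrite -(powRr0 (1 + `|u|)) ler_powR// lerDl.
Qed.

Lemma dominated_cst c : dominated (fun=> c).
Proof.
split; first exact: measurable_cst.
by exists `|c| => u; rewrite ler_peMr// weight_ge1.
Qed.

Variable f : R -> R.
Hypothesis wf : weightable f.

Lemma dominated_integrable k : dominated k ->
  mu.-integrable setT (EFin \o (fun u => k u * f u)).
Proof.
move: wf => [mf f0 If] [mk [D hD]].
apply: (le_integrable measurableT _ _ (integrableZl measurableT D If)) => //=.
- by apply/measurable_EFinP; exact: measurable_funM.
- move=> u _. rewrite lee_fin mulrA 2!normrM ler_wpM2r//.
  exact: le_trans (hD u) (ler_norm _).
Qed.

Lemma ExD k l : dominated k -> dominated l -> Ex f (k \+ l) = Ex f k + Ex f l.
Proof.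
move=> dk dl; rewrite /Ex -RintegralD//; [|exact: dominated_integrable..].
by apply: eq_Rintegral => u _; rewrite mulrDl.
Qed.

Lemma ExZ c k : dominated k -> Ex f (fun u => c * k u) = c * Ex f k.
Proof.
move=> dk; rewrite /Ex -RintegralZl//; [|exact: dominated_integrable].
by apply: eq_Rintegral => u _; rewrite mulrA.
Qed.

Lemma Ex_le k l : dominated k -> dominated l -> (forall u, k u <= l u) ->
  Ex f k <= Ex f l.
Proof.
move=> dk dl kl; apply: le_Rintegral => //; [exact: dominated_integrable..|].
by move=> u _; rewrite ler_wpM2r//; case: wf.
Qed.

Lemma Ex_ge0 k : (forall u, 0 <= k u) -> 0 <= Ex f k.
Proof.
by move=> k0; apply: Rintegral_ge0 => u _; rewrite mulr_ge0//; case: wf.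
Qed.

Lemma Ex_EFin k : dominated k -> (\int[mu]_u (k u * f u)%:E = (Ex f k)%:E)%E.
Proof.
by move=> dk; rewrite fineK// integrable_fin_num//; exact: dominated_integrable.
Qed.

(** Dominated convergence in the form asked of the abstract operators below: by linearity, null
    sequences are enough. *)
Lemma Ex_cvg0 (k : nat -> R -> R) l : (forall n, measurable_fun setT (k n)) ->
  dominated l -> (forall n u, `|k n u| <= l u) -> (forall u, k ^~ u @ \oo --> 0) ->
  (fun n => Ex f (k n)) @ \oo --> 0.
Proof.
move=> mk dl kl k0.
have [mf f0 _] := wf.
have dk n : dominated (k n) by apply: dominated_le (kl n).
suff H : ((fun n => \int[mu]_u (k n u * f u)%:E) @ \oo --> 0%:E)%E.
  exact: (fine_fcvg H).
have := @dominated_cvg _ _ _ mu setT measurableT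
  (fun n u => (k n u * f u)%:E) (cst 0%E) (fun u => (l u * f u)%:E).
rewrite integral_cst// mul0e => H.
apply: H => //=.
- by move=> n; apply: measurableT_comp => //; apply: measurable_funM; [exact: mk|exact: mf].
- move=> u _; apply: cvg_EFin; first exact: nearW.
  rewrite /= -(mul0r (f u)); apply: cvgM; [exact: k0|exact: cvg_cst].
- exact: dominated_integrable.
- move=> n u _; rewrite /= lee_fin normrM (ger0_norm (f0 u)) ler_wpM2r//.
Qed.

Lemma Ex_tail eps : 0 < eps ->
  exists2 A : R, 0 < A & Ex f (fun u => weight u * \1_[set v | A < `|v|] u) <= eps.
Proof.
move=> e0.
have mA := @measurable_normr_gt R.
have /cvgrPdist_le/(_ eps e0)[N _ /(_ N.+1) HN] : (fun n : nat =>
  Ex f (fun u => weight u * \1_[set v : R | n%:R < `|v|] u)) @ \oo --> 0.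
  apply: (@Ex_cvg0 _ weight) => //.
  - move=> n; apply: measurable_funM; first exact: measurable_weight.
    exact: measurable_indic.
  - exact: dominated_weight.
  - move=> n u; rewrite indicE normrM ger0_norm ?weight_ge0//.
    by case: (_ \in _); rewrite ?normr1 ?mulr1 ?normr0 ?mulr0 ?weight_ge0.
  - move=> u; apply: cvg_near_cst.
    exists (Num.Def.archi_bound `|u|) => // n /= hn.
    rewrite indicE memNset ?mulr0// /= => /lt_geF.
    rewrite (le_trans (ltW (archi_boundP _)))// ler_nat//.
have {}HN := HN (leqnSn _).
exists N.+1%:R => //; move: HN; rewrite sub0r normrN; exact: le_trans (ler_norm _).
Qed.

End weighted_integral.

(** * Affine change of variables for Lebesgue measure *)

Section affine.
Context {R : realType}.
Local Notation mu := (@lebesgue_measure R).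

(** The rescaled pushforward gives every half-open interval its length, so uniqueness of Lebesgue
    measure identifies it. *)
Lemma lebesgue_measure_affine (s t : R) (A : set R) : 0 < t -> measurable A ->
  (t%:E * mu ((fun v => (s + t * v)%R : measurableTypeR R) @^-1` A) = mu A)%E.
Proof.
move=> t0 mA.
pose psi : measurableTypeR R -> measurableTypeR R := fun v => s + t * v.
have mpsi : measurable_fun setT psi.
  by apply: measurable_funD => //; apply: measurable_funM.
pose tn : {nonneg R} := NngNum (ltW t0).
pose nu : {measure set (measurableTypeR R) -> \bar R} :=
  measure_function_pushforward__canonical__measure_function_Measure mu mpsi.
suff : mu A = mscale tn nu A by move=> ->.
apply: lebesgue_measure_unique => //.
move=> _ [[a b]] _ <-.
change (mu `]a, b]%classic = (t%:E * mu (psi @^-1` `]a, b]%classic))%E).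
have -> : psi @^-1` `]a, b] = `](a - s) / t, (b - s) / t]%classic.
  apply/seteqP; split => v /=; rewrite !in_itv/= /psi ltr_pdivrMr// ler_pdivlMr//.
    by move=> /andP[? ?]; apply/andP; split; lra.
  by move=> /andP[? ?]; apply/andP; split; lra.
rewrite !lebesgue_measure_itv/= !lte_fin ltr_pM2r ?invr_gt0// ltrD2r.
case: ifP => // _; last by rewrite mule0.
by rewrite -!EFinD -EFinM; congr EFin; field; exact: lt0r_neq0.
Qed.

Lemma integral_affine (s t : R) (k : R -> R) : 0 < t -> measurable_fun setT k ->
  (forall u, 0 <= k u) ->
  (\int[mu]_u (k u)%:E = \int[mu]_v (k (s + t * v) * t)%:E)%E.
Proof.
move=> t0 mk k0.
pose psi : measurableTypeR R -> measurableTypeR R := fun v => s + t * v.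
have mpsi : measurable_fun setT psi.
  by apply: measurable_funD => //; apply: measurable_funM.
pose tn : {nonneg R} := NngNum (ltW t0).
have mk' : measurable_fun setT (EFin \o k) by apply/measurable_EFinP.
pose nu : {measure set (measurableTypeR R) -> \bar R} :=
  measure_function_pushforward__canonical__measure_function_Measure mu mpsi.
rewrite (@eq_measure_integral _ _ _ _ (mscale tn nu)); last first.
  by move=> A mA _; apply/esym; exact: lebesgue_measure_affine.
rewrite ge0_integral_mscale//=; last by move=> x _; rewrite lee_fin.
rewrite ge0_integral_pushforward//=; last by move=> x _; rewrite lee_fin.
rewrite preimage_setT -ge0_integralZl//=; first last.
- by rewrite lee_fin ltW.
- by move=> x _; rewrite lee_fin.
- exact: (measurableT_comp mk' mpsi).
by apply: eq_integral => v _; rewrite -EFinM mulrC.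
Qed.

Lemma le_integral_real (k l : R -> R) : measurable_fun setT k ->
  measurable_fun setT l -> (forall u, 0 <= k u <= l u) ->
  (\int[mu]_u (k u)%:E <= \int[mu]_u (l u)%:E)%E.
Proof.
move=> mk ml kl; apply: ge0_le_integral => //.
- by move=> u _; rewrite lee_fin; have /andP[] := kl u.
- exact/measurable_EFinP.
- exact/measurable_EFinP.
- by move=> u _; rewrite lee_fin; have /andP[] := kl u.
Qed.

Lemma integral_realD (k l : R -> R) : measurable_fun setT k ->
  measurable_fun setT l -> (forall u, 0 <= k u) -> (forall u, 0 <= l u) ->
  (\int[mu]_u (k u + l u)%:E = \int[mu]_u (k u)%:E + \int[mu]_u (l u)%:E)%E.
Proof.
move=> mk ml k0 l0; rewrite -ge0_integralD//.
- by move=> u _; rewrite lee_fin.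
- exact/measurable_EFinP.
- by move=> u _; rewrite lee_fin.
- exact/measurable_EFinP.
Qed.

Lemma integral_realZ (c : R) (k : R -> R) : measurable_fun setT k ->
  0 <= c -> (forall u, 0 <= k u) ->
  (\int[mu]_u (c * k u)%:E = c%:E * \int[mu]_u (k u)%:E)%E.
Proof.
move=> mk c0 k0; rewrite -ge0_integralZl//.
- exact/measurable_EFinP.
- by move=> u _; rewrite lee_fin.
Qed.

End affine.

(** * Uniform smallness of the event that an affine function is near zero *)

Section uniform_estimates.
Context {R : realType}.
Local Notation mu := (@lebesgue_measure R).
Variables (r : R) (f : R -> R).
Hypotheses (r0 : 0 <= r) (wf : weightable r f).

Lemma measurable_affine_preimage (s t : R) (A : set R) : measurable A ->
  measurable [set v : R | A (s + t * v)].
Proof.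
move=> mA; rewrite -[X in measurable X]setTI.
have m : measurable_fun setT (fun v : R => s + t * v).
  by apply: measurable_funD => //; apply: measurable_funM.
exact: m.
Qed.

Lemma measurable_abs_affine_lt (s t d : R) :
  measurable [set v : R | `|s + t * v| < d].
Proof.
rewrite (_ : mkset _ = [set v : R | `]-d, d[%classic (s + t * v)]).
  exact: measurable_affine_preimage.
by apply/seteqP; split => v /=; rewrite in_itv/= ltr_norml.
Qed.

Lemma Ex_indic_affine Cf (s t d : R) : (forall u, f u <= Cf) -> 0 < t -> 0 < d ->
  Ex f \1_[set v | `|s + t * v| < d] <= Cf * (2 * d / t).
Proof.
move=> fC t0 d0.
have [mf f0 _] := wf.
have C0 : 0 <= Cf by exact: le_trans (f0 0) (fC 0).
have mI := measurable_abs_affine_lt s t d.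
have dI : dominated r (\1_[set v | `|s + t * v| < d] : R -> R).
  apply: (@dominated_le _ _ _ (cst 1)) => //; first exact: dominated_cst.
  by move=> u; rewrite indicE/=; case: (_ \in _); rewrite ?normr1 ?normr0.
rewrite -lee_fin -(Ex_EFin wf dI).
apply: (@le_trans _ _ (\int[mu]_u (Cf * \1_[set v | `|s + t * v| < d] u)%:E)%E).
  apply: le_integral_real.
  - by apply: measurable_funM => //; exact: measurable_indic.
  - by apply: measurable_funM => //; exact: measurable_indic.
  - move=> u; rewrite mulr_ge0//=.
    by rewrite mulrC ler_wpM2r.
rewrite integral_realZ//.
rewrite integral_indic// setIT EFinM lee_wpmul2l ?lee_fin//.
rewrite (_ : mkset _ = `](- s - d) / t, (- s + d) / t[%classic); last first.
  apply/seteqP; split => v /=;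
    rewrite in_itv/= ltr_norml ltr_pdivrMr// ltr_pdivlMr//.
    by move=> /andP[? ?]; apply/andP; split; lra.
  by move=> /andP[? ?]; apply/andP; split; lra.
have E := lebesgue_measure_itv `](- s - d) / t, (- s + d) / t[.
rewrite /= in E; rewrite [X in (X <= _)%E]E.
rewrite lte_fin; case: ifP => _.
  rewrite -EFinD lee_fin -mulrBl ler_wpM2r ?invr_ge0 ?(ltW t0)//.
  by rewrite (_ : - s + d - (- s - d) = 2 * d)//; ring.
by rewrite lee_fin mulr_ge0// ?invr_ge0 ?mulr_ge0// ltW.
Qed.

(** Two regimes for [t]. Below a threshold [h], [|s|] is at least [c], and only a large [|u|] can
    bring [s + t * u] near 0, so the tail of the innovation pays. Above [h], the event is an
    interval of length [2 * d / t], which the bounded density makes improbable once [|u|] is cut at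
    [A]. *)
Lemma Ex_weight_near_root (Cf c eps : R) : (forall u, f u <= Cf) -> 0 < c -> 0 < eps ->
  exists2 d : R, 0 < d & forall s t : R, 0 <= t -> c <= Num.max `|s| t ->
  Ex f (fun u => weight r u * \1_[set v | `|s + t * v| < d] u) <= eps.
Proof.
move=> fC c0 e0.
have [mf f0 _] := wf.
have C0 : 0 <= Cf by exact: le_trans (f0 0) (fC 0).
have [A A0 tailA] := Ex_tail wf (divr_gt0 e0 (@ltr0Sn R 1)).
set W := (1 + A) `^ r.
have W0 : 0 <= W by exact: powR_ge0.
(* For [t < h] and [|u| <= A] this gives [|t * u| <= c / 2]; with [d <= c / 2] the inequality
   [|s + t * u| < d] would then force [|s| < c]. *)
pose h := c / (2 * (A + 1)).
have h0 : 0 < h by rewrite divr_gt0// mulr_gt0//; lra.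
have hc : h * A <= c / 2.
  rewrite /h mulrAC ler_pdivrMr; last by rewrite mulr_gt0//; lra.
  by rewrite (_ : c / 2 * _ = c * (A + 1)); [nra|field].
(* The second entry makes [W * Cf * (2 * d / h)] at most [eps / 2]. *)
pose d := Num.min (c / 2) (eps * h / (4 * (W * Cf + 1))).
have WC : 0 <= W * Cf by rewrite mulr_ge0.
have d0 : 0 < d.
  rewrite lt_min divr_gt0//= divr_gt0// mulr_gt0//; lra.
exists d => // s t t0 cst_.
have mI := measurable_abs_affine_lt s t d.
have mT := measurable_normr_gt A.
have dw := dominated_weight r.
have dI : dominated r (\1_[set v | `|s + t * v| < d] : R -> R).
  apply: (@dominated_le _ _ _ (cst 1)) => //; first exact: dominated_cst.
  by move=> u; rewrite indicE/=; case: (_ \in _); rewrite ?normr1 ?normr0.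
have [th|ht] := ltP t h.
  apply: (@le_trans _ _ (eps / 2)); last lra.
  apply: le_trans tailA; apply: (Ex_le wf) => //.
  - exact: dominated_indic.
  - exact: dominated_indic.
  - move=> u; rewrite ler_wpM2l ?weight_ge0// !indicE.
    case: (boolP (u \in _)) => //; rewrite inE/= => ud.
    rewrite mem_set//= ltNge; apply/negP => uA.
    have hc' : h <= c / 2.
      rewrite /h ler_pdivrMr ?mulr_gt0//; last lra.
      by rewrite (_ : c / 2 * _ = c * (A + 1)); [nra|field].
    have sc : c <= `|s|.
      by move: cst_; rewrite le_max => /orP[//|ct]; lra.
    have : `|s| <= `|s + t * u| + `|t * u|.
      by rewrite -{1}(addrK (t * u) s) (le_trans (ler_normB _ _)).
    have : `|t * u| <= h * A.
      by rewrite normrM (ger0_norm t0) ler_pM// ltW.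
    have : d <= c / 2 by rewrite ge_min lexx.
    lra.
have tt : 0 < t by exact: lt_le_trans ht.
apply: (@le_trans _ _ (Ex f ((fun u => weight r u * \1_[set v | A < `|v|] u) \+
   (fun u => W * \1_[set v | `|s + t * v| < d] u)))).
  apply: (Ex_le wf) => //.
  - exact: dominated_indic.
  - by apply: dominatedD; [exact: dominated_indic|exact: dominatedZ].
  - move=> u /=; rewrite !indicE.
    have w0 := weight_ge0 r u.
    have [uA|uA] := ltP A `|u|.
      rewrite (mem_set (uA : [set v | A < `|v|] u)) mulr1.
      case: (_ \in _); rewrite ?mulr1 ?mulr0; first by rewrite lerDl.
      by rewrite addr0.
    have -> : (u \in [set v | A < `|v|]) = false.
      by apply: memNset => /=; apply/negP; rewrite -leNgt.
    rewrite mulr0 add0r ler_wpM2r//.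
    by rewrite /weight /W ge0_ler_powR ?nnegrE ?addr_ge0// ?lerD2l// ltW.
rewrite (ExD wf); [|exact: dominated_indic|exact: dominatedZ].
rewrite (ExZ wf)// (splitr eps) lerD//.
apply: (le_trans (ler_wpM2l W0 (Ex_indic_affine s fC tt d0))).
have : d <= eps * h / (4 * (W * Cf + 1)) by rewrite ge_min lexx orbT.
rewrite ler_pdivlMr ?mulr_gt0//; last lra.
move=> dd.
rewrite mulrA mulrA ler_pdivrMr//.
apply: (@le_trans _ _ (eps / 2 * h)); last by rewrite ler_wpM2l// ltW// divr_gt0.
rewrite mulrA; nra.
Qed.

End uniform_estimates.

(** * Stability of expectations under a change of the affine coefficients *)

Section continuity_estimates.
Context {R : realType}.
Local Notation mu := (@lebesgue_measure R).

(** Only [x] is confined to the segment. The freedom of [y] matters in dimension one, where the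
    perturbed point may leave the segment that contains the unperturbed one. *)
Lemma segment_unif_continuous (phi : R -> R) (a b eps : R) :
  continuous phi -> 0 < eps -> exists2 d : R, 0 < d &
    forall x y, a <= x <= b -> `|x - y| <= d -> `|phi x - phi y| <= eps.
Proof.
move=> cphi e0.
have /compact_near_coveringP H := @segment_compact R a b.
have {}H : \forall d \near (0 : R)^'+, `[a, b]%classic `<=`
    (fun x => forall y, `|x - y| <= d -> `|phi x - phi y| <= eps).
  apply: H => x _.
  have /cvgrPdist_le/(_ _ (divr_gt0 e0 (@ltr0Sn R 1))) := cphi x.
  move=> /nbhs_ballP[d /= d0 hd].
  exists (ball x (d / 2), [set e | 0 < e < d / 2]) => /=.
    split; first by apply: nbhsx_ballx; rewrite divr_gt0.
    near=> e; apply/andP; split; first by near: e; exact: nbhs_right_gt.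
    by near: e; apply: nbhs_right_lt; rewrite divr_gt0.
  move=> [z e] /= [xz /andP[e00 ed]] y zy.
  have h1 : `|phi x - phi z| <= eps / 2.
    by apply: hd; apply: le_ball xz; rewrite ler_pdivrMr// ler_pMr// ler1n.
  have h2 : `|phi x - phi y| <= eps / 2.
    apply: hd; rewrite /ball/= in xz *.
    rewrite -(subrK z x) -addrA (le_lt_trans (ler_normD _ _))//.
    by rewrite (splitr d) ltrD// (le_lt_trans zy).
  rewrite -(subrK (phi x) (phi z)) -addrA (le_trans (ler_normD _ _))//.
  by rewrite (splitr eps) lerD// distrC.
near (0 : R)^'+ => d.
exists d; first by near: d; exact: nbhs_right_gt.
move=> x y xab; have Hd : `[a, b]%classic `<=`
    (fun x => forall y, `|x - y| <= d -> `|phi x - phi y| <= eps) by near: d.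
by apply: Hd; rewrite /= in_itv.
Unshelve. all: by end_near. Qed.

Variables (r : R) (f : R -> R).
Hypotheses (r0 : 0 <= r) (wf : weightable r f).

Lemma weight_affine (C s t u : R) : `|s| <= C -> `|t| <= C ->
  weight r (s + t * u) <= (1 + C) `^ r * weight r u.
Proof.
move=> sC tC; have C0 : 0 <= C by exact: le_trans sC.
rewrite /weight -powRM ?addr_ge0//.
apply: ge0_ler_powR => //; rewrite ?nnegrE ?addr_ge0 ?mulr_ge0 ?addr_ge0//.
have : `|s + t * u| <= `|s| + `|t| * `|u|.
  by rewrite (le_trans (ler_normD _ _))// normrM.
have : `|t| * `|u| <= C * `|u| by rewrite ler_wpM2r.
have : 0 <= `|u| by [].
nra.
Qed.

Lemma dominated_affine (H : R -> R) (D s t : R) : measurable_fun setT H ->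
  (forall z, 0 <= H z <= D * weight r z) -> dominated r (fun u => H (s + t * u)).
Proof.
move=> mH HD.
have m : measurable_fun setT (fun v : R => s + t * v).
  by apply: measurable_funD => //; apply: measurable_funM.
split; first exact: measurableT_comp mH m.
have D0 : 0 <= D.
  have /andP[h1 h2] := HD 0.
  by have := le_trans h1 h2; rewrite pmulr_lge0// weight_gt0.
exists (D * (1 + (`|s| + `|t|)) `^ r) => u.
have /andP[h1 h2] := HD (s + t * u).
rewrite ger0_norm// (le_trans h2)// -mulrA ler_wpM2l//.
by apply: weight_affine; rewrite ?lerDl ?lerDr.
Qed.

Lemma continuous_L1_approx (A e : R) : 0 < e -> 
  exists g : R -> R, [/\ continuous g, measurable_fun setT g &
    (\int[mu]_u (\1_(`[- A, A]%classic) u * `|f u - g u|)%:E <= e%:E)%E].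
Proof.
move=> e0.
have df := dominated_integrable wf (dominated_cst r0 1).
have mE : measurable (`[- A, A]%classic : set (measurableTypeR R)) by exact: measurable_itv.
have intf : mu.-integrable (`[- A, A]%classic : set (measurableTypeR R)) (EFin \o f).
  apply: (@integrableS _ _ _ _ setT) => //.
  rewrite (_ : EFin \o f = EFin \o (fun u => 1 * f u))//.
  by apply/funext => u /=; rewrite mul1r.
have finE : (mu (`[(- A)%R, A%R]%classic : set (measurableTypeR R)) < +oo)%E.
  have E := lebesgue_measure_itv (`[- A, A] : interval R); rewrite /= in E.
  rewrite [X in (X < _)%E]E; case: ifP => _; last by [].
  by rewrite -EFinD ltry.
have [g [cg ig gf]] := approximation_continuous_integrable mE finE intf.
have /fine_cvgP[finI /cvgrPdist_le/(_ e e0) HI] := gf.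
have [N [hN1 hN2]] := filter_ex (filterI finI HI).
exists (g N); split.
- exact: cg.
- by apply: continuous_measurable_fun; exact: cg.
- rewrite (_ : (\int[mu]_u _)%E = (\int[mu]_(z in `[(- A)%R, A%R]%classic) `|(f z - g N z)%:E|)%E); last first.
    rewrite [RHS]integral_mkcond; apply: eq_integral => u _.
    rewrite patchE indicE; case: ifP => _; first by rewrite mul1r.
    by rewrite mul0r.
  rewrite -(fineK hN1) lee_fin.
  by move: hN2; rewrite /= sub0r normrN; exact: le_trans (ler_norm _).
Qed.

End continuity_estimates.

Section affine_perturbation.
Context {R : realType}.
Local Notation mu := (@lebesgue_measure R).
Variables (r : R) (f : R -> R).
Hypotheses (r0 : 0 <= r) (wf : weightable r f).

Lemma affine_perturb_bounds (C eta k s t s' t' : R) : 0 <= C -> 0 < eta ->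
  0 < k -> k <= 1 / 2 -> `|s'| <= C -> eta <= t' <= C ->
  `|s - s'| <= Num.min 1 (eta * k / 2) -> `|t - t'| <= Num.min 1 (eta * k / 2) ->
  [/\ 0 < t, 0 < t', `|s| <= C + 1, `|t| <= C + 1 & `|t'| <= C + 1] /\
  `|(s' - s) / t| <= k /\ `|t' / t - 1| <= k.
Proof.
move=> C0 eta0 k0 k1 s'C /andP[t'1 t'2].
rewrite !le_min => /andP[s1 s2] /andP[t1 t2].
have h : eta * k <= eta / 2 by rewrite ler_wpM2l ?(ltW eta0)//; lra.
have tlo : eta / 2 <= t by move: t2; rewrite ler_norml => /andP[h1 _]; lra.
have t0 : 0 < t by apply: lt_le_trans tlo; rewrite divr_gt0.
have kt : eta * k / 2 / t <= k.
  rewrite ler_pdivrMr// (_ : eta * k / 2 = k * (eta / 2)); last by field.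
  by rewrite ler_wpM2l// ltW.
split; last split.
- split=> //; first lra.
  + by rewrite -(subrK s' s) (le_trans (ler_normD _ _))// addrC lerD.
  + by rewrite -(subrK t' t) (le_trans (ler_normD _ _))// addrC lerD// ger0_norm//; lra.
  + by rewrite ger0_norm; lra.
- rewrite normrM normfV (gtr0_norm t0) distrC (le_trans _ kt)//.
  by rewrite ler_wpM2r// invr_ge0 ltW.
- rewrite (_ : t' / t - 1 = (t' - t) / t); last by field; exact: lt0r_neq0.
  rewrite normrM normfV (gtr0_norm t0) distrC (le_trans _ kt)//.
  by rewrite ler_wpM2r// invr_ge0 ltW.
Qed.

(** The left-hand side is the density [phi] carried over by the substitution. The point moves by at
    most [k * (A + 2)], which keeps [v] in the larger segment and within the modulus [d]; the bound
    on [k * (2 * S)] pays for the factor [tau <= 1 + k]. *)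
Lemma affine_perturb_phi (phi : R -> R) (A S d e k sg tau v : R) : 0 < A ->
  (forall u, 0 <= phi u) -> (forall u, `|u| <= A + 1 -> phi u <= S) ->
  (forall x y, `|x| <= A + 1 -> `|x - y| <= d -> `|phi x - phi y| <= e / 4) ->
  0 < k -> 0 < e -> k * (A + 2) <= 1 -> k * (A + 2) <= d -> k * (2 * S) <= e ->
  `|sg| <= k -> `|tau - 1| <= k -> 0 < tau -> `|sg + tau * v| <= A ->
  `|v| <= A + 1 /\ tau * phi (sg + tau * v) <= phi v + e.
Proof.
move=> A0 phi0 phiS phiu k0 e0 k1 k2 k3 sgk tauk tau0 vA.
have k4 : k <= 1 / 2 by have : 0 < A * k by [rewrite mulr_gt0]; nra.
have [tauk1 tauk2] : 1 - k <= tau /\ tau <= 1 + k.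
  by move: tauk; rewrite ler_norml => /andP[? ?]; split; lra.
have vE : `|v| <= A + 1.
  have h1 : tau * `|v| <= A + k.
    rewrite -{1}(gtr0_norm tau0) -normrM -(addrK sg (tau * v)) (addrC (tau * v)).
    by rewrite (le_trans (ler_normB _ _))// lerD.
  have h4 : (1 - k) * `|v| <= A + k by rewrite (le_trans _ h1)// ler_wpM2r.
  rewrite leNgt; apply/negP => h5.
  have h6 : (1 - k) * (A + 1) < (1 - k) * `|v| by rewrite ltr_pM2l//; lra.
  by clear -h4 h6 k1; lra.
split=> //.
have vd : `|v - (sg + tau * v)| <= d.
  rewrite (_ : v - (sg + tau * v) = - (sg + (tau - 1) * v)); last by ring.
  rewrite normrN (le_trans (ler_normD _ _))// (normrM (tau - 1)) (le_trans _ k2)//.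
  have : `|tau - 1| * `|v| <= k * (A + 1) by rewrite ler_pM.
  lra.
have := phiu v (sg + tau * v) vE vd.
rewrite distrC ler_norml => /andP[_ h].
have h1 : phi (sg + tau * v) <= phi v + e / 4 by lra.
have h3 : tau * phi (sg + tau * v) <= (1 + k) * (phi v + e / 4) by rewrite ler_pM// ltW.
have h5 : k * phi v <= k * S by rewrite ler_wpM2l ?phiS// ltW.
have h6 : k * e <= 1 / 2 * e by rewrite ler_wpM2r// ltW.
by clear -h3 h5 h6 k3 e0; lra.
Qed.

(** After the substitution, [H] is evaluated at the same points on both sides, so only densities are
    compared and measurability and growth of [H] suffice; [d] is chosen before [H]. The lower bound
    [eta] on the scale is what makes the substitution close to the identity. *)
Lemma Ex_affine_le (C eta D eps : R) : 0 <= C -> 0 < eta -> 0 <= D -> 0 < eps ->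
  exists2 d : R, 0 < d & forall (H : R -> R) (s t s' t' : R),
    measurable_fun setT H -> (forall z, 0 <= H z <= D * weight r z) ->
    `|s'| <= C -> eta <= t' <= C -> `|s - s'| <= d -> `|t - t'| <= d ->
    Ex f (fun u => H (s + t * u)) <= Ex f (fun u => H (s' + t' * u)) + eps.
Proof.
move=> C0 eta0 D0 eps0.
have [mf f0 _] := wf.
pose D1 := D * (1 + (C + 1)) `^ r.
have D10 : 0 <= D1 by rewrite mulr_ge0// powR_ge0.
have D4 : 0 < 4 * (D1 + 1) by rewrite mulr_gt0//; lra.
have [A A0 tailA] := Ex_tail wf (divr_gt0 eps0 D4).
pose W := (1 + (A + 1)) `^ r.
have W0 : 0 <= W by exact: powR_ge0.
pose D2 := D1 * W.
have D20 : 0 <= D2 by rewrite mulr_ge0.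
pose e0 := eps / (8 * (D2 + 1)).
have D2p : 0 < D2 + 1 by rewrite ltr_wpDl.
have D1p : 0 < D1 + 1 by rewrite ltr_wpDl.
have Ap : 0 < A + 1 by rewrite addr_gt0.
have e00 : 0 < e0 by rewrite divr_gt0// mulr_gt0.
have [g [cg mg gI]] := continuous_L1_approx r0 wf (A + 1) e00.
(* The positive part keeps the integrands of the change of variables nonnegative; since [f] is
   nonnegative, both [f <= |f - g| + phi] and [phi <= f + |f - g|] survive. *)
pose phi : R -> R := fun u => Num.max (g u) 0.
have cphi : continuous phi.
  by move=> x; apply: (@continuous_max _ _ _ (cst 0)); [exact: cg|exact: cst_continuous].
have mphi : measurable_fun setT phi by exact: measurable_maxr.
have phi0 u : 0 <= phi u by rewrite le_max lexx orbT.
have [S0 [_ HS]] : bounded_set (phi @` `[- (A + 1), A + 1]).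
  apply: compact_bounded; apply: continuous_compact; last exact: segment_compact.
  exact: continuous_subspaceT.
pose S := `|S0| + 1.
have Sgt0 : 0 < S by rewrite ltr_wpDl.
have {}HS u : `|u| <= A + 1 -> phi u <= S.
  rewrite ler_norml => uA; apply: (le_trans (ler_norm _)).
  apply: (HS S); first by rewrite (le_lt_trans (ler_norm _))// ltrDl.
  by exists u => //=; rewrite in_itv.
pose e2 := eps / (8 * (D2 + 1) * (A + 1)).
have e20 : 0 < e2 by rewrite divr_gt0// !mulr_gt0.
have [d2 d20 Hd2'] := @segment_unif_continuous _ phi (- (A + 1)) (A + 1) _ cphi
  (divr_gt0 e20 (@ltr0Sn R 3)).
have Hd2 x y : `|x| <= A + 1 -> `|x - y| <= d2 -> `|phi x - phi y| <= e2 / 4.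
  by rewrite ler_norml; exact: Hd2'.
pose k0 := Num.min (1 / (A + 2)) (Num.min (d2 / (A + 2)) (e2 / (2 * S))).
have A2 : 0 < A + 2 by lra.
have S2 : 0 < 2 * S by rewrite mulr_gt0.
have k00 : 0 < k0.
  rewrite !lt_min; apply/and3P; split; exact: divr_gt0.
have k1 : k0 * (A + 2) <= 1 by rewrite -ler_pdivlMr ?ge_min ?lexx.
have k2 : k0 * (A + 2) <= d2.
  by rewrite -ler_pdivlMr ?ge_min ?lexx ?orbT.
have k3 : k0 * (2 * S) <= e2.
  by rewrite -ler_pdivlMr ?ge_min ?lexx ?orbT// mulr_gt0.
have k4 : k0 <= 1 / 2.
  by have : 0 < A * k0 by [rewrite mulr_gt0]; clear -k1 r f r0 wf; nra.
pose d := Num.min 1 (eta * k0 / 2).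
have d0 : 0 < d by rewrite lt_min ltr01/= divr_gt0// mulr_gt0.
exists d => // H s t s' t' mH HD s'C t'12 ss tt.
have [[t0 t'0 sC tC t'C] [sgk tauk]] :=
  affine_perturb_bounds C0 eta0 k00 k4 s'C t'12 ss tt.
have s'C' : `|s'| <= C + 1 by rewrite (le_trans s'C)// lerDl.
pose tau := t' / t; pose sg := (s' - s) / t.
have tau0 : 0 < tau by rewrite divr_gt0.
have Haff v : s + t * (sg + tau * v) = s' + t' * v.
  by rewrite /sg /tau; field; exact: lt0r_neq0.
have HW (a b u : R) : `|a| <= C + 1 -> `|b| <= C + 1 -> H (a + b * u) <= D1 * weight r u.
  move=> aC bC; have /andP[_ h] := HD (a + b * u).
  by rewrite (le_trans h)// /D1 -mulrA ler_wpM2l// weight_affine.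
have HD2 (a b u : R) : `|a| <= C + 1 -> `|b| <= C + 1 -> `|u| <= A + 1 ->
    H (a + b * u) <= D2.
  move=> aC bC uA; rewrite (le_trans (HW a b u aC bC))// ler_wpM2l//.
  by rewrite /weight /W ge0_ler_powR ?nnegrE ?addr_ge0// ?lerD2l// ltW.
have H0 z : 0 <= H z by have /andP[] := HD z.
have mHa (a b : R) : measurable_fun setT (fun u : R => H (a + b * u)).
  apply: (measurableT_comp mH).
  by apply: measurable_funD => //; apply: measurable_funM.
have dH := dominated_affine r0 s t mH HD.
have dH' := dominated_affine r0 s' t' mH HD.
have mT := measurable_normr_gt A.
have mB : measurable (`[- A, A]%classic : set R) by exact: measurable_itv.
pose E : set R := `[- (A + 1), A + 1]%classic.
have mE : measurable E by exact: measurable_itv.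
(* [q1] is the tail beyond [A], [q2] the error of the continuous approximation, [K] the main term
   with the continuous density, and [q3] the error of its uniform continuity. [P1] introduces [K]
   before the substitution and [P2] removes it afterwards, so [q2] is paid twice: [eps / 4] for
   [q1], two times [eps / 8] for [q2], [eps / 4] for [q3]. *)
pose q1 (u : R) : R := D1 * (weight r u * \1_[set v : R | A < `|v|] u * f u).
pose q2 (u : R) : R := D2 * (\1_E u * `|f u - g u|).
pose K (u : R) : R := \1_(`[- A, A]%classic : set R) u * H (s + t * u) * phi u.
pose q3 (u : R) : R := D2 * e2 * \1_E u.
have indic01 (B : set R) u : 0 <= (\1_B u : R) by rewrite indicE ler0n.
have indE u : `|u| <= A + 1 -> \1_E u = 1 :> R.
  by move=> uE; rewrite indicE mem_set//= /E/= in_itv/= -ler_norml.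
have indA u : `|u| <= A -> \1_(`[- A, A]%classic : set R) u = 1 :> R.
  by move=> uE; rewrite indicE mem_set//= in_itv/= -ler_norml.
have q10 u : 0 <= q1 u by apply: mulr_ge0 => //; rewrite !mulr_ge0 ?weight_ge0 ?indic01 ?f0.
have q20 u : 0 <= q2 u by apply: mulr_ge0 => //; rewrite mulr_ge0 ?indic01.
have q30 u : 0 <= q3 u by apply: mulr_ge0 => //; apply: mulr_ge0 => //; exact: ltW.
have K0 u : 0 <= K u by rewrite !mulr_ge0 ?indic01 ?H0 ?phi0.
have mq1 : measurable_fun setT q1.
  apply: measurable_funM => //; apply: measurable_funM; last exact: mf.
  by apply: measurable_funM; [exact: measurable_weight|exact: measurable_indic].
have mq2 : measurable_fun setT q2.
  apply: measurable_funM => //; apply: measurable_funM; first exact: measurable_indic.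
  by apply: measurableT_comp => //; exact: measurable_funB.
have mq3 : measurable_fun setT q3.
  by apply: measurable_funM => //; exact: measurable_indic.
have mK : measurable_fun setT K.
  by apply: measurable_funM => //; apply: measurable_funM; [exact: measurable_indic|].
have mK' : measurable_fun setT (fun v : R => K (sg + tau * v) * tau).
  apply: measurable_funM => //; apply: (measurableT_comp mK).
  by apply: measurable_funD => //; apply: measurable_funM.
have phif u : phi u <= f u + `|f u - g u|.
  rewrite /phi ge_max; have := ler_norm (g u - f u); rewrite distrC => h.
  by rewrite addr_ge0// andbT; clear -h r f r0 wf; lra.
have mHf (a b : R) : measurable_fun setT (fun u : R => H (a + b * u) * f u).
  exact: measurable_funM.
have P1 u : H (s + t * u) * f u <= q1 u + q2 u + K u.
  have [uA|uA] := ltP A `|u|.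
    have -> : q1 u = D1 * weight r u * f u.
      by rewrite /q1 indicE (mem_set (uA : [set v | A < `|v|] u)) mulr1 mulrA.
    rewrite -addrA (@le_trans _ _ (D1 * weight r u * f u))// ?ler_wpM2r// ?HW//.
    by rewrite lerDl addr_ge0.
  have uE : `|u| <= A + 1 by rewrite (le_trans uA)// lerDl.
  rewrite (@le_trans _ _ (q2 u + K u))//; last by rewrite -addrA lerDr.
  rewrite /q2 /K indE// indA// !mul1r.
  have h1 : H (s + t * u) <= D2 by exact: HD2.
  have h2 : f u <= `|f u - g u| + phi u.
    have : g u <= phi u by rewrite le_max lexx.
    by have := ler_norm (f u - g u); clear -r f r0 wf; lra.
  rewrite (@le_trans _ _ (H (s + t * u) * (`|f u - g u| + phi u)))// ?ler_wpM2l//.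
  by rewrite mulrDr lerD2r ler_wpM2r.
have P2 v : K (sg + tau * v) * tau <= H (s' + t' * v) * f v + q2 v + q3 v.
  have [vA|vA] := leP `|sg + tau * v| A; last first.
    rewrite /K indicE memNset ?mul0r; last first.
      by rewrite /= in_itv/= -ler_norml; apply/negP; rewrite -ltNge.
    by rewrite !addr_ge0// mulr_ge0.
  have [vE hphi] := affine_perturb_phi A0 phi0 HS Hd2 k00 e20 k1 k2 k3 sgk tauk tau0 vA.
  rewrite /K Haff /q2 /q3 indE// indA//.
  rewrite !mul1r mulr1 -mulrA (mulrC (phi _)).
  have h1 : H (s' + t' * v) <= D2 by exact: HD2.
  rewrite (@le_trans _ _ (H (s' + t' * v) * (f v + `|f v - g v| + e2)))//.
    by rewrite ler_wpM2l// (le_trans hphi)// lerD2r.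
  by rewrite !mulrDr !lerD// ler_wpM2r// ltW.
rewrite -lee_fin EFinD -(Ex_EFin wf dH) -(Ex_EFin wf dH').
have I2 : (\int[mu]_u (q2 u)%:E <= (eps / 8)%:E)%E.
  rewrite integral_realZ//; last first.
    apply: measurable_funM; first exact: measurable_indic.
    by apply: measurableT_comp => //; exact: measurable_funB.
  apply: (@le_trans _ _ (D2%:E * e0%:E)%E); first by rewrite lee_wpmul2l ?lee_fin.
  rewrite -EFinM lee_fin /e0 mulrA ler_pdivrMr ?mulr_gt0//.
  rewrite (_ : eps / 8 * _ = eps * (D2 + 1)); last by field.
  by rewrite mulrC ler_wpM2l ?(ltW eps0)// lerDl.
have I3 : (\int[mu]_u (q3 u)%:E <= (eps / 4)%:E)%E.
  rewrite integral_realZ ?(mulr_ge0 D20 (ltW e20))//.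
  rewrite integral_indic// setIT.
  have EE := lebesgue_measure_itv (`[- (A + 1), (A + 1)] : interval R).
  rewrite /= in EE; rewrite [X in (_ * X)%E]EE lte_fin.
  rewrite ifT; last by rewrite gtrN.
  rewrite -EFinD -EFinM lee_fin.
  have -> : D2 * e2 * (A + 1 - - (A + 1)) = D2 / (D2 + 1) * (eps / 4).
    by rewrite /e2; field; rewrite !lt0r_neq0.
  by rewrite ger_pMl ?divr_gt0// ler_pdivrMr// mul1r lerDl.
have I1 : (\int[mu]_u (q1 u)%:E <= (eps / 4)%:E)%E.
  rewrite integral_realZ//; last 2 first.
  - apply: measurable_funM => //.
    by apply: measurable_funM; [exact: measurable_weight|exact: measurable_indic].
  - by move=> u; rewrite !mulr_ge0// weight_ge0.
  rewrite (Ex_EFin wf); last first.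
    by apply: dominated_indic => //; exact: dominated_weight.
  rewrite -EFinM lee_fin (le_trans (ler_wpM2l D10 tailA))//.
  have -> : D1 * (eps / (4 * (D1 + 1))) = D1 / (D1 + 1) * (eps / 4).
    by field; rewrite lt0r_neq0.
  by rewrite ger_pMl ?divr_gt0// ler_pdivrMr// mul1r lerDl.
apply: (@le_trans _ _ (\int[mu]_u (q1 u + q2 u + K u)%:E)%E).
  apply: le_integral_real => //.
  - by do 2 (apply: measurable_funD => //).
  - by move=> u; rewrite mulr_ge0//= P1.
rewrite integral_realD//; [|exact: measurable_funD|by move=> u; rewrite addr_ge0].
rewrite integral_realD// (integral_affine sg tau0 mK K0).
have IK : (\int[mu]_v (K (sg + tau * v) * tau)%:E <=
    \int[mu]_u (H (s' + t' * u) * f u)%:E + \int[mu]_u (q2 u)%:E + \int[mu]_u (q3 u)%:E)%E.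
  rewrite -!integral_realD//; first last.
  - by move=> u; rewrite mulr_ge0.
  - by move=> u; rewrite addr_ge0// mulr_ge0.
  - exact: measurable_funD.
  apply: le_integral_real => //.
  - by do 2 (apply: measurable_funD => //).
  - by move=> v; rewrite P2 andbT mulr_ge0// ltW.
apply: (le_trans (leeD (leeD I1 I2) IK)).
rewrite (Ex_EFin wf dH').
apply: (le_trans (leeD (lexx _) (leeD (leeD (lexx _) I2) I3))).
by rewrite -!EFinD lee_fin; clear -eps0 r f r0 wf; lra.
Qed.

End affine_perturbation.

(** * Harris ergodic theorem *)

Section harris.
Context d (T : measurableType d) (R : realType).
Variable V : T -> R.
Hypotheses (mV : measurable_fun setT V) (V1 : forall x, 1 <= V x).

Definition Vbounded (g : T -> R) :=
  measurable_fun setT g /\ exists c, forall x, `|g x| <= c * V x.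

(** What remains of a transition kernel when it acts on functions bounded by a multiple of [V]. The
    last field is its countable additivity; it is what later turns the limit functional into a
    measure. *)
Record Vop (P : (T -> R) -> T -> R) : Prop := {
  Vop_stable : forall g, Vbounded g -> Vbounded (P g) ;
  VopD : forall g h x, Vbounded g -> Vbounded h -> P (g \+ h) x = P g x + P h x ;
  VopZ : forall c g x, Vbounded g -> P (fun y => c * g y) x = c * P g x ;
  Vop_le : forall g h x, Vbounded g -> Vbounded h -> (forall y, g y <= h y) ->
    P g x <= P h x ;
  Vop_cvg0 : forall (k : nat -> T -> R) l x, (forall n, measurable_fun setT (k n)) ->
    Vbounded l -> (forall n y, `|k n y| <= l y) ->
    (forall y, k ^~ y @ \oo --> 0) -> (fun n => P (k n) x) @ \oo --> 0 }.

Let V0 x : 0 < V x. Proof. exact: lt_le_trans (V1 x). Qed.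

Lemma VboundedV : Vbounded V.
Proof. by split=> //; exists 1 => x; rewrite mul1r gtr0_norm. Qed.

Lemma Vbounded_cst c : Vbounded (fun=> c).
Proof. by split=> //; exists `|c| => x; rewrite ler_peMr. Qed.

Lemma VboundedD g h : Vbounded g -> Vbounded h -> Vbounded (g \+ h).
Proof.
move=> [mg [c hc]] [mh [e he]]; split; first exact: measurable_funD.
by exists (c + e) => x; rewrite (le_trans (ler_normD _ _))// mulrDl lerD.
Qed.

Lemma VboundedZ a g : Vbounded g -> Vbounded (fun x => a * g x).
Proof.
move=> [mg [c hc]]; split; first exact: measurable_funM.
by exists (`|a| * c) => x; rewrite normrM -mulrA ler_wpM2l.
Qed.

Lemma Vbounded_le (g h : T -> R) : measurable_fun setT g -> Vbounded h ->
  (forall x, `|g x| <= h x) -> Vbounded g.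
Proof.
move=> mg [_ [c hc]] gh; split=> //; exists c => x.
by rewrite (le_trans (gh x))// (le_trans (ler_norm _)).
Qed.

Lemma Vbounded_indic (A : set T) : measurable A -> Vbounded (\1_A : T -> R).
Proof.
move=> mA; apply: (@Vbounded_le _ (fun=> 1)); first exact: measurable_indic.
- exact: Vbounded_cst.
- by move=> x; rewrite indicE; case: (_ \in _); rewrite ?normr1 ?normr0.
Qed.

Lemma Vop_norm_le P g h x : Vop P -> Vbounded g -> Vbounded h ->
  (forall y, `|g y| <= h y) -> `|P g x| <= P h x.
Proof.
move=> oP bg bh gh; rewrite ler_norml; apply/andP; split.
- rewrite -mulN1r -(VopZ oP)//; apply: (Vop_le oP) => //; first exact: VboundedZ.
  by move=> y; rewrite mulN1r; have := gh y; rewrite ler_norml => /andP[].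
- by apply: (Vop_le oP) => // y; rewrite (le_trans (ler_norm _)).
Qed.

Lemma Vop_iter P n : Vop P -> Vop (iter n P).
Proof.
move=> oP; elim: n => [|n IH].
  by split=> //= k l x mk bl kl; exact.
split=> /=.
- by move=> g bg; apply: (Vop_stable oP); exact: (Vop_stable IH).
- move=> g h x bg bh.
  rewrite (_ : iter n P (g \+ h) = iter n P g \+ iter n P h).
    by rewrite (VopD oP)//; exact: (Vop_stable IH).
  by apply/funext => y; rewrite (VopD IH).
- move=> c g x bg.
  rewrite (_ : iter n P _ = fun y => c * iter n P g y).
    by rewrite (VopZ oP)//; exact: (Vop_stable IH).
  by apply/funext => y; rewrite (VopZ IH).
- move=> g h x bg bh gh; apply: (Vop_le oP); [exact: (Vop_stable IH)..|].
  by move=> y; exact: (Vop_le IH).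
- move=> k l x mk bl kl k0.
  have bk m : Vbounded (k m) by exact: Vbounded_le (kl m).
  apply: (@Vop_cvg0 _ oP _ (iter n P l)).
  - by move=> m; have [] := Vop_stable IH (bk m).
  - exact: (Vop_stable IH).
  - by move=> m y; exact: Vop_norm_le.
  - by move=> y; exact: (@Vop_cvg0 _ IH k l).
Qed.

Lemma Vop_cst1 P c x : Vop P -> P (fun=> 1) x = 1 -> P (fun=> c) x = c.
Proof.
move=> oP P1; rewrite (_ : (fun=> c) = (fun y => c * (fun=> 1) y)); last first.
  by apply/funext => y; rewrite mulr1.
by rewrite (VopZ oP) ?P1 ?mulr1//; exact: Vbounded_cst.
Qed.

(* The weighted oscillation seminorm of Hairer and Mattingly: a function with
   |phi x - phi y| <= s (2 + b (V x + V y)) can be shifted by a constant so as to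
   satisfy |phi| <= s (1 + b V). *)
Lemma oscillation_center (phi : T -> R) (b s : R) (x0 : T) :
  (forall x y, `|phi x - phi y| <= s * (2 + b * (V x + V y))) ->
  exists c, forall x, `|phi x + c| <= s * (1 + b * V x).
Proof.
move=> H.
pose A := [set s * (1 + b * V x) - phi x | x in setT].
have lA y : lbound A (- (s * (1 + b * V y)) - phi y).
  move=> _ [x _ <-]; have := H x y; rewrite ler_norml => /andP[_]; lra.
have hA : has_inf A.
  split; first by exists (s * (1 + b * V x0) - phi x0), x0.
  by exists (- (s * (1 + b * V x0)) - phi x0); exact: lA.
exists (inf A) => x; rewrite ler_norml; apply/andP; split.
- have : - (s * (1 + b * V x)) - phi x <= inf A.
    by apply: lb_le_inf; [case: hA|exact: lA].
  lra.
- have : inf A <= s * (1 + b * V x) - phi x.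
    by apply: ge_inf; [case: hA|exists x].
  lra.
Qed.

(** Centering [phi] leaves the difference unchanged because [P] preserves constants. If [V x + V y]
    is at least [R0], the drift alone shrinks the weight; otherwise both points lie in the sublevel
    set, and subtracting the common part [nu] gains [2 * al]. *)
Lemma oscillation_contraction P nu (g K R0 : R) :
  Vop P -> (forall x, P (fun=> 1) x = 1) ->
  g < 1 -> 0 <= K -> (forall x, P V x <= g * V x + K) ->
  2 * K < (1 - g) * R0 ->
  (forall h k, Vbounded h -> Vbounded k -> nu (h \+ k) = nu h + nu k) ->
  (forall c h, Vbounded h -> nu (fun y => c * h y) = c * nu h) ->
  (forall h, Vbounded h -> (forall y, 0 <= h y) -> 0 <= nu h) ->
  0 < nu (fun=> 1) ->
  (forall h x, Vbounded h -> (forall y, 0 <= h y) -> V x <= R0 -> nu h <= P h x) ->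
  exists2 b : R, 0 < b & exists2 a : R, a < 1 &
  forall phi s, Vbounded phi -> 0 <= s ->
    (forall x y, `|phi x - phi y| <= s * (2 + b * (V x + V y))) ->
    (forall x y, `|P phi x - P phi y| <= a * s * (2 + b * (V x + V y))).
Proof.
move=> oP P1 g1 K0 drift hR0 nuD nuZ nu0 nu1 minor.
set al := nu (fun=> 1) in nu1.
(* The weight [b] is so small that the additive drift constant, which enters as [2 * (b * K)], uses
   up at most half of the gain [2 * al]. *)
pose b := al / (2 * (K + 1)).
have K10 : 0 < 2 * (K + 1) by rewrite mulr_gt0// ltr_wpDl.
have b0 : 0 < b by rewrite divr_gt0.
have bK : b * K <= al / 2.
  rewrite /b mulrAC ler_pdivrMr// (_ : al / 2 * _ = al * (K + 1)); last by field.
  by rewrite ler_wpM2l ?(ltW nu1)// lerDl.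
have g10 : 0 < 1 - g by rewrite subr_gt0.
have R00 : 0 < R0 by rewrite -(pmulr_rgt0 _ g10) (le_lt_trans _ hR0)// mulr_ge0.
have bR0 : 0 < 2 + b * R0 by rewrite addr_gt0// mulr_gt0.
have hR0' : 0 < (1 - g) * R0 - 2 * K by rewrite subr_gt0.
(* The first entry controls the coefficient of [V x + V y] in both regimes, the second the constant
   term near the centre, and the third is the far regime at its worst point [V x + V y = R0]. *)
pose e := Num.min (1 - g) (Num.min (al / 2) (b * ((1 - g) * R0 - 2 * K) / (2 + b * R0))).
have e0 : 0 < e.
  rewrite !lt_min; apply/and3P; split=> //; first exact: divr_gt0.
  by rewrite divr_gt0// mulr_gt0.
have e1 : e <= 1 - g by rewrite ge_min lexx.
have e2 : e <= al / 2 by rewrite !ge_min lexx !orbT.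
have e3 : e * (2 + b * R0) <= b * ((1 - g) * R0 - 2 * K).
  by rewrite -ler_pdivlMr// !ge_min lexx !orbT.
clearbody e b.
exists b => //; exists (1 - e); first by rewrite ltrBlDr ltrDl.
move=> phi s bphi s0 Hphi x y.
have [c Hc] := oscillation_center x Hphi.
pose psi := phi \+ (fun=> c).
have bc := Vbounded_cst c.
have bpsi : Vbounded psi by exact: VboundedD.
have Ppsi z : P psi z = P phi z + c by rewrite (VopD oP)// Vop_cst1.
have -> : P phi x - P phi y = P psi x - P psi y by rewrite !Ppsi; ring.
pose U := fun z => s * (1 + b * V z).
pose U1 := (fun=> s) \+ (fun z => (s * b) * V z).
have UE : U = U1 by apply/funext => z; rewrite /U /U1/=; ring.
have bU : Vbounded U.
  by rewrite UE; apply: VboundedD; [exact: Vbounded_cst|exact/VboundedZ/VboundedV].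
have PU z : P U z <= s * (1 + b * (g * V z + K)).
  rewrite UE (VopD oP); [|exact: Vbounded_cst|exact/VboundedZ/VboundedV].
  rewrite Vop_cst1// (VopZ oP); last exact: VboundedV.
  have := ler_wpM2l (mulr_ge0 s0 (ltW b0)) (drift z); move: (P V z) => Pz h.
  by clear -h V mV V1; lra.
have nuU : s * al <= nu U.
  rewrite UE nuD; [|exact: Vbounded_cst|exact/VboundedZ/VboundedV].
  rewrite [in leRHS](_ : (fun=> s) = fun z : T => s * (fun=> 1) z); last first.
    by apply/funext => z; rewrite mulr1.
  rewrite nuZ ?lerDl; last exact: Vbounded_cst.
  apply: nu0; first exact/VboundedZ/VboundedV.
  by move=> z; rewrite !mulr_ge0// ltW.
set S := V x + V y.
have bnd1 z : `|P psi z| <= P U z by exact: Vop_norm_le.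
have S0 : 0 < S by rewrite addr_gt0.
have [SR|RS] := leP R0 S.
  have h1 : `|P psi x - P psi y| <= s * (2 + b * g * S + 2 * (b * K)).
    rewrite (le_trans (ler_normB _ _))//.
    rewrite (le_trans (lerD (bnd1 x) (bnd1 y)))//.
    rewrite (le_trans (lerD (PU x) (PU y)))// /S.
    by clear -V mV V1; lra.
  rewrite (le_trans h1)// (mulrC (1 - e) s) -(mulrA s) ler_wpM2l//.
  have h2 : (b * (1 - g) - e * b) * R0 <= (b * (1 - g) - e * b) * S.
    by rewrite ler_wpM2l// subr_ge0 mulrC ler_wpM2l ?(ltW b0).
  by clearbody S; clear -V mV V1 h2 e3; lra.
have Vx : V x <= R0 by rewrite (le_trans _ (ltW RS))// lerDl ltW.
have Vy : V y <= R0 by rewrite (le_trans _ (ltW RS))// lerDr ltW.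
have bpsiN : Vbounded (fun z => -1 * psi z) by exact: VboundedZ.
(* Both [U + psi] and [U - psi] are nonnegative; applying the minorization to each bounds
   [P psi z - nu psi] from the two sides. *)
have bnd2 z : V z <= R0 -> `|P psi z - nu psi| <= P U z - nu U.
  move=> Vz.
  have h1 : nu (U \+ psi) <= P (U \+ psi) z.
    apply: minor => //; first exact: VboundedD.
    move=> w; have := Hc w; rewrite ler_norml -/(U w) /= /psi/= => /andP[h _].
    by rewrite -lerBlDl sub0r.
  have h2 : nu (U \+ (fun z => -1 * psi z)) <= P (U \+ (fun z => -1 * psi z)) z.
    apply: minor => //; first exact: VboundedD.
    move=> w; have := Hc w; rewrite ler_norml -/(U w) /= /psi/= => /andP[_ h].
    by rewrite mulN1r subr_ge0.
  rewrite (VopD oP)// nuD// in h1.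
  rewrite (VopD oP)// nuD// (VopZ oP (-1) z bpsi) (nuZ (-1) _ bpsi) in h2.
  move: (nu U) (nu psi) (P U z) (P psi z) h1 h2 => n1 n2 p1 p2 h1 h2.
  by rewrite ler_norml; clear -V mV V1 h1 h2; apply/andP; split; lra.
have -> : P psi x - P psi y = (P psi x - nu psi) - (P psi y - nu psi) by ring.
rewrite (le_trans (ler_normB _ _))//.
rewrite (le_trans (lerD (bnd2 x Vx) (bnd2 y Vy)))//.
apply: (@le_trans _ _ (s * (2 + b * g * S + 2 * (b * K) - 2 * al))).
  have h1 := PU x; have h2 := PU y; rewrite /S.
  move: (nu U) (P U x) (P U y) nuU h1 h2 => n1 p1 p2 h0 h1 h2.
  by clearbody al; clear -V mV V1 h0 h1 h2; lra.
rewrite (mulrC (1 - e) s) -(mulrA s) ler_wpM2l//.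
have h : e * b * S <= (1 - g) * b * S.
  by rewrite ler_wpM2r ?(ltW S0)// ler_wpM2r ?(ltW b0).
by clearbody S al; clear -V mV V1 h bK e2; lra.
Qed.

End harris.

(** * Representation of a positive functional by a probability *)

Section daniell.
Context d (T : measurableType d) (R : realType).
Variable V : T -> R.
Hypotheses (mV : measurable_fun setT V) (V1 : forall x, 1 <= V x).
Variable L : (T -> R) -> R.
Hypotheses
  (LD : forall g h, Vbounded V g -> Vbounded V h -> L (g \+ h) = L g + L h)
  (LZ : forall c g, Vbounded V g -> L (fun y => c * g y) = c * L g)
  (L_ge0 : forall g, Vbounded V g -> (forall y, 0 <= g y) -> 0 <= L g)
  (L1 : L (fun=> 1) = 1)
  (L_cvg0 : forall (k : nat -> T -> R) l, (forall n, measurable_fun setT (k n)) ->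
    Vbounded V l -> (forall n y, `|k n y| <= l y) ->
    (forall y, k ^~ y @ \oo --> 0) -> (fun n => L (k n)) @ \oo --> 0).

(** The absolute value matters only off the measurable sets, where [L] has no sign: a measure has to
    be nonnegative as a function of all sets. *)
Let daniell_set (A : set T) : \bar R := (`|L (\1_A)|)%:E.

Let daniell_setE A : measurable A -> daniell_set A = (L (\1_A))%:E.
Proof.
move=> mA; rewrite /daniell_set ger0_norm// L_ge0//; exact: Vbounded_indic.
Qed.

Let L0 : L (fun=> 0) = 0.
Proof.
rewrite (_ : (fun=> 0) = (fun y : T => 0 * (fun=> 1) y)).
  by rewrite LZ ?mul0r//; exact: Vbounded_cst.
by apply/funext => y; rewrite mul0r.
Qed.

Let LB g h : Vbounded V g -> Vbounded V h -> L (fun y => g y - h y) = L g - L h.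
Proof.
move=> bg bh; rewrite -mulN1r -LZ// -LD//; last exact: VboundedZ.
by congr L; apply/funext => y /=; rewrite mulN1r.
Qed.

Lemma functional_sum (I : Type) (s : seq I) (F : I -> T -> R) :
  (forall i, Vbounded V (F i)) ->
  L (fun y => \sum_(i <- s) F i y) = \sum_(i <- s) L (F i) /\
  Vbounded V (fun y => \sum_(i <- s) F i y).
Proof.
move=> bF; elim: s => [|i s [IH1 IH2]].
  rewrite big_nil (_ : (fun _ => _) = fun=> 0).
    by split=> //; exact: Vbounded_cst.
  by apply/funext => y; rewrite big_nil.
rewrite (_ : (fun _ => _) = F i \+ (fun y => \sum_(j <- s) F j y)); last first.
  by apply/funext => y; rewrite big_cons.
by rewrite big_cons LD// IH1; split=> //; exact: VboundedD.
Qed.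

Let daniell0 : daniell_set set0 = 0%E.
Proof.
rewrite daniell_setE// (_ : \1_set0 = fun=> 0) ?L0//.
by apply/funext => y; rewrite indic0.
Qed.

Let daniell_ge0 A : (0 <= daniell_set A)%E.
Proof. by rewrite lee_fin. Qed.

(** The indicator of the union minus the partial sums is bounded by 1 and eventually 0 at each
    point, so [L] of it tends to 0. *)
Let daniell_sigma_additive : semi_sigma_additive daniell_set.
Proof.
move=> F mF tF mUF.
rewrite daniell_setE//.
pose U : T -> R := \1_(\bigcup_n F n).
pose s n : T -> R := fun y => \sum_(0 <= i < n) (\1_(F i) y).
have bF i : Vbounded V (\1_(F i)) by exact: Vbounded_indic.
have bU : Vbounded V U by exact: Vbounded_indic.
have bs n : Vbounded V (s n) by have [] := functional_sum (index_iota 0 n) bF.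
have sE n : (\sum_(0 <= i < n) daniell_set (F i))%E = (L (s n))%:E.
  rewrite (functional_sum (index_iota 0 n) bF).1 -sumEFin.
  by apply: eq_bigr => i _; rewrite daniell_setE.
rewrite (_ : (fun n => _) = (fun n => (L (s n))%:E)); last exact/funext.
have s_out y n : ~ (\bigcup_n F n) y -> s n y = 0.
  move=> nU; rewrite /s big1// => i _; rewrite indicE memNset// => Fi.
  by apply: nU; exists i.
have s_in y n j : F j y -> s n y = ((j < n)%N)%:R.
  move=> Fj; rewrite /s; have [jn|nj] := ltnP j n.
    rewrite (bigD1_seq j)//=; [|by rewrite mem_index_iota|exact: iota_uniq].
    rewrite indicE mem_set// big1 ?addr0// => i ij.
    rewrite indicE memNset// => Fi; move/trivIsetP : tF => /(_ i j I I ij) /seteqP[+ _].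
    by move=> /(_ y); exact.
  rewrite big_nat_cond big1// => i /andP[/andP[_ iN] _].
  rewrite indicE memNset// => Fi; have ij : i != j.
    by rewrite neq_ltn (leq_trans iN nj).
  move/trivIsetP : tF => /(_ i j I I ij) /seteqP[+ _].
  by move=> /(_ y); exact.
have : (fun n => L (fun y => U y - s n y)) @ \oo --> 0.
  apply: (@L_cvg0 _ (fun=> 1)).
  - by move=> n; apply: measurable_funB; [case: bU|case: (bs n)].
  - exact: Vbounded_cst.
  - move=> n y; have [[j _ Fj]|nU] := pselect ((\bigcup_n F n) y).
      rewrite (s_in y n j Fj) /U indicE mem_set; last by exists j.
      by case: (j < n)%N; rewrite ?subrr ?subr0 ?normr0 ?normr1.
    by rewrite s_out// /U indicE memNset// subrr normr0.
  - move=> y; have [[j _ Fj]|nU] := pselect ((\bigcup_n F n) y).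
      apply: cvg_near_cst; exists j.+1 => // n /= jn.
      by rewrite (s_in y n j Fj) jn /U indicE mem_set ?subrr//; exists j.
    apply: cvg_near_cst; apply: nearW => n.
    by rewrite s_out// /U indicE memNset// subrr.
move=> h; apply: cvg_EFin; first exact: nearW.
rewrite (_ : fine \o _ = (fun n => L U - L (fun y => U y - s n y))); last first.
  by apply/funext => n /=; rewrite LB// opprB addrC subrK.
rewrite -[X in _ --> X](subr0 (L U)).
by apply: cvgB => //; exact: cvg_cst.
Qed.

HB.instance Definition _ := isMeasure.Build _ _ _ daniell_set
  daniell0 daniell_ge0 daniell_sigma_additive.

Let daniell_setT : daniell_set setT = 1%E.
Proof. by rewrite daniell_setE// indicT L1. Qed.

HB.instance Definition _ := Measure_isProbability.Build _ _ _ daniell_set daniell_setT.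

Import HBNNSimple.

(** Simple functions are settled by linearity. For nonnegative [g] the approximants from below
    converge on the measure side by monotone convergence and on the side of [L] by its continuity
    along dominated null sequences. *)
Lemma daniell_representation : exists G : probability T R,
  (forall A, measurable A -> G A = (L (\1_A))%:E) /\
  forall g, Vbounded V g -> G.-integrable setT (EFin \o g) /\
    (\int[G]_x (g x)%:E = (L g)%:E)%E.
Proof.
pose G : probability T R := daniell_set.
exists G; split; first by move=> A mA; rewrite -daniell_setE.
have step (h : {nnsfun T >-> R}) : (\int[G]_x (h x)%:E = (L h)%:E)%E.
  rewrite integralT_nnsfun sintegralE fsbig_finite//=.
  pose s : seq R := finmap.enum_fset (fset_set (range h)).
  rewrite [in RHS](_ : (h : T -> R) =
      (fun y => \sum_(i <- s) (i * \1_(h @^-1` [set i]) y))); last first.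
    by apply/funext => y; rewrite [in LHS](fimfunE h y) fsbig_finite.
  have bF i : Vbounded V (fun y => i * \1_(h @^-1` [set i]) y).
    by apply: VboundedZ; exact: Vbounded_indic.
  have [-> _] := functional_sum s bF.
  rewrite -sumEFin; apply: eq_bigr => i _.
  rewrite LZ ?EFinM; last exact: Vbounded_indic.
  by congr (_ * _)%E; rewrite /G/= daniell_setE.
have pos g : Vbounded V g -> (forall y, 0 <= g y) ->
    (\int[G]_x (g x)%:E = (L g)%:E)%E.
  move=> bg g0.
  have mg : measurable_fun setT (EFin \o g) by apply/measurable_EFinP; case: bg.
  pose g_ := nnsfun_approx measurableT mg.
  have gcvg y : g_ ^~ y @ \oo --> g y.
    have g0' z : setT z -> (0 <= (EFin \o g) z)%E by rewrite lee_fin.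
    exact: (fine_cvg (@cvg_nnsfun_approx _ _ _ _ measurableT _ mg g0' y I)).
  have gn_nd y : nondecreasing_seq (g_ ^~ y).
    by move=> m n mn; exact/lefP/nd_nnsfun_approx.
  have gn_le n y : g_ n y <= g y.
    rewrite -(cvg_lim _ (gcvg y))//; apply: nondecreasing_cvgn_le => //.
    by apply/cvg_ex; exists (g y).
  have bg_ n : Vbounded V (g_ n).
    by apply: (Vbounded_le _ bg) => // y; rewrite ger0_norm.
  have H1 : ((fun n => \int[G]_x (g_ n x)%:E) @ \oo --> \int[G]_x (g x)%:E)%E.
    rewrite [X in _ --> X](_ : _ = (\int[G]_x limn (fun n => (g_ n x)%:E))%E).
      apply: (@cvg_monotone_convergence _ _ _ G setT measurableT (fun n x => (g_ n x)%:E)).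
      - by move=> n; apply/measurable_EFinP.
      - by move=> n x _; rewrite lee_fin.
      - by move=> x _ m n mn; rewrite lee_fin; exact: gn_nd.
    apply: eq_integral => x _; apply/esym/cvg_lim => //.
    by apply: cvg_EFin; [exact: nearW|exact: gcvg].
  have H2 : ((fun n => \int[G]_x (g_ n x)%:E) @ \oo --> (L g)%:E)%E.
    rewrite (_ : (fun n => _) = (fun n => (L (g_ n))%:E)); last first.
      by apply/funext => n; rewrite step.
    apply: cvg_EFin; first exact: nearW.
    have : (fun n => L (fun y => g y - g_ n y)) @ \oo --> 0.
      apply: (@L_cvg0 _ g) => //.
      - by move=> n; apply: measurable_funB => //; case: bg.
      - by move=> n y; rewrite ger0_norm ?subr_ge0// lerBlDr lerDl.
      - move=> y; rewrite -(subrr (g y)); apply: cvgB; [exact: cvg_cst|exact: gcvg].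
    move=> h; rewrite (_ : fine \o _ = (fun n => L g - L (fun y => g y - g_ n y))).
      by rewrite -[X in _ --> X](subr0 (L g)); apply: cvgB => //; exact: cvg_cst.
    by apply/funext => n /=; rewrite LB// opprB addrC subrK.
  exact: (cvg_unique _ H1 H2).
have posi g : Vbounded V g -> (forall y, 0 <= g y) -> G.-integrable setT (EFin \o g).
  move=> bg g0; apply/integrableP; split; first by apply/measurable_EFinP; case: bg.
  under eq_integral => x _ do rewrite /= ger0_norm//.
  by rewrite (pos g)// ltry.
move=> g bg; have [mg [c gc]] := bg.
(* A signed [g] is the difference of the nonnegative functions [g + h] and [h], both bounded by a
   multiple of [V]. *)
pose h y := `|c| * V y.
have bh : Vbounded V h by apply: VboundedZ; exact: VboundedV.
have h0 y : 0 <= h y by rewrite mulr_ge0// (le_trans ler01).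
have bgh : Vbounded V (g \+ h) by exact: VboundedD.
have gh0 y : 0 <= (g \+ h) y.
  have : `|g y| <= h y.
    by rewrite (le_trans (gc y))// ler_wpM2r ?ler_norm// (le_trans ler01).
  by rewrite ler_norml /= => /andP[+ _]; rewrite -subr_ge0 opprK.
have gE : (fun y => (g y)%:E) = (fun y => ((g \+ h) y)%:E - (h y)%:E)%E.
  by apply/funext => y; rewrite -EFinB /= addrK.
rewrite gE; split.
  rewrite (_ : EFin \o g = (fun y => ((g \+ h) y)%:E - (h y)%:E)%E)//.
  by apply: (integrableB measurableT) => //; exact: posi.
rewrite integralB_EFin//; [|exact: posi..].
by rewrite !pos// LD// -EFinB addrK.
Qed.

End daniell.

(** * Geometric convergence of the iterates *)

Section harris_theorem.
Context d (T : measurableType d) (R : realType).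
Variable V : T -> R.
Hypotheses (mV : measurable_fun setT V) (V1 : forall x, 1 <= V x).
Variables (P : (T -> R) -> T -> R) (g K : R).
Hypotheses (oP : Vop V P) (P1 : forall x, P (fun=> 1) x = 1).
Hypotheses (g0 : 0 <= g) (g1 : g < 1) (K0 : 0 <= K).
Hypothesis drift : forall x, P V x <= g * V x + K.

Let V0 x : 0 < V x. Proof. exact: lt_le_trans (V1 x). Qed.
Let g10 : 0 < 1 - g. Proof. by rewrite subr_gt0. Qed.
(** The sum of the geometric series of drift constants: it bounds the additive term of every iterate
    at once. *)
Let K1 := K / (1 - g).
Let K10 : 0 <= K1. Proof. by rewrite divr_ge0// ltW. Qed.
Let bV : Vbounded V V := VboundedV mV V1.

Lemma iter_cst1 n x : iter n P (fun=> 1) x = 1.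
Proof.
elim: n x => //= n IH x; rewrite (_ : iter n P _ = fun=> 1) ?P1//.
exact/funext.
Qed.

Lemma iter_drift n x : iter n P V x <= g ^+ n * V x + K1 * (1 - g ^+ n).
Proof.
elim: n x => [|n IH] x /=; first by rewrite expr0 mul1r subrr mulr0 addr0.
have bgV : Vbounded V (fun y => g ^+ n * V y) by exact: VboundedZ.
have bc c : Vbounded V (fun=> c) by exact: Vbounded_cst.
apply: (@le_trans _ _ (P ((fun y => g ^+ n * V y) \+ (fun=> K1 * (1 - g ^+ n))) x)).
  apply: (Vop_le oP) => //; first exact: (Vop_stable (Vop_iter n oP)).
  exact: VboundedD.
rewrite (VopD oP)// (VopZ oP)// (Vop_cst1 V1 _ oP)//.
have h1 : g ^+ n * P V x <= g ^+ n * (g * V x + K) by rewrite ler_wpM2l// exprn_ge0.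
have h2 : g ^+ n * K = g ^+ n * (K1 * (1 - g)) by rewrite /K1 divfK// gt_eqF.
rewrite exprSr; move: (P V x) h1 h2 => p h1 h2.
by lra.
Qed.

Lemma iter_drift_le n x : iter n P V x <= (1 + K1) * V x.
Proof.
apply: (le_trans (iter_drift n x)); rewrite mulrDl lerD//.
  by rewrite ler_wpM2r ?(ltW (V0 x))// exprn_ile1// ltW.
by rewrite ler_wpM2l// (le_trans _ (V1 x))// gerBl exprn_ge0.
Qed.

(** Bernoulli's inequality. It provides a rate whose [m]-th power is at least the contraction factor
    of [m] steps, without extracting a root. *)
Lemma bernoulli_le (e : R) n : 0 <= e <= 1 -> 1 - n%:R * e <= (1 - e) ^+ n.
Proof.
move=> /andP[e0 e1]; elim: n => [|n IH]; first by rewrite mul0r subr0.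
rewrite exprS (le_trans _ (ler_wpM2l _ IH))// ?subr_ge0// -natr1.
have : 0 <= n%:R * (e * e) by rewrite !mulr_ge0.
by move: n%:R => k; lra.
Qed.

Variable m : nat.
Hypothesis m0 : (0 < m)%N.
Hypothesis minor : forall R0 : R, exists nu : (T -> R) -> R,
  [/\ forall h k, Vbounded V h -> Vbounded V k -> nu (h \+ k) = nu h + nu k,
      forall c h, Vbounded V h -> nu (fun y => c * h y) = c * nu h,
      forall h, Vbounded V h -> (forall y, 0 <= h y) -> 0 <= nu h,
      0 < nu (fun=> 1) &
      forall h x, Vbounded V h -> (forall y, 0 <= h y) -> V x <= R0 ->
        nu h <= iter m P h x].

Lemma geometric_oscillation : exists C rho : R, [/\ 0 <= C, 0 < rho, rho < 1 &
  forall n c phi x y, Vbounded V phi -> 0 <= c -> (forall z, `|phi z| <= c * V z) ->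
  `|iter n P phi x - iter n P phi y| <= C * c * rho ^+ n * (V x + V y)].
Proof.
pose Q := iter m P.
have oQ : Vop V Q := Vop_iter m oP.
have driftQ x : Q V x <= g * V x + K1.
  apply: (le_trans (iter_drift m x)); rewrite lerD//.
    by rewrite ler_wpM2r ?(ltW (V0 x))// -(prednK m0) exprS ler_piMr// exprn_ile1// ltW.
  by rewrite ler_piMr// gerBl exprn_ge0.
pose R0 := (2 * K1 + 1) / (1 - g).
have hR0 : 2 * K1 < (1 - g) * R0 by rewrite /R0 [ltRHS]mulrC divfK ?gt_eqF// ltrDl.
have [nu [nuD nuZ nu0 nu1 nuP]] := minor R0.
have [b b0 [a0 a01 contr0]] := oscillation_contraction mV V1 oQ (iter_cst1 m) g1 K10
  driftQ hR0 nuD nuZ nu0 nu1 nuP.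
(* The contraction factor is only known to be below 1; the maximum makes it positive. *)
pose a := Num.max a0 (1 / 2).
have a1 : a < 1 by rewrite gt_max a01/= ltr_pdivrMr// mul1r ltr1n.
have a12 : 1 / 2 <= a by rewrite le_max lexx orbT.
have apos : 0 < a by rewrite (lt_le_trans _ a12).
have S0 x y : 0 <= 2 + b * (V x + V y).
  by rewrite addr_ge0// mulr_ge0 ?addr_ge0// ltW.
have contr k phi s : Vbounded V phi -> 0 <= s ->
    (forall x y, `|phi x - phi y| <= s * (2 + b * (V x + V y))) ->
    forall x y, `|iter k Q phi x - iter k Q phi y| <= a ^+ k * s * (2 + b * (V x + V y)).
  move=> bphi s0 Hphi; elim: k => [|k IH] x y; first by rewrite expr0 mul1r.
  have := contr0 _ _ (Vop_stable (Vop_iter k oQ) bphi)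
    (mulr_ge0 (exprn_ge0 k (ltW apos)) s0) IH x y.
  move=> /le_trans; apply; rewrite ler_wpM2r// exprS -mulrA ler_wpM2r//.
    by rewrite mulr_ge0// exprn_ge0// ltW.
  by rewrite le_max lexx.
pose rho := 1 - (1 - a) / m%:R.
have mR : 0 < m%:R :> R by rewrite ltr0n.
have e01 : 0 <= (1 - a) / m%:R <= 1.
  rewrite divr_ge0 ?subr_ge0 ?(ltW a1)//= ler_pdivrMr// mul1r.
  by rewrite (@le_trans _ _ 1)// ?gerBl ?(ltW apos)// ler1n.
have rho1 : rho < 1 by rewrite gtrBl divr_gt0// subr_gt0.
have rho0 : 0 < rho.
  rewrite subr_gt0 ltr_pdivrMr// mul1r (@lt_le_trans _ _ 1)// ?gtrBl// ler1n//.
have arho : a <= rho ^+ m.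
  apply: le_trans (bernoulli_le m e01).
  by rewrite mulrCA divff ?gt_eqF// mulr1 opprB addrCA subrr addr0.
(* [rho ^- m] pays for the incomplete block of fewer than [m] steps, [(1 + K1) / b] for passing to
   the oscillation seminorm, and [1 + b] for absorbing its constant 2, as [V x + V y >= 2]. *)
pose C := rho ^- m * ((1 + K1) / b * (1 + b)).
have C0 : 0 <= C.
  rewrite mulr_ge0 ?invr_ge0 ?exprn_ge0 ?(ltW rho0)// mulr_ge0//.
    by rewrite divr_ge0 ?addr_ge0// ltW.
  by rewrite addr_ge0// ltW.
exists C, rho; split=> // n c phi x y bphi c0 phiV.
pose k := (n %/ m)%N; pose j := (n %% m)%N.
pose psi := iter j P phi.
have bpsi : Vbounded V psi by exact: (Vop_stable (Vop_iter j oP)).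
have psiV z : `|psi z| <= c * (1 + K1) * V z.
  have := Vop_norm_le z (Vop_iter j oP) bphi (VboundedZ c bV) phiV.
  move=> /le_trans; apply.
  by rewrite (VopZ (Vop_iter j oP))// -mulrA ler_wpM2l// iter_drift_le.
pose s := c * (1 + K1) / b.
have s0 : 0 <= s by rewrite divr_ge0 ?mulr_ge0 ?addr_ge0// ltW.
have Hpsi u v : `|psi u - psi v| <= s * (2 + b * (V u + V v)).
  apply: (le_trans (ler_normB _ _)); apply: (le_trans (lerD (psiV u) (psiV v))).
  rewrite (_ : s * _ = s * 2 + c * (1 + K1) * (V u + V v)); last first.
    by rewrite /s; field; rewrite gt_eqF.
  by rewrite -mulrDr lerDr mulr_ge0.
have -> : iter n P phi = iter k Q psi.
  by rewrite /psi /Q -iterM -iterD /k /j -divn_eq.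
apply: (le_trans (contr k psi s bpsi s0 Hpsi x y)).
have S2 : 2 <= V x + V y by rewrite (_ : 2 = 1 + 1)// lerD.
apply: (@le_trans _ _ (a ^+ k * s * ((1 + b) * (V x + V y)))).
  rewrite ler_wpM2l//; first by rewrite mulr_ge0// exprn_ge0// ltW.
  by rewrite (mulrDl 1) mul1r lerD2r.
rewrite mulrA ler_wpM2r ?addr_ge0 ?(ltW (V0 _))//.
have ak : a ^+ k <= rho ^- m * rho ^+ n.
  rewrite ler_pdivlMl ?exprn_gt0// (divn_eq n m) exprD -/k -/j mulrC.
  apply: ler_pM; rewrite ?exprn_ge0// ?(ltW apos)// ?(ltW rho0)//.
    by rewrite mulnC exprM lerXn2r// ?nnegrE ?exprn_ge0// ltW.
  by apply: ler_wiXn2l; [exact: ltW|exact: ltW|rewrite ltnW ?ltn_mod].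
rewrite (_ : C * c * rho ^+ n = rho ^- m * rho ^+ n * (s * (1 + b))); last first.
  by rewrite /C /s; ring.
by rewrite -mulrA ler_wpM2r// mulr_ge0// addr_ge0// ltW.
Qed.

(** For the second bound, [P^k] is applied to [psi - psi x] with [psi = P^n phi]: the oscillation
    bound majorizes it by [B * (V y + V x)], and [P^k V x <= (1 + K1) * V x] turns this into
    [B * (2 + K1) * V x]. *)
Lemma geometric_cauchy : exists C rho : R, [/\ 0 <= C, 0 < rho, rho < 1 &
  forall n c phi, Vbounded V phi -> 0 <= c -> (forall z, `|phi z| <= c * V z) ->
  (forall x y, `|iter n P phi x - iter n P phi y| <= C * c * rho ^+ n * (V x + V y)) /\
  (forall k x, `|iter n P phi x - iter (k + n) P phi x| <= C * c * rho ^+ n * V x)].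
Proof.
have [C [rho [C0 rho0 rho1 H]]] := geometric_oscillation.
have K2 : 0 <= 2 + K1 by rewrite addr_ge0.
have C2 : C <= C * (2 + K1) by rewrite ler_peMr//; have := K10; lra.
exists (C * (2 + K1)), rho; split => //; first exact: mulr_ge0.
move=> n c phi bphi c0 phiV; split=> [x y|k x].
  apply: (le_trans (H n c phi x y bphi c0 phiV)).
  rewrite ler_wpM2r ?addr_ge0 ?(ltW (V0 _))// ler_wpM2r ?exprn_ge0 ?(ltW rho0)//.
  by rewrite ler_wpM2r.
pose Q := iter k P; pose psi := iter n P phi.
have oQ : Vop V Q := Vop_iter k oP.
have bpsi : Vbounded V psi by exact: (Vop_stable (Vop_iter n oP)).
have bc a : Vbounded V (fun=> a) by exact: Vbounded_cst.
pose B := C * c * rho ^+ n.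
have B0 : 0 <= B by rewrite !mulr_ge0 ?exprn_ge0// ltW.
have bB : Vbounded V ((fun y => B * V y) \+ (fun=> B * V x)).
  by apply: VboundedD => //; exact: VboundedZ.
have := @Vop_norm_le _ _ _ _ Q (psi \+ (fun=> - psi x)) _ x oQ
  (VboundedD bpsi (bc _)) bB.
have c1 c' : Q (fun=> c') x = c' by apply: (Vop_cst1 V1 _ oQ); exact: iter_cst1.
have bBV : Vbounded V (fun y => B * V y) by exact: VboundedZ.
rewrite (VopD oQ x bpsi (bc _)) (VopD oQ x bBV (bc _)) (VopZ oQ B x bV) !c1 => h.
rewrite distrC iterD; apply: (le_trans (h _)).
  by move=> y /=; rewrite -mulrDr; exact: H.
rewrite -mulrDr -/B (_ : C * (2 + K1) * c * rho ^+ n = B * (2 + K1)); last first.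
  by rewrite /B; ring.
rewrite -mulrA ler_wpM2l//.
by have := iter_drift_le k x; rewrite -/Q; lra.
Qed.

(** The limit [L] is taken along the orbit of [x0], but the oscillation bound makes it the same from
    every [x]. Invariance of [L] under [P] is a shift of the index, and becomes stationarity once
    [L] is integration against [G]. *)
Theorem harris_ergodic (x0 : T) : exists G : probability T R,
  [/\ forall A, measurable A -> (G A = \int[G]_x (P (\1_A) x)%:E)%E,
      forall phi, Vbounded V phi -> G.-integrable setT (EFin \o phi) &
      exists C rho : R, rho < 1 /\ forall n x phi, Vbounded V phi ->
        (forall y, `|phi y| <= V y) ->
        (`|(iter n P phi x)%:E - \int[G]_y (phi y)%:E| <= (C * rho ^+ n * V x)%:E)%E].
Proof.
have [C [rho [C0 rho0 rho1 H]]] := geometric_cauchy.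
have rhoc (D : R) : (fun n => D * rho ^+ n) @ \oo --> 0.
  rewrite -(mulr0 D); apply: cvgM; first exact: cvg_cst.
  by apply: cvg_expr; rewrite ger0_norm// ltW.
pose L (phi : T -> R) : R := limn (fun n => iter n P phi x0).
have bnd phi : Vbounded V phi -> exists2 c, 0 <= c & forall z, `|phi z| <= c * V z.
  move=> [_ [c hc]]; exists `|c| => // z.
  by rewrite (le_trans (hc z))// ler_wpM2r ?ler_norm// ltW.
have Lcvg phi : Vbounded V phi -> (fun n => iter n P phi x0) @ \oo --> L phi.
  move=> bphi; have [c c0 hc] := bnd _ bphi.
  suff : cvgn (fun n => iter n P phi x0) by [].
  apply: cauchy_cvg; apply: cauchy_exP => e e0.
  have /cvgrPdist_lt/(_ e e0)[N _ HN] := rhoc (C * c * V x0).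
  exists (iter N P phi x0); exists N => // n /= Nn.
  rewrite /ball/= -(subnK Nn).
  have [_ /(_ (n - N)%N x0) h] := H N c phi bphi c0 hc.
  rewrite (le_lt_trans h)//; have := HN N (leqnn N).
  rewrite /= sub0r normrN ger0_norm; last by rewrite !mulr_ge0 ?exprn_ge0// ltW.
  by congr (_ < _); ring.
have Lrate n x c phi : Vbounded V phi -> 0 <= c -> (forall z, `|phi z| <= c * V z) ->
    `|iter n P phi x - L phi| <= C * c * rho ^+ n * V x.
  move=> bphi c0 hc.
  have /= lim0 : (fun k => iter (k + n) P phi x) @ \oo --> L phi.
    have h1 : (fun k => iter (k + n) P phi x0) @ \oo --> L phi.
      by rewrite (cvg_shiftn n (fun k => iter k P phi x0)); exact: Lcvg.
    have h2 : (fun k => iter (k + n) P phi x - iter (k + n) P phi x0) @ \oo --> 0.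
      have h3 : (fun k => C * c * rho ^+ (k + n) * (V x + V x0)) @ \oo --> 0.
        rewrite (cvg_shiftn n (fun k => C * c * rho ^+ k * (V x + V x0))).
        rewrite (_ : (fun k => _) = (fun k => C * c * (V x + V x0) * rho ^+ k)).
          exact: rhoc.
        by apply/funext => k; ring.
      apply/norm_cvg0P; apply: (squeeze_cvgr _ (cvg_cst 0) h3).
      apply: nearW => k; rewrite normr_ge0/=.
      by have [] := H (k + n)%N c phi bphi c0 hc.
    rewrite -[X in _ --> X]addr0.
    rewrite (_ : (fun k => _) = (fun k => iter (k + n) P phi x0 +
        (iter (k + n) P phi x - iter (k + n) P phi x0))); first exact: cvgD h1 h2.
    by apply/funext => k /=; rewrite addrC subrK.
  have h4 : (fun k => `|iter n P phi x - iter (k + n) P phi x|) @ \oo -->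
      `|iter n P phi x - L phi|.
    by apply: cvg_norm; apply: cvgB => //; exact: cvg_cst.
  rewrite -(cvg_lim _ h4)//; apply: limr_le; first by apply/cvg_ex; eexists; exact: h4.
  by apply: nearW => k; have [_] := H n c phi bphi c0 hc; exact.
have LE phi l : Vbounded V phi -> (fun n => iter n P phi x0) @ \oo --> l -> L phi = l.
  by move=> bphi h; exact: (cvg_unique _ (Lcvg _ bphi) h).
have LD h k : Vbounded V h -> Vbounded V k -> L (h \+ k) = L h + L k.
  move=> bh bk; apply: LE; first exact: VboundedD.
  rewrite (_ : (fun n => _) = (fun n => iter n P h x0 + iter n P k x0)).
    by apply: cvgD; exact: Lcvg.
  by apply/funext => n; rewrite (VopD (Vop_iter n oP)).
have LZ c h : Vbounded V h -> L (fun y => c * h y) = c * L h.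
  move=> bh; apply: LE; first exact: VboundedZ.
  rewrite (_ : (fun n => _) = (fun n => c * iter n P h x0)).
    by apply: cvgM; [exact: cvg_cst|exact: Lcvg].
  by apply/funext => n; rewrite (VopZ (Vop_iter n oP)).
have b1 : Vbounded V (fun=> 1) by exact: Vbounded_cst.
have L1 : L (fun=> 1) = 1.
  by apply: LE => //; apply: cvg_near_cst; apply: nearW => n; rewrite iter_cst1.
have L_ge0 h : Vbounded V h -> (forall y, 0 <= h y) -> 0 <= L h.
  move=> bh h0; apply: limr_ge; first by apply/cvg_ex; eexists; exact: Lcvg.
  apply: nearW => n; have o := Vop_iter n oP.
  have -> : (0 : R) = iter n P (fun=> 0) x0.
    by rewrite (Vop_cst1 V1 _ o)// iter_cst1.
  by apply: (Vop_le o) => //; exact: Vbounded_cst.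
(* An exchange of limits: the rate is uniform over functions dominated by [l], so [L] can be
   replaced by one fixed iterate [P^N], whose continuity is already known. *)
have L_cvg0 (k : nat -> T -> R) l : (forall n, measurable_fun setT (k n)) ->
    Vbounded V l -> (forall n y, `|k n y| <= l y) ->
    (forall y, k ^~ y @ \oo --> 0) -> (fun n => L (k n)) @ \oo --> 0.
  move=> mk bl kl k0; have [c c0 hc] := bnd _ bl.
  apply/cvgrPdist_le => e e0.
  have /cvgrPdist_le/(_ _ (divr_gt0 e0 (@ltr0Sn R 1)))[N _ HN] := rhoc (C * c * V x0).
  have := @Vop_cvg0 _ _ _ _ _ (Vop_iter N oP) k l x0 mk bl kl k0.
  move=> /cvgrPdist_le/(_ _ (divr_gt0 e0 (@ltr0Sn R 1))).
  apply: filterS => n; rewrite !sub0r !normrN => h1.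
  have bk : Vbounded V (k n) by exact: (Vbounded_le (mk n) bl).
  have kc z : `|k n z| <= c * V z.
    by rewrite (le_trans (kl n z))// (le_trans (ler_norm _)).
  have h2 := Lrate N x0 c (k n) bk c0 kc.
  have := HN N (leqnn N); rewrite /= sub0r normrN ger0_norm; last first.
    by rewrite !mulr_ge0 ?exprn_ge0// ltW.
  rewrite mulrAC => h3.
  rewrite -(subrK (iter N P (k n) x0) (L (k n))) (le_trans (ler_normD _ _))//.
  by rewrite (splitr e) lerD// distrC (le_trans h2).
have [G [GA Gint]] := daniell_representation mV V1 LD LZ L_ge0 L1 L_cvg0.
have LP h : Vbounded V h -> L (P h) = L h.
  move=> bh; apply: LE; first exact: (Vop_stable oP).
  rewrite (_ : (fun n => _) = (fun n => iter n.+1 P h x0)).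
    by rewrite (cvg_shiftS (fun n => iter n P h x0)); exact: Lcvg.
  by apply/funext => n; rewrite iterSr.
exists G; split.
- move=> A mA; have bA : Vbounded V (\1_A : T -> R) by exact: Vbounded_indic.
  by rewrite (Gint _ (Vop_stable oP bA)).2 LP// GA.
- by move=> phi /Gint[].
- exists C, rho; split=> // n x phi bphi phiV.
  rewrite (Gint _ bphi).2 -EFinB abse_EFin lee_fin.
  have := Lrate n x 1 phi bphi ler01; rewrite mulr1; apply => z.
  by rewrite mul1r.
Qed.

End harris_theorem.

(** * Vectors, the shift and compactness *)

Section vectors.
Context {R : realType} {p : nat}.
Local Notation vec := (p.-tuple R).
Implicit Types (x y : vec) (z c : R).

Lemma enorm_ge0 x : 0 <= enorm x. Proof. exact: sqrtr_ge0. Qed.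

Lemma sqr_enorm x : enorm x ^+ 2 = \sum_(i < p) tnth x i ^+ 2.
Proof. by rewrite sqr_sqrtr// sumr_ge0// => i _; rewrite sqr_ge0. Qed.

Lemma tnth_le_enorm x i : `|tnth x i| <= enorm x.
Proof.
rewrite -ler_sqr ?nnegrE ?enorm_ge0// sqr_enorm real_normK ?num_real//.
by rewrite (bigD1 i)//= lerDl sumr_ge0// => j _; rewrite sqr_ge0.
Qed.

Lemma enorm_tscale c x : enorm (tscale c x) = `|c| * enorm x.
Proof.
rewrite /enorm (_ : \sum_(i < p) _ = c ^+ 2 * \sum_(i < p) tnth x i ^+ 2).
  by rewrite sqrtrM ?sqr_ge0// sqrtr_sqr.
by rewrite mulr_sumr; apply: eq_bigr => i _; rewrite tnth_mktuple exprMn.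
Qed.

Lemma tscaleA c1 c2 x : tscale c1 (tscale c2 x) = tscale (c1 * c2) x.
Proof. by apply: eq_from_tnth => i; rewrite !tnth_mktuple mulrA. Qed.

Lemma tscale1 x : tscale 1 x = x.
Proof. by apply: eq_from_tnth => i; rewrite tnth_mktuple mul1r. Qed.

Lemma Theta_normalize x : enorm x != 0 -> Theta (tscale (enorm x)^-1 x).
Proof.
by move=> x0; rewrite /Theta/= enorm_tscale normfV ger0_norm ?enorm_ge0// mulVf.
Qed.

Lemma tscale_normalize x : enorm x != 0 -> tscale (enorm x) (tscale (enorm x)^-1 x) = x.
Proof. by move=> x0; rewrite tscaleA divff// tscale1. Qed.

Lemma normalize_tscale c x : 0 < c ->
  tscale (enorm (tscale c x))^-1 (tscale c x) = tscale (enorm x)^-1 x.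
Proof.
move=> c0; rewrite tscaleA enorm_tscale (gtr0_norm c0) invfM mulrAC mulVf ?mul1r//.
exact: lt0r_neq0.
Qed.

Lemma nth_tscale c x k : nth 0 (tscale c x) k = c * nth 0 x k.
Proof.
have [kp|pk] := ltnP k p; last by rewrite !nth_default ?size_tuple ?mulr0.
by rewrite -(tnth_nth 0 _ (Ordinal kp)) tnth_mktuple (tnth_nth 0).
Qed.

Lemma tscale_shift c x z : tscale c (shift x z) = shift (tscale c x) (c * z).
Proof.
apply: eq_from_tnth => i; rewrite !tnth_mktuple; case: ifP => // _.
by rewrite nth_tscale.
Qed.

Lemma tnth_shift0 x z (i : 'I_p) : (i : nat) = 0%N -> tnth (shift x z) i = z.
Proof. by move=> i0; rewrite tnth_mktuple i0. Qed.

Lemma tnth_shiftS x z (i j : 'I_p) : (i : nat) = j.+1 -> tnth (shift x z) i = tnth x j.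
Proof. by move=> ij; rewrite tnth_mktuple ij/= (tnth_nth 0). Qed.

Lemma measurable_nth k : measurable_fun setT (fun x : vec => nth 0 x k).
Proof.
have [kp|pk] := ltnP k p.
  rewrite (_ : (fun x => _) = fun x : vec => tnth x (Ordinal kp)).
    exact: measurable_tnth.
  by apply/funext => x; rewrite (tnth_nth 0).
rewrite (_ : (fun x => _) = cst 0); first exact: measurable_cst.
by apply/funext => x; rewrite nth_default// size_tuple.
Qed.

Lemma measurable_enorm : measurable_fun setT (@enorm R p).
Proof.
have ms : measurable_fun setT (@Num.sqrt R).
  by apply: continuous_measurable_fun; exact: sqrt_continuous.
rewrite /enorm; apply: (measurableT_comp ms).
apply: measurable_sum => i; apply: measurable_funX; exact: measurable_tnth.
Qed.

Lemma measurable_tscale d (T : measurableType d) (c : T -> R) (x : T -> vec) :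
  measurable_fun setT c -> measurable_fun setT x ->
  measurable_fun setT (fun t => tscale (c t) (x t)).
Proof.
move=> mc mx; apply/measurable_fun_tnthP => i.
rewrite (_ : _ \o _ = fun t => c t * tnth (x t) i).
  apply: measurable_funM => //.
  exact: (measurableT_comp (measurable_tnth i) mx).
by apply/funext => t /=; rewrite tnth_mktuple.
Qed.

Lemma measurable_shift d (T : measurableType d) (z : T -> R) (x : T -> vec) :
  measurable_fun setT z -> measurable_fun setT x ->
  measurable_fun setT (fun t => shift (x t) (z t)).
Proof.
move=> mz mx; apply/measurable_fun_tnthP => i.
rewrite (_ : _ \o _ = fun t => if (i : nat) == 0%N then z t else nth 0 (x t) i.-1).
  case: (_ == _) => //; exact: (measurableT_comp (measurable_nth _) mx).
by apply/funext => t /=; rewrite tnth_mktuple.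
Qed.

End vectors.

Section more_vectors.
Context {R : realType}.

Lemma enorm_shift_le p (x : p.-tuple R) (z : R) : enorm (shift x z) <= `|z| + enorm x.
Proof.
have h : 0 <= `|z| + enorm x by rewrite addr_ge0// enorm_ge0.
rewrite -ler_sqr ?nnegrE ?enorm_ge0// sqrrD sqr_enorm real_normK ?num_real//.
suff : \sum_(i < p) tnth (shift x z) i ^+ 2 <= z ^+ 2 + enorm x ^+ 2.
  move=> /le_trans; apply; rewrite lerD2r lerDl mulrn_wge0// mulr_ge0//.
  exact: enorm_ge0.
rewrite sqr_enorm; case: p x {h} => [|q] x; first by rewrite !big_ord0 addr0 sqr_ge0.
rewrite big_ord_recl [in leRHS]big_ord_recr/= tnth_shift0// lerD2l.
rewrite -[leLHS]addr0 lerD ?sqr_ge0//.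
apply: ler_sum => i _; rewrite (@tnth_shiftS _ _ x z _ (widen_ord (leqnSn q) i))//.
Qed.

Variable p : nat.
Local Notation vec := (p.-tuple R).

(** Compactness and continuity are argued on row vectors with their product topology and carried
    over to tuples. *)
Definition vec_of_row (v : 'rV[R]_p) : vec := [tuple v ord0 i | i < p].

Lemma vec_of_rowK (x : vec) : vec_of_row (\row_i tnth x i) = x.
Proof. by apply: eq_from_tnth => i; rewrite tnth_mktuple mxE. Qed.

Lemma continuous_sqdist (c : 'I_p -> R) :
  continuous (fun v : 'rV[R]_p => Num.sqrt (\sum_(i < p) (v ord0 i - c i) ^+ 2)).
Proof.
move=> v; apply: continuous_comp; last exact: sqrt_continuous.
have H (I : Type) (s : seq I) (F : I -> 'rV[R]_p -> R) :
    (forall i, {for v, continuous (F i)}) ->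
    {for v, continuous (fun w => \sum_(i <- s) F i w)}.
  move=> cF; elim: s => [|i s IH].
    rewrite (_ : (fun w => _) = cst 0); first exact: cst_continuous.
    by apply/funext => w; rewrite big_nil.
  rewrite (_ : (fun w => _) = F i \+ (fun w => \sum_(j <- s) F j w)).
    by apply: continuousD.
  by apply/funext => w; rewrite big_cons.
apply: H => i.
rewrite (_ : (fun w : 'rV[R]_p => _) =
    (fun w => (w ord0 i - c i) * (w ord0 i - c i))); last first.
  by apply/funext => w; rewrite expr2.
have h : {for v, continuous (fun w : 'rV[R]_p => w ord0 i - c i)}.
  apply: continuousB; [exact: coord_continuous|exact: cst_continuous].
exact: continuousM.
Qed.

Lemma enorm_rowE (v : 'rV[R]_p) (x : vec) :
  enorm [tuple tnth (vec_of_row v) i - tnth x i | i < p] =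
  Num.sqrt (\sum_(i < p) (v ord0 i - tnth x i) ^+ 2).
Proof. by congr Num.sqrt; apply: eq_bigr => i _; rewrite !tnth_mktuple. Qed.

Lemma continuous_enorm_row : continuous (fun v : 'rV[R]_p => enorm (vec_of_row v)).
Proof.
rewrite (_ : (fun v => _) = fun v : 'rV[R]_p => Num.sqrt (\sum_(i < p) (v ord0 i - 0) ^+ 2)).
  exact: continuous_sqdist.
apply/funext => v; congr Num.sqrt; apply: eq_bigr => i _.
by rewrite tnth_mktuple subr0.
Qed.

(** The bounds [n.+1%:R^-1] are tried simultaneously: each holds near a given point for all large
    [n], and compactness of [K] yields one [n] for all points. *)
Lemma compact_lower_bound (D K : set vec) (g : vec -> R) (B : R) :
  loc_bdd_away0 D g -> K `<=` D -> closed [set v | K (vec_of_row v)] ->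
  (forall x, K x -> enorm x <= B) -> exists2 c, 0 < c & forall x, K x -> c <= g x.
Proof.
move=> gD KD cK KB.
have /compact_near_coveringP/near_covering_withinP H : compact [set v | K (vec_of_row v)].
  apply: (subclosed_compact cK (@rV_compact R^o _ (fun=> `[- B, B]%classic) _)).
    by move=> i; exact: segment_compact.
  move=> v /KB h i /=; rewrite in_itv/= -ler_norml.
  apply: le_trans h; have := tnth_le_enorm (vec_of_row v) i.
  by rewrite tnth_mktuple.
have {}H : \forall n \near \oo, [set v | K (vec_of_row v)] `<=`
    (fun v => n.+1%:R^-1 <= g (vec_of_row v)).
  apply: H => v Kv.
  have [e e0 [c c0 gc]] := gD _ (KD _ Kv).
  have /cvgrPdist_lt/(_ e e0) := @continuous_sqdist (tnth (vec_of_row v)) v.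
  move=> nv.
  exists ([set w : 'rV[R]_p | enorm [tuple tnth (vec_of_row w) i - tnth (vec_of_row v) i | i < p] < e],
    [set n | n.+1%:R^-1 < c]) => /=.
    split; last exact: near_infty_natSinv_lt (PosNum c0).
    apply: filterS nv => w /=; rewrite enorm_rowE.
    rewrite big1 ?sqrtr0 ?sub0r ?normrN; last first.
      by move=> i _; rewrite tnth_mktuple subrr expr0n.
    by rewrite ger0_norm// sqrtr_ge0.
  move=> [w n] /= [we nc] Kw; rewrite (le_trans (ltW nc))//.
  by apply: gc => //; exact: KD.
have [n Hn] := filter_ex H.
exists n.+1%:R^-1 => // x Kx; rewrite -(vec_of_rowK x); apply: Hn.
by rewrite /= vec_of_rowK.
Qed.

End more_vectors.

Lemma segment_lower_bound (R : realType) (f : R -> R) (A : R) :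
  (forall u0 : R, exists2 eps : R, 0 < eps & exists2 c : R, 0 < c &
     forall u, `|u - u0| < eps -> c <= f u) ->
  exists2 c : R, 0 < c & forall u, `|u| <= A -> c <= f u.
Proof.
move=> Hf.
have /compact_near_coveringP H := @segment_compact R (- A) A.
have {}H : \forall n \near \oo, `[- A, A]%classic `<=` (fun v => n.+1%:R^-1 <= f v).
  apply: H => v _; have [e e0 [c c0 fc]] := Hf v.
  exists (ball v e, [set n | n.+1%:R^-1 < c]) => /=.
    by split; [exact: nbhsx_ballx|exact: near_infty_natSinv_lt (PosNum c0)].
  move=> [w n] /= [we nc]; rewrite (le_trans (ltW nc))// fc//.
  by rewrite distrC.
have [n Hn] := filter_ex H.
by exists n.+1%:R^-1 => // u uA; apply: Hn; rewrite /= in_itv/= -ler_norml.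
Qed.

(** * The collapsed chain *)

(** The integrand is signed, so Tonelli is applied to its positive and negative parts separately. *)
Lemma measurable_Ex d (T : measurableType d) (R : realType) (k : T -> R -> R) (f : R -> R) :
  measurable_fun setT (fun tu : T * R => k tu.1 tu.2) -> measurable_fun setT f ->
  measurable_fun setT (fun x => Ex f (k x)).
Proof.
move=> mk mf.
pose F (tu : T * measurableTypeR R) : \bar R := (k tu.1 tu.2 * f tu.2)%:E.
have mF : measurable_fun setT F.
  apply/measurable_EFinP; apply: measurable_funM; first exact: mk.
  exact: (measurableT_comp mf measurable_snd).
rewrite (_ : (fun x => _) = fine \o (fun x =>
    fubini_F lebesgue_measure (F^\+)%E x - fubini_F lebesgue_measure (F^\-)%E x)%E).
  apply: measurableT_comp; first exact: fine_measurable.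
  apply: emeasurable_funB.
    apply: measurable_fun_fubini_tonelli_F => //; exact: measurable_funepos.
  apply: measurable_fun_fubini_tonelli_F => //; exact: measurable_funeneg.
apply/funext => x; rewrite /= /Ex /Rintegral integralE /fubini_F.
by congr (fine (_ - _)%E); apply: eq_integral => u _; rewrite ?funeposE ?funenegE.
Qed.

Section collapsed_chain.
Context {R : realType} {p : nat}.
Local Notation vec := (p.-tuple R).
Local Notation mu := (@lebesgue_measure R).
Variables (as_ bs_ : vec -> R) (f : R -> R) (r C : R).
Hypotheses (r0 : 0 < r) (wf : weightable r f).
Hypotheses (mA : measurable_fun setT (star as_)) (mB : measurable_fun setT (star bs_)).
Hypotheses (C0 : 0 <= C) (AC : forall th, Theta th -> `|star as_ th| <= C)
  (BC : forall th, Theta th -> `|star bs_ th| <= C).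
Local Notation w := (wfun as_ bs_).
Local Notation thn := (thnext as_ bs_).

Lemma measurable_Theta : measurable (Theta : set vec).
Proof.
rewrite (_ : Theta = setT `&` @enorm R p @^-1` [set 1]).
  by apply: measurable_enorm => //; exact: measurable_set1.
by apply/seteqP; split=> x // -[].
Qed.

Lemma wfun_ge0 th u : 0 <= w th u. Proof. exact: enorm_ge0. Qed.

Lemma thnext_Theta th u : w th u != 0 -> Theta (thn th u).
Proof. by move=> w0; exact: Theta_normalize. Qed.

Lemma wfun_le th u : Theta th -> w th u <= (1 + C) * (1 + `|u|).
Proof.
move=> Th; rewrite /wfun (le_trans (enorm_shift_le _ _))// Th /zfun.
have := ler_normD (star as_ th) (star bs_ th * u); rewrite normrM.
have := AC Th; have : `|star bs_ th| * `|u| <= C * `|u| by rewrite ler_wpM2r// BC.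
have : 0 <= `|u| by [].
lra.
Qed.

Lemma powR_wfun_le th u : Theta th -> (w th u) `^ r <= (1 + C) `^ r * weight r u.
Proof.
move=> Th; rewrite -powRM ?addr_ge0//.
apply: ge0_ler_powR; rewrite ?nnegrE ?wfun_ge0 ?mulr_ge0 ?addr_ge0 ?(ltW r0)//.
exact: wfun_le.
Qed.

Lemma measurable_w : measurable_fun setT (fun xu : vec * R => w xu.1 xu.2).
Proof.
apply: (measurableT_comp measurable_enorm); apply: measurable_shift.
  apply: measurable_funD; first exact: (measurableT_comp mA measurable_fst).
  apply: measurable_funM; last exact: measurable_snd.
  exact: (measurableT_comp mB measurable_fst).
exact: measurable_fst.
Qed.

Lemma measurable_thn : measurable_fun setT (fun xu : vec * R => thn xu.1 xu.2).
Proof.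
apply: measurable_tscale.
  rewrite (_ : (fun _ => _) = (fun xu : vec * R => (w xu.1 xu.2) `^ (-1))).
    exact: (measurableT_comp (measurable_powR (-1)) measurable_w).
  by apply/funext => xu; rewrite powR_inv1// wfun_ge0.
apply: measurable_shift.
  apply: measurable_funD; first exact: (measurableT_comp mA measurable_fst).
  apply: measurable_funM; last exact: measurable_snd.
  exact: (measurableT_comp mB measurable_fst).
exact: measurable_fst.
Qed.

Definition integrand (h : vec -> R) (x : vec) (u : R) : R := (w x u) `^ r * h (thn x u).

Lemma measurable_integrand (h : vec -> R) : measurable_fun setT h ->
  measurable_fun setT (fun xu : vec * R => integrand h xu.1 xu.2).
Proof.
move=> mh; apply: measurable_funM.
  exact: (measurableT_comp (measurable_powR r) measurable_w).
exact: (measurableT_comp mh measurable_thn).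
Qed.

Lemma dominated_integrand (h : vec -> R) (D : R) (th : vec) : measurable_fun setT h ->
  (forall x, `|h x| <= D) -> Theta th -> dominated r (integrand h th).
Proof.
move=> mh hD Th; split.
  by have := measurableT_comp (measurable_integrand mh) (measurable_pair1 th).
have D0 : 0 <= D := le_trans (normr_ge0 _) (hD th).
exists ((1 + C) `^ r * D) => u; rewrite normrM ger0_norm ?powR_ge0// mulrAC.
by apply: ler_pM; rewrite ?powR_ge0// powR_wfun_le.
Qed.

(* Cut off outside Theta, where the coefficients are not bounded by C; on Theta the
   iterates are the values of Gn (the junk value of thnext at w = 0 has weight 0). *)
Definition collapsed_op (h : vec -> R) (th : vec) : R := \1_Theta th * Ex f (integrand h th).

Definition collapsed_iter n : vec -> R := iter n collapsed_op (\1_Theta).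

Lemma collapsed_iterS n th : Theta th ->
  collapsed_iter n.+1 th = Ex f (integrand (collapsed_iter n) th).
Proof.
by move=> Th; rewrite /collapsed_iter iterS /collapsed_op indicE mem_set// mul1r.
Qed.

Let B := Ex f (fun u => (1 + C) `^ r * weight r u).

Let B0 : 0 <= B.
Proof. by apply: (Ex_ge0 wf) => u; rewrite mulr_ge0 ?powR_ge0. Qed.

(** One step multiplies a bound by at most [B], the expectation of the majorant of [w ^ r]. So the
    extended-real recursion stays finite on [Theta], and the rest of the argument can work with real
    numbers. *)
Lemma collapsed_iterP n : [/\ measurable_fun setT (collapsed_iter n),
  forall x, 0 <= collapsed_iter n x <= B ^+ n &
  forall th, Theta th -> Gn as_ bs_ f r n th = (collapsed_iter n th)%:E].
Proof.
elim: n => [|n [IH1 IH2 IH3]].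
  split.
  - by apply: measurable_indic; exact: measurable_Theta.
  - by move=> x; rewrite expr0 /collapsed_iter/= indicE; case: (_ \in _); rewrite ?lexx ?ler01.
  - by move=> th Th; rewrite /collapsed_iter/= indicE mem_set.
have hD x : `|collapsed_iter n x| <= B ^+ n.
  by have /andP[h1 h2] := IH2 x; rewrite ger0_norm.
have S0 th u : 0 <= integrand (collapsed_iter n) th u.
  by rewrite mulr_ge0 ?powR_ge0//; have /andP[] := IH2 (thn th u).
split.
- apply: measurable_funM; first by apply: measurable_indic; exact: measurable_Theta.
  by apply: measurable_Ex; [exact: measurable_integrand|case: wf].
- move=> x; rewrite /collapsed_iter iterS -/(collapsed_iter n) /collapsed_op indicE.
  case: (boolP (x \in _)) => [|_]; last by rewrite mul0r lexx exprn_ge0.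
  rewrite inE => Th; rewrite mul1r (Ex_ge0 wf)//= exprSr.
  have -> : B ^+ n * B = Ex f (fun u => B ^+ n * ((1 + C) `^ r * weight r u)).
    by rewrite (ExZ wf)//; apply: dominatedZ; exact: dominated_weight.
  apply: (Ex_le wf).
  + exact: dominated_integrand Th.
  + by do 2 apply: dominatedZ; exact: dominated_weight.
  + move=> u; rewrite mulrC; have /andP[h1 h2] := IH2 (thn x u).
    by apply: ler_pM; rewrite ?powR_ge0// powR_wfun_le.
- move=> th Th; rewrite collapsed_iterS// -(Ex_EFin wf); last exact: dominated_integrand Th.
  change (Gn as_ bs_ f r n.+1 th) with (\int[mu]_u ((powR (w th u) r)%:E *
    Gn as_ bs_ f r n (thn th u) * (f u)%:E))%E.
  apply: eq_integral => u _; rewrite EFinM; congr (_ * _)%E.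
  have [w0|w0] := eqVneq (w th u) 0; last by rewrite IH3//; exact: thnext_Theta.
  by rewrite /integrand w0 powR0 ?gt_eqF// mul0e mul0r.
Qed.

(** Condition (i) multiplied out by [lam th]. The upper bound is asked everywhere, also off [Theta],
    because it makes [integrand lam th] dominated without a case distinction on [w = 0]. *)
Definition drift_lambda (lam : vec -> R) := [/\ measurable_fun setT lam,
  exists c1 c2 : R, 0 < c1 /\ (forall x, 0 <= lam x <= c2) /\
    (forall th, Theta th -> c1 <= lam th) &
  exists c : R, [/\ 0 <= c, c < 1 & forall th, Theta th -> Ex f (integrand lam th) <= c * lam th]].

Lemma cond_i_drift (lam : vec -> R) : measurable_fun Theta lam ->
  (exists2 c1 : R, 0 < c1 & exists c2 : R,
     forall th, Theta th -> c1 <= lam th <= c2) ->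
  (exists2 c : R, c < 1 & forall th, Theta th ->
    (\int[mu]_u ((lam (thn th u) / lam th * powR (w th u) r)%:E * (f u)%:E) <= c%:E)%E) ->
  drift_lambda (lam \_ Theta).
Proof.
move=> mlam [c1 c10 [c2 lamc]] [c cl1 Hc].
have mlam' : measurable_fun setT (lam \_ Theta).
  apply/(measurable_restrictT _ measurable_Theta) => //.
have lamE th : Theta th -> (lam \_ Theta) th = lam th by move=> Th; rewrite patchE mem_set.
have lam0 th : Theta th -> 0 < lam th.
  by move=> Th; have /andP[h _] := lamc _ Th; exact: lt_le_trans h.
have lamb x : 0 <= (lam \_ Theta) x <= `|c2|.
  rewrite patchE; case: (boolP (x \in _)) => [|_]; last by rewrite lexx normr_ge0.
  rewrite inE => Th; have /andP[_ h2] := lamc _ Th.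
  by rewrite (ltW (lam0 _ Th))/= (le_trans h2)// ler_norm.
split=> //.
  by exists c1, `|c2|; split=> //; split=> // th Th; rewrite lamE//; have /andP[] := lamc _ Th.
exists (Num.max c 0); split; first by rewrite le_max lexx orbT.
  by rewrite gt_max cl1 ltr01.
move=> th Th; rewrite lamE//.
have dI : dominated r (integrand (lam \_ Theta) th).
  apply: dominated_integrand Th => //; last first.
    by move=> x; have /andP[h1 h2] := lamb x; rewrite ger0_norm//; exact: h2.
have : Ex f (fun u => (lam th)^-1 * integrand (lam \_ Theta) th u) <= c.
  rewrite -lee_fin -(Ex_EFin wf); last exact: dominatedZ.
  apply: le_trans (Hc th Th).
  rewrite le_eqVlt; apply/orP; left; apply/eqP; apply: eq_integral => u _.
  rewrite -EFinM; congr (EFin (_ * _)); rewrite /integrand.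
  have [w0|w0] := eqVneq (w th u) 0.
    by rewrite w0 powR0 ?gt_eqF// mul0r !mulr0.
  by rewrite lamE; [ring|exact: thnext_Theta].
rewrite (ExZ wf)// mulrC ler_pdivrMr ?lam0// => /le_trans; apply.
by rewrite ler_wpM2r ?le_max ?lexx// ltW// lam0.
Qed.

Lemma drift_cond_i (lam : vec -> R) : drift_lambda lam ->
  measurable_fun Theta lam /\
  (exists2 c1 : R, 0 < c1 & exists c2 : R,
     forall th, Theta th -> c1 <= lam th <= c2) /\
  (exists2 c : R, c < 1 & forall th, Theta th ->
    (\int[mu]_u ((lam (thn th u) / lam th * powR (w th u) r)%:E * (f u)%:E) <= c%:E)%E).
Proof.
move=> [mlam [c1 [c2 [c10 [lamb lamc]]]] [c [c0 cl1 Hc]]].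
split; first exact: measurable_funTS.
split.
  by exists c1 => //; exists c2 => th Th; rewrite lamc//=; have /andP[] := lamb th.
exists c => // th Th.
have lam0 : 0 < lam th by rewrite (lt_le_trans c10)// lamc.
have dI : dominated r (integrand lam th).
  apply: (dominated_integrand mlam _ Th) => x; have /andP[h1 h2] := lamb x.
  by rewrite ger0_norm//; exact: h2.
rewrite (_ : (\int[mu]_u _)%E = (Ex f (fun u => (lam th)^-1 * integrand lam th u))%:E).
  by rewrite lee_fin (ExZ wf)// mulrC ler_pdivrMr// Hc.
rewrite -(Ex_EFin wf); last exact: dominatedZ.
by apply: eq_integral => u _; rewrite -EFinM; congr (EFin (_ * _)); rewrite /integrand; ring.
Qed.

(** The induction carries [lam th / c1] in place of a constant, since it is [lam] that one step
    contracts; it starts because [lam / c1 >= 1] on [Theta]. *)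
Lemma drift_collapsed_iter lam : drift_lambda lam -> exists D c : R,
  [/\ 0 <= D, 0 <= c, c < 1 & forall n th, Theta th -> collapsed_iter n th <= D * c ^+ n].
Proof.
move=> [mlam [c1 [c2 [c10 [lamb lamc]]]] [c [c0 cl1 Hc]]].
have c20 : 0 <= c2.
  by have /andP[h1 h2] := lamb [tuple 0 | i < p]; exact: le_trans h2.
exists (c2 / c1), c; split => //; first by rewrite divr_ge0// ltW.
have dl th : Theta th -> dominated r (integrand lam th).
  move=> Th; apply: (dominated_integrand mlam _ Th) => x; have /andP[h1 h2] := lamb x.
  by rewrite ger0_norm//; exact: h2.
suff H n th : Theta th -> collapsed_iter n th <= lam th / c1 * c ^+ n.
  move=> n th Th; rewrite (le_trans (H n th Th))// ler_wpM2r ?exprn_ge0//.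
  by rewrite ler_wpM2r ?invr_ge0 ?(ltW c10)//; have /andP[] := lamb th.
elim: n th => [|n IH] th Th.
  by rewrite /collapsed_iter/= indicE mem_set// expr0 mulr1 ler_pdivlMr// mul1r lamc.
rewrite collapsed_iterS//.
have [m1 m2 _] := collapsed_iterP n.
apply: (@le_trans _ _ (Ex f (fun u => c ^+ n / c1 * integrand lam th u))).
  apply: (Ex_le wf).
  - apply: (dominated_integrand m1 _ Th) => x; have /andP[h1 h2] := m2 x.
    by rewrite ger0_norm//; exact: h2.
  - by apply: dominatedZ; exact: dl.
  - move=> u; rewrite /integrand; have [w0|w0] := eqVneq (w th u) 0.
      by rewrite w0 powR0 ?gt_eqF// !mul0r mulr0.
    rewrite mulrCA ler_wpM2l ?powR_ge0//.
    rewrite (_ : _ / c1 * _ = lam (thn th u) / c1 * c ^+ n); last by ring.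
    by apply: IH; exact: thnext_Theta.
rewrite (ExZ wf); last exact: dl.
rewrite exprSr (_ : lam th / c1 * (c ^+ n * c) = c ^+ n / c1 * (c * lam th)); last by ring.
by rewrite ler_wpM2l ?Hc// divr_ge0 ?exprn_ge0// ltW.
Qed.

(** One step sends the term [c k] to [rho * c k.+1]. The sum therefore becomes [rho] times itself
    with [c 0 = 1] replaced by [c N.+1 <= 1], and the term [c 0] bounds it from below. *)
Lemma drift_of_iter N (rho : R) : 0 < rho -> rho < 1 ->
  (forall th, Theta th -> collapsed_iter N.+1 th <= rho ^+ N.+1) ->
  exists lam, drift_lambda lam.
Proof.
move=> rho0 rho1 HN.
pose c k := fun x => rho ^- k * collapsed_iter k x.
pose lam n := fun x : vec => \sum_(k < n) c k x.
have rk k : 0 <= rho ^- k by rewrite invr_ge0 exprn_ge0// ltW.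
have c0 k x : 0 <= c k x.
  by rewrite mulr_ge0//; have [_ /(_ x)/andP[]] := collapsed_iterP k.
have mc k : measurable_fun setT (c k).
  by apply: measurable_funM => //; have [] := collapsed_iterP k.
have mlam n : measurable_fun setT (lam n) by apply: measurable_sum => k.
pose c2 n := \sum_(k < n) (rho ^- k * B ^+ k).
have lamb n x : 0 <= lam n x <= c2 n.
  rewrite sumr_ge0//=; apply: ler_sum => k _; rewrite ler_wpM2l//.
  by have [_ /(_ x)/andP[]] := collapsed_iterP k.
have dl n th : Theta th -> dominated r (integrand (lam n) th).
  move=> Th; apply: (dominated_integrand (mlam n) _ Th) => x; have /andP[h1 h2] := lamb n x.
  by rewrite ger0_norm//; exact: h2.
have dc k th : Theta th -> dominated r (integrand (collapsed_iter k) th).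
  have [m1 m2 _] := collapsed_iterP k.
  move=> Th; apply: (dominated_integrand m1 _ Th) => x; have /andP[h1 h2] := m2 x.
  by rewrite ger0_norm//; exact: h2.
have Elam n th : Theta th ->
    Ex f (integrand (lam n) th) = \sum_(k < n) (rho ^- k * collapsed_iter k.+1 th).
  move=> Th; elim: n => [|n IH].
    rewrite big_ord0 (_ : integrand _ _ = (fun u => 0 * weight r u)).
      by rewrite (ExZ wf) ?mul0r//; exact: dominated_weight.
    by apply/funext => u; rewrite /integrand /lam big_ord0 mulr0 mul0r.
  rewrite big_ord_recr/= -IH (_ : integrand (lam n.+1) th = integrand (lam n) th \+
      (fun u => rho ^- n * integrand (collapsed_iter n) th u)); last first.
    by apply/funext => u; rewrite /integrand /lam /= big_ord_recr/= /c; ring.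
  rewrite (ExD wf); [|exact: dl|by apply: dominatedZ; exact: dc].
  rewrite (ExZ wf); last exact: dc.
  by rewrite -collapsed_iterS.
have c1 th : Theta th -> c 0%N th = 1.
  by move=> Th; rewrite /c expr0 invr1 mul1r /collapsed_iter/= indicE mem_set.
exists (lam N.+1); split => //.
  exists 1, (c2 N.+1); split=> //; split=> // th Th.
  by rewrite /lam big_ord_recl c1// lerDl sumr_ge0.
exists rho; split => //; first exact: ltW.
move=> th Th; rewrite Elam//.
have -> : \sum_(k < N.+1) (rho ^- k * collapsed_iter k.+1 th) =
    rho * \sum_(k < N.+1) c k.+1 th.
  have rr k : rho * rho ^- k.+1 = rho ^- k.
    by rewrite exprS invfM mulrA divff ?mul1r// gt_eqF.
  by rewrite mulr_sumr; apply: eq_bigr => k _; rewrite /c -rr -mulrA.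
rewrite ler_wpM2l ?(ltW rho0)//.
have : c 0%N th + \sum_(k < N.+1) c k.+1 th = lam N.+1 th + c N.+1 th.
  by rewrite -(big_ord_recl N.+1 (fun k => c k th)) -(big_ord_recr N.+1 (fun k => c k th)).
have : c N.+1 th <= 1.
  by rewrite /c mulrC ler_pdivrMr ?exprn_gt0// mul1r HN.
rewrite c1//; lra.
Qed.

Lemma cond_ii_iter :
  (limn_esup (fun n : nat =>
     ereal_sup [set poweR (Gn as_ bs_ f r n th) (n%:R)^-1 | th in Theta]) < 1%:E)%E ->
  exists N (rho : R), [/\ 0 < rho, rho < 1 &
    forall th, Theta th -> collapsed_iter N.+1 th <= rho ^+ N.+1].
Proof.
set u := (u in limn_esup u).
rewrite /limn_esup /limf_esup => /ereal_inf_lt[_ [A [N _ NA] <-]] supA.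
(* The successor keeps the exponent [n^-1] away from its value at [n = 0]. *)
have AN : A N.+1 by apply: NA => /=.
have uN : (u N.+1 < 1%:E)%E.
  by apply: le_lt_trans supA; apply: ereal_sup_ubound; exists N.+1.
(* The supremum may be 0, or minus infinity over an empty [Theta]; the maximum makes the rate
   positive, as dividing by its powers requires. *)
exists N, (Num.max (fine (u N.+1)) (1 / 2)); split.
- by rewrite lt_max divr_gt0// orbT.
- rewrite gt_max ltr_pdivrMr// mul1r ltr1n andbT.
  by move: uN; case: (u N.+1) => [s| |]//=.
- move=> th Th; set rho := Num.max _ _.
  have [_ /(_ th)/andP[G0 _] GE] := collapsed_iterP N.+1.
  set G := collapsed_iter N.+1 th in G0 *.
  have h1 : ((G `^ (N.+1%:R)^-1)%:E <= u N.+1)%E.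
    by rewrite -poweR_EFin -GE//; apply: ereal_sup_ubound; exists th.
  have h2 : G `^ (N.+1%:R)^-1 <= rho.
    rewrite le_max; apply/orP; left.
    by move: h1 uN; case: (u N.+1) => [s| |]//=; rewrite ?lee_fin ?leeNy_eq.
  have -> : G = (G `^ (N.+1%:R)^-1) ^+ N.+1.
    by rewrite -powR_mulrn ?powR_ge0// -powRrM mulVf ?powRr1// pnatr_eq0.
  by apply: lerXn2r; rewrite ?nnegrE ?powR_ge0// le_max divr_ge0// orbT.
Qed.

Lemma iter_cond_ii (D c : R) : 0 <= D -> 0 <= c -> c < 1 ->
  (forall n th, Theta th -> collapsed_iter n th <= D * c ^+ n) ->
  (limn_esup (fun n : nat =>
     ereal_sup [set poweR (Gn as_ bs_ f r n th) (n%:R)^-1 | th in Theta]) < 1%:E)%E.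
Proof.
move=> D0 c0 cl1 H.
set u := (u in limn_esup u).
(* A rate strictly between [c] and 1: the factor [D] is eventually absorbed in [(q / c) ^ n], which
   gives [D * c ^+ n <= q ^+ n]. *)
pose q := (1 + c) / 2.
have q0 : 0 < q by rewrite divr_gt0// ltr_pwDl.
have q1 : q < 1 by rewrite /q; lra.
have cq : `|c / q| < 1.
  rewrite ger0_norm; last by apply: divr_ge0 => //; exact: ltW.
  by rewrite ltr_pdivrMr// mul1r /q; lra.
have : (fun n => D * (c / q) ^+ n) @ \oo --> 0.
  by rewrite -(mulr0 D); apply: cvgM; [exact: cvg_cst|exact: cvg_expr].
move=> /cvgrPdist_le/(_ 1 ltr01)[N _ HN].
apply: (@le_lt_trans _ _ q%:E); last by rewrite lte_fin.
rewrite /limn_esup /limf_esup.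
apply: (@le_trans _ _ (ereal_sup (u @` [set n | (N.+1 <= n)%N]))).
  by apply: ereal_inf_lbound; exists [set n | (N.+1 <= n)%N] => //; exists N.+1.
apply: ge_ereal_sup => _ [n /= Nn <-].
apply: ge_ereal_sup => _ [th Th <-].
have [_ /(_ th)/andP[G0 _] ->//] := collapsed_iterP n.
rewrite poweR_EFin lee_fin.
have n0 : n%:R != 0 :> R by rewrite pnatr_eq0; case: n Nn {G0}.
have -> : q = (q ^+ n) `^ (n%:R)^-1.
  by rewrite -powR_mulrn ?(ltW q0)// -powRrM divff// powRr1// ltW.
apply: ge0_ler_powR; rewrite ?nnegrE ?invr_ge0 ?exprn_ge0 ?(ltW q0)//.
apply: (le_trans (H n th Th)).
have := HN n (ltnW Nn); rewrite /= sub0r normrN ger0_norm; last first.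
  by rewrite mulr_ge0// exprn_ge0// divr_ge0// ltW.
by rewrite expr_div_n mulrA ler_pdivrMr ?exprn_gt0// mul1r.
Qed.

End collapsed_chain.

(** * Perturbed drift *)

Section homogeneous.
Context {R : realType} {p : nat}.
Local Notation vec := (p.-tuple R).
Variable r : R.
Hypothesis r0 : 0 < r.

(** The extension of [h] from the sphere that is homogeneous of degree [r]. By [integrandE] its mean
    after one step of the homogeneous chain is the expectation in (i), so (i) is a drift inequality
    for it. *)
Definition radial (h : vec -> R) (x : vec) : R :=
  h (tscale (enorm x)^-1 x) * (enorm x) `^ r.

Lemma integrandE as_ bs_ h x u :
  integrand as_ bs_ r h x u = radial h (shift x (star as_ x + star bs_ x * u)).
Proof. by rewrite /integrand mulrC. Qed.

Lemma radial_tscale h c x : 0 < c -> radial h (tscale c x) = c `^ r * radial h x.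
Proof.
move=> c0; rewrite /radial normalize_tscale// enorm_tscale gtr0_norm//.
by rewrite powRM ?enorm_ge0 ?(ltW c0)//; ring.
Qed.

Lemma measurable_radial h : measurable_fun setT h -> measurable_fun setT (radial h).
Proof.
move=> mh; apply: measurable_funM; last first.
  exact: (measurableT_comp (measurable_powR r) measurable_enorm).
apply: (measurableT_comp mh); apply: measurable_tscale => //.
rewrite (_ : (fun _ => _) = (fun x : vec => (enorm x) `^ (-1))).
  exact: (measurableT_comp (measurable_powR (-1)) measurable_enorm).
by apply/funext => x; rewrite powR_inv1// enorm_ge0.
Qed.

Lemma radial_Theta h th : Theta th -> radial h th = h th.
Proof. by move=> Th; rewrite /radial Th invr1 tscale1 powR1 mulr1. Qed.

Lemma radial_le h D x : (forall y, h y <= D) -> radial h x <= D * (enorm x) `^ r.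
Proof. by move=> hD; rewrite ler_wpM2r ?powR_ge0. Qed.

Lemma radial_ge0 h x : (forall y, 0 <= h y) -> 0 <= radial h x.
Proof. by move=> h0; rewrite mulr_ge0 ?powR_ge0. Qed.

Lemma radial_ge h D x : (forall th, Theta th -> D <= h th) -> D * (enorm x) `^ r <= radial h x.
Proof.
move=> hD; have [x0|x0] := eqVneq (enorm x) 0.
  by rewrite /radial x0 powR0 ?gt_eqF// !mulr0.
by rewrite ler_wpM2r ?powR_ge0// hD//; exact: Theta_normalize.
Qed.

Lemma enorm_shift_affine (x : vec) (s t u : R) :
  enorm (shift x (s + t * u)) <= (`|s| + `|t| + enorm x) * (1 + `|u|).
Proof.
rewrite (le_trans (enorm_shift_le _ _))//.
have := ler_normD s (t * u); rewrite normrM.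
have : 0 <= `|s| * `|u| by [].
have : 0 <= enorm x * `|u| by rewrite mulr_ge0 ?enorm_ge0.
have : 0 <= `|t| by [].
lra.
Qed.

Lemma powR_enorm_shift_affine (x : vec) (K s t u : R) : `|s| + `|t| + enorm x <= K ->
  (enorm (shift x (s + t * u))) `^ r <= K `^ r * weight r u.
Proof.
move=> hK; have K0 : 0 <= K by apply: le_trans hK; rewrite !addr_ge0 ?enorm_ge0.
rewrite -powRM ?addr_ge0//.
apply: ge0_ler_powR; rewrite ?nnegrE ?enorm_ge0 ?mulr_ge0 ?addr_ge0 ?(ltW r0)//.
by apply: (le_trans (enorm_shift_affine _ _ _ _)); rewrite ler_wpM2r ?addr_ge0.
Qed.

Lemma dominated_shift (g : vec -> R) (D : R) (x : vec) (s t : R) :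
  measurable_fun setT g -> (forall y, 0 <= g y <= D * (enorm y) `^ r) ->
  dominated r (fun u => g (shift x (s + t * u))).
Proof.
move=> mg hg.
have ms : measurable_fun setT (fun u : R => shift x (s + t * u)).
  apply: measurable_shift => //.
  by apply: measurable_funD => //; apply: measurable_funM.
apply: (@dominated_le _ _ _ (fun u => (`|D| * (`|s| + `|t| + enorm x) `^ r) * weight r u)).
- exact: (measurableT_comp mg ms).
- by apply: dominatedZ; exact: dominated_weight.
- move=> u; have /andP[h1 h2] := hg (shift x (s + t * u)).
  rewrite ger0_norm// (le_trans h2)// -mulrA.
  rewrite (@le_trans _ _ (`|D| * (enorm (shift x (s + t * u))) `^ r))//.
    by rewrite ler_wpM2r ?powR_ge0// ler_norm.
  by rewrite ler_wpM2l// powR_enorm_shift_affine.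
Qed.

End homogeneous.

Section coordinate_levels.
Context {R : realType} {q : nat}.
Local Notation p := q.+1.
Local Notation vec := (p.-tuple R).

(* The penalty M^(p-i) for a small i-th coordinate loses a factor M when that
   coordinate is shifted to place i+1, up to a rescaling of the thresholds dl. *)
Definition small (dl : nat -> R) (i : nat) (y : vec) : R :=
  if `|nth 0 y i| < dl i * enorm y then 1 else 0.
Definition level (M : R) (dl : nat -> R) (y : vec) : R :=
  \sum_(i < p) M ^+ (p - i) * small dl i y.

Lemma small01 dl i y : 0 <= small dl i y <= 1.
Proof. by rewrite /small; case: ifP; rewrite ?lexx ler01. Qed.

Lemma measurable_level M dl : measurable_fun setT (level M dl).
Proof.
apply: measurable_sum => i; apply: measurable_funM => //.
apply: measurable_fun_ifT => //; apply: measurable_fun_ltr.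
  by apply: measurableT_comp => //; exact: measurable_nth.
by apply: measurable_funM => //; exact: measurable_enorm.
Qed.

Lemma level_tscale (M : R) (dl : nat -> R) (c : R) (y : vec) : 0 < c -> level M dl (tscale c y) = level M dl y.
Proof.
move=> c0; apply: eq_bigr => i _; congr (_ * _); rewrite /small nth_tscale enorm_tscale.
by rewrite normrM (gtr0_norm c0) mulrCA ltr_pM2l.
Qed.

Lemma level_ge0 M dl y : 1 <= M -> 0 <= level M dl y.
Proof.
move=> M1; apply: sumr_ge0 => i _; have /andP[h _] := small01 dl i y.
by rewrite mulr_ge0// exprn_ge0// (le_trans ler01).
Qed.

Lemma level_le M dl y : 1 <= M -> level M dl y <= p%:R * M ^+ p.
Proof.
move=> M1; rewrite (@le_trans _ _ (\sum_(i < p) M ^+ p))//.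
  apply: ler_sum => i _; have /andP[h0 h1] := small01 dl i y.
  rewrite -[leRHS]mulr1; apply: ler_pM => //; first by rewrite exprn_ge0// (le_trans ler01).
  by rewrite ler_weXn2l// leq_subr.
by rewrite sumr_const card_ord mulr_natl.
Qed.

(** The last place carries the smallest penalty, [M ^+ 1], so any small coordinate costs at least
    [M]. *)
Lemma level_ge (M : R) (dl : nat -> R) (y : vec) (i : 'I_p) : 1 <= M -> `|tnth y i| < dl i * enorm y -> M <= level M dl y.
Proof.
move=> M1 yi; rewrite /level (bigD1 i)//= {1}/small -(tnth_nth 0) yi mulr1.
rewrite (@le_trans _ _ (M ^+ (p - i)))//.
  by rewrite -[leLHS]expr1 ler_weXn2l// subn_gt0.
rewrite lerDl sumr_ge0// => j _; have /andP[h _] := small01 dl j y.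
by rewrite mulr_ge0// exprn_ge0// (le_trans ler01).
Qed.

Lemma level_eq0 (M : R) (dl : nat -> R) (y : vec) : (forall i : 'I_p, dl i * enorm y <= `|tnth y i|) -> level M dl y = 0.
Proof.
move=> H; apply: big1 => i _; rewrite /small -tnth_nth ltNge H/= mulr0//.
Qed.

(** The old coordinate [i] sits at place [i.+1], where its penalty is smaller by a factor [M].
    Relative to the new norm, at most [Rr], it can look smaller by that factor, which is why the
    thresholds satisfy [dl i = dl i.+1 * Rr]. Only the entering coordinate can add a new penalty. *)
Lemma level_shift (M : R) (dl : nat -> R) (Rr : R) (th : vec) (z : R) : 1 <= M -> 0 < Rr -> (forall i, 0 <= dl i) ->
  (forall i, dl i = dl i.+1 * Rr) -> Theta th -> enorm (shift th z) <= Rr ->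
  level M dl (shift th z) <= M ^+ p * (if `|z| < dl 0%N * Rr then 1 else 0) + level M dl th / M.
Proof.
move=> M1 Rr0 dl0 dlS Th wR.
have M0 : 0 < M by exact: lt_le_trans M1.
rewrite /level big_ord_recl subn0 lerD//.
  rewrite ler_wpM2l ?exprn_ge0 ?(ltW M0)// /small.
  rewrite (_ : nth 0 (shift th z) (ord0 : 'I_p) = z); last first.
    by rewrite -tnth_nth tnth_shift0.
  case: ifPn => [h|_]; last by case: ifP.
  by rewrite (lt_le_trans h)// ler_wpM2l.
rewrite big_ord_recr/= mulrDl mulr_suml.
rewrite -[leLHS]addr0 lerD//; last first.
  have /andP[h _] := small01 dl q th.
  by rewrite divr_ge0 ?mulr_ge0 ?exprn_ge0// ltW.
apply: ler_sum => i _; rewrite /bump leq0n add1n.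
have -> : M ^+ (p - i.+1) = M ^+ (p - i) / M.
  by rewrite -(subnSK (leqW (ltn_ord i))) exprSr mulfK// gt_eqF.
rewrite mulrAC ler_wpM2r ?invr_ge0 ?(ltW M0)// ler_wpM2l ?exprn_ge0 ?(ltW M0)//.
rewrite /small.
have -> : nth 0 (shift th z) i.+1 = nth 0 th i.
  have ip : (i.+1 < p)%N by rewrite ltnS ltn_ord.
  rewrite -(tnth_nth 0 _ (Ordinal ip)) (@tnth_shiftS _ _ th z _ (Ordinal (ltnW ip)))//.
  by rewrite (tnth_nth 0).
case: ifPn => [h|_]; last by case: ifP.
rewrite (lt_le_trans h)// Th mulr1 [leRHS]dlS ler_wpM2l//.
Qed.

End coordinate_levels.

(* (a x / |x|, b x / |x|) is d-close to the limit coefficients at x / |x| for large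
   |x|, so by homogeneity this is a drift of the original chain towards a ball. *)
Definition perturbed_drift {R : realType} {p : nat} (as_ bs_ : p.-tuple R -> R)
    (f : R -> R) (r : R) := exists (g : p.-tuple R -> R) (rho d c1 c3 : R),
  [/\ measurable_fun setT g, 0 <= rho < 1, 0 < d & 0 < c1] /\
  [/\ forall c x, 0 < c -> g (tscale c x) = c `^ r * g x,
      forall x, c1 * (enorm x) `^ r <= g x <= c3 * (enorm x) `^ r &
      forall th s t, Theta th -> 0 <= t -> `|s - star as_ th| <= d ->
        `|t - star bs_ th| <= d ->
        Ex f (fun u => g (shift th (s + t * u))) <= rho * g th].

Lemma max_perturb (R : realType) (cm a b s t d : R) :
  cm <= Num.max `|a| b -> `|s - a| <= d -> `|t - b| <= d -> d <= cm / 2 ->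
  cm / 2 <= Num.max `|s| t.
Proof.
rewrite !le_max => /orP[h|h] sa tb dc; apply/orP; [left|right].
  have : `|a| <= `|s - a| + `|s|.
    by rewrite distrC -{1}(subrK s a) ler_normD.
  lra.
by move: tb; rewrite ler_norml => /andP[? ?]; lra.
Qed.

(** * The drift with penalized small coordinates *)

Section drift_multi.
Context {R : realType} {q : nat}.
Local Notation p := q.+1.
Local Notation vec := (p.-tuple R).
Variables (as_ bs_ : vec -> R) (f : R -> R) (r C Cf cm : R).
Hypotheses (r0 : 0 < r) (wf : weightable r f) (fC : forall u, f u <= Cf).
Hypotheses (C0 : 0 <= C) (AC : forall th, Theta th -> `|star as_ th| <= C)
  (BC : forall th, Theta th -> `|star bs_ th| <= C).
Hypotheses (cm0 : 0 < cm)
  (max_cm : forall th, Theta th -> cm <= Num.max `|star as_ th| (star bs_ th)).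
Hypothesis B_away : forall dl : nat -> R, (forall i, 0 < dl i) ->
  exists2 eta : R, 0 < eta & forall th : vec, Theta th ->
    (forall i : 'I_p, dl i <= `|tnth th i|) -> eta <= star bs_ th.

(* The first two terms account for the transitions that leave the good region:
   a new coordinate below d0, or an innovation above A. *)
Lemma level_term_le (M A d0 Rr : R) (dl : nat -> R) (th : vec) (s t : R) :
  1 <= M -> 0 < Rr -> 0 <= A -> Rr = (2 * C + 3) * (1 + A) ->
  (forall i, 0 <= dl i) -> (forall i, dl i = dl i.+1 * Rr) -> dl 0%N * Rr = d0 ->
  Theta th -> `|s| <= C + 1 -> `|t| <= C + 1 ->
  let W := (2 * C + 3) `^ r in
  forall u,
  (enorm (shift th (s + t * u))) `^ r * level M dl (shift th (s + t * u)) <=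
    (W * M ^+ p) * (weight r u * \1_[set v | `|s + t * v| < d0] u) +
    (W * (p%:R * M ^+ p)) * (weight r u * \1_[set v : R | A < `|v|] u) +
    (W * (level M dl th / M)) * weight r u.
Proof.
move=> M1 Rr0 A0 RrE dl0 dlS d0E Th sC tC W u.
have M0 : 0 < M by exact: lt_le_trans M1.
have W0 : 0 <= W by exact: powR_ge0.
have w0 := weight_ge0 r u.
have hK : `|s| + `|t| + enorm th <= 2 * C + 3 by rewrite Th; lra.
have wW : (enorm (shift th (s + t * u))) `^ r <= W * weight r u.
  exact: powR_enorm_shift_affine.
have l0 y : 0 <= level M dl y by exact: level_ge0.
set X1 := \1_[set v | _ < d0] u; set X2 := \1_[set v : R | A < _] u.
have X10 : 0 <= X1 by rewrite /X1 indicE ler0n.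
have X20 : 0 <= X2 by rewrite /X2 indicE ler0n.
suff H : level M dl (shift th (s + t * u)) <=
    M ^+ p * X1 + p%:R * M ^+ p * X2 + level M dl th / M.
  rewrite (@le_trans _ _ (W * weight r u *
    (M ^+ p * X1 + p%:R * M ^+ p * X2 + level M dl th / M)))//.
    by apply: ler_pM => //; rewrite powR_ge0.
  by rewrite le_eqVlt; apply/orP; left; apply/eqP; ring.
have lM : 0 <= level M dl th / M by rewrite divr_ge0// ltW.
have MX1 : 0 <= M ^+ p * X1 by rewrite mulr_ge0// exprn_ge0// ltW.
have [uA|uA] := ltP A `|u|.
  have -> : X2 = 1 by rewrite /X2 indicE mem_set.
  rewrite mulr1 (le_trans (level_le dl _ M1))// -addrA addrCA lerDl.
  exact: addr_ge0.
have -> : X2 = 0 by rewrite /X2 indicE memNset//=; apply/negP; rewrite -leNgt.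
rewrite mulr0 addr0.
have wR : enorm (shift th (s + t * u)) <= Rr.
  rewrite (le_trans (enorm_shift_affine _ _ _ _))// RrE.
  by apply: ler_pM => //; rewrite ?addr_ge0 ?enorm_ge0// lerD2l.
apply: (le_trans (level_shift M1 Rr0 dl0 dlS Th wR)); rewrite lerD2r d0E.
rewrite ler_wpM2l ?exprn_ge0 ?(ltW M0)// /X1 indicE.
case: ifPn => [h|_]; last by rewrite ler0n.
by rewrite mem_set.
Qed.

(** The function is [g0 + qf], the homogeneous extension of [lam] plus the penalty. Where no
    coordinate is small the penalty vanishes, the scale is at least [eta], and [Ex_affine_le]
    transfers the drift of [g0]. Elsewhere the penalty is at least [M]: its own decrease outweighs
    even the crude bound [c2 * BB] on the mean of [g0]. *)
Lemma perturbed_drift_multi (lam : vec -> R) : drift_lambda as_ bs_ f r lam ->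
  perturbed_drift as_ bs_ f r.
Proof.
move=> [mlam [c1 [c2 [c10 [lamb lamc]]]] [rho [rho0 rho1 Hrho]]].
have c20 : 0 <= c2.
  by have /andP[h1 h2] := lamb [tuple 0 | i < p]; exact: le_trans h2.
pose W := (2 * C + 3) `^ r.
have W0 : 0 <= W by exact: powR_ge0.
pose Ew := Ex f (weight r).
have Ew0 : 0 <= Ew by apply: (Ex_ge0 wf) => u; exact: weight_ge0.
pose BB := W * Ew.
have BB0 : 0 <= BB by rewrite mulr_ge0.
(* Large enough that one step leaves at most a quarter of the old penalty and that [c2 * BB] is at
   most a quarter of any nonzero penalty. *)
pose M := 4 * BB + 4 * (c2 * BB) + 1.
have cB0 : 0 <= c2 * BB by rewrite mulr_ge0.
have M1 : 1 <= M by rewrite lerDr addr_ge0// mulr_ge0.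
have M0 : 0 < M by exact: lt_le_trans M1.
have BM : BB / M <= 1 / 4.
  by rewrite ler_pdivrMr// /M; lra.
have cBM : c2 * BB <= M / 4 by rewrite /M; lra.
clearbody M.
(* Where no coordinate is small three errors [e] occur and must fit into half the margin
   [(1 - rho) * c1]; elsewhere two occur and [2 * e <= 1 / 4 <= M / 4] is needed. *)
pose e := Num.min (1 / 8) ((1 - rho) * c1 / 6).
have e0 : 0 < e by rewrite lt_min !divr_gt0// mulr_gt0// subr_gt0.
have e1 : e <= 1 / 8 by rewrite ge_min lexx.
have e2 : e <= (1 - rho) * c1 / 6 by rewrite ge_min lexx orbT.
clearbody e.
pose K1 := W * M ^+ p; pose K2 := W * (p%:R * M ^+ p).
have Mp0 : 0 <= M ^+ p by rewrite exprn_ge0// ltW.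
have K10 : 0 <= K1 by rewrite mulr_ge0.
have K20 : 0 <= K2 by rewrite !mulr_ge0.
have scale_e (K x : R) : 0 <= K -> x <= e / (K + 1) -> K * x <= e.
  move=> k0 hx; rewrite (le_trans (ler_wpM2l k0 hx))// mulrA ler_pdivrMr ?ltr_wpDl//.
  by rewrite mulrC ler_wpM2l ?(ltW e0)// lerDl.
have eK K : 0 <= K -> 0 < e / (K + 1) by move=> k0; rewrite divr_gt0// ltr_wpDl.
have [A A0 tailA] := Ex_tail wf (eK _ K20).
have [d0 d00 rootd] := Ex_weight_near_root (ltW r0) wf fC
  (divr_gt0 cm0 (@ltr0Sn R 1)) (eK _ K10).
pose Rr := (2 * C + 3) * (1 + A).
have Rr0 : 0 < Rr by apply: mulr_gt0; [rewrite ltr_wpDl// mulr_ge0|rewrite addr_gt0].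
(* The geometric thresholds required by [level_shift]; at place 0 the condition on the new value
   becomes [|z| < d0], the event made improbable by the choice of [d0]. *)
pose dl i := d0 / Rr ^+ i.+1.
have dl0 i : 0 < dl i by rewrite divr_gt0// exprn_gt0.
have dlS i : dl i = dl i.+1 * Rr.
  rewrite /dl [Rr ^+ i.+2]exprSr; field.
  by rewrite !gt_eqF// exprn_gt0.
have d0E : dl 0%N * Rr = d0 by rewrite /dl expr1 divfK// gt_eqF.
have [eta eta0 Heta] := B_away dl0.
have [d1 d10 HTV] := Ex_affine_le (ltW r0) wf C0 eta0 c20 e0.
pose g0 := radial r lam.
pose qf := fun y : vec => (enorm y) `^ r * level M dl y.
pose g := g0 \+ qf.
have mg0 : measurable_fun setT g0 by exact: measurable_radial.
have mqf : measurable_fun setT qf.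
  apply: measurable_funM; last exact: measurable_level.
  exact: (measurableT_comp (measurable_powR r) measurable_enorm).
have g0b y : 0 <= g0 y <= c2 * (enorm y) `^ r.
  rewrite radial_ge0 ?radial_le// => z; first by have /andP[_ h] := lamb z; exact: h.
  by have /andP[] := lamb z.
have qfb y : 0 <= qf y <= p%:R * M ^+ p * (enorm y) `^ r.
  rewrite /qf mulr_ge0 ?powR_ge0 ?level_ge0//= [leLHS]mulrC ler_wpM2r ?powR_ge0//.
  exact: level_le.
(* The factor [3 / 4] serves states with a small coordinate, [(1 + rho) / 2] the others. *)
pose rho' := Num.max (3 / 4) ((1 + rho) / 2).
pose d := Num.min 1 (Num.min (cm / 2) d1).
exists g, rho', d, c1, (c2 + p%:R * M ^+ p).
have dpos : 0 < d by rewrite !lt_min ltr01 divr_gt0.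
have dle1 : d <= 1 by rewrite ge_min lexx.
have dle2 : d <= cm / 2 by rewrite !ge_min lexx ?orbT.
have dle3 : d <= d1 by rewrite !ge_min lexx ?orbT.
clearbody d.
split.
  split => //; first exact: measurable_funD.
  rewrite le_max divr_ge0//= gt_max ltr_pdivrMr// mul1r.
  by rewrite ltr_pdivrMr// mul1r ltr_nat/= -natr1 addrC ltrD2r.
split.
- move=> c x c0; rewrite /g/= /g0 radial_tscale// /qf level_tscale//.
  by rewrite enorm_tscale (gtr0_norm c0) powRM ?enorm_ge0 ?(ltW c0)//; ring.
- move=> x; have /andP[h1 h2] := g0b x; have /andP[h3 h4] := qfb x.
  apply/andP; split; last by rewrite mulrDl lerD.
  rewrite (@le_trans _ _ (g0 x))// ?lerDl//.
  exact: radial_ge.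
move=> th s t Th t0 sa tb.
have sC : `|s| <= C + 1.
  rewrite -(subrK (star as_ th) s) (le_trans (ler_normD _ _))// addrC lerD ?AC//.
  exact: le_trans dle1.
have tC : `|t| <= C + 1.
  rewrite -(subrK (star bs_ th) t) (le_trans (ler_normD _ _))// addrC lerD ?BC//.
  exact: le_trans dle1.
have cst_ : cm / 2 <= Num.max `|s| t by exact: max_perturb (max_cm Th) sa tb dle2.
have dg0 : dominated r (fun u => g0 (shift th (s + t * u))) by exact: dominated_shift g0b.
have dqf : dominated r (fun u => qf (shift th (s + t * u))) by exact: dominated_shift qfb.
have dw := dominated_weight r.
have gE : g th = lam th + level M dl th.
  by rewrite /g/= /g0 radial_Theta// /qf Th powR1 mul1r.
have l0 : 0 <= level M dl th by exact: level_ge0.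
have lam1 : c1 <= lam th by exact: lamc.
set lv := level M dl th in gE l0 *.
have mT := measurable_normr_gt A.
have mI := measurable_abs_affine_lt s t d0.
have d1w : dominated r (fun u => weight r u * \1_[set v | `|s + t * v| < d0] u).
  exact: dominated_indic.
have d2w : dominated r (fun u => weight r u * \1_[set v : R | A < `|v|] u).
  exact: dominated_indic.
have Eq : Ex f (fun u => qf (shift th (s + t * u))) <= e + e + lv / 4.
  apply: (@le_trans _ _ (Ex f ((
    (fun u => K1 * (weight r u * \1_[set v | `|s + t * v| < d0] u)) \+
    (fun u => K2 * (weight r u * \1_[set v : R | A < `|v|] u))) \+
    (fun u => (W * (lv / M)) * weight r u)))).
    apply: (Ex_le wf) => //.
      by apply: dominatedD; [apply: dominatedD|]; exact: dominatedZ.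
    move=> u; apply: (@level_term_le M A d0 Rr dl th s t) => //; first exact: ltW.
    by move=> i; exact: ltW.
  rewrite (ExD wf); [|by apply: dominatedD; exact: dominatedZ|exact: dominatedZ].
  rewrite (ExD wf); [|exact: dominatedZ|exact: dominatedZ].
  rewrite !(ExZ wf)// lerD//.
    by rewrite lerD// scale_e// rootd.
  rewrite (_ : W * (lv / M) * _ = BB / M * lv); last by rewrite /BB /Ew; ring.
  by rewrite (le_trans (ler_wpM2r l0 BM))// mul1r mulrC.
have -> : (fun u => g (shift th (s + t * u))) =
  (fun u => g0 (shift th (s + t * u))) \+ (fun u => qf (shift th (s + t * u))) by [].
rewrite (ExD wf)// gE.
have [H|H] := pselect (forall i : 'I_p, dl i <= `|tnth th i|).
  have lv0 : lv = 0 by apply: level_eq0 => i; rewrite Th mulr1.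
  have hTV : Ex f (fun u => g0 (shift th (s + t * u))) <=
      Ex f (fun u => g0 (shift th (star as_ th + star bs_ th * u))) + e.
    apply: (HTV (fun z => g0 (shift th z))).
    - by apply: (measurableT_comp mg0); apply: measurable_shift.
    - move=> z; have /andP[-> h2] := g0b (shift th z).
      rewrite (le_trans h2)// ler_wpM2l// /weight.
      apply: ge0_ler_powR; rewrite ?nnegrE ?enorm_ge0 ?addr_ge0 ?(ltW r0)//.
      by rewrite (le_trans (enorm_shift_le _ _))// Th addrC.
    - exact: AC.
    - by rewrite Heta//= (le_trans (ler_norm _))// BC.
    - exact: le_trans dle3.
    - exact: le_trans dle3.
  have hrho := Hrho th Th.
  rewrite (_ : integrand as_ bs_ r lam th =
    (fun u => g0 (shift th (star as_ th + star bs_ th * u)))) in hrho; last first.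
    by apply/funext => u; rewrite integrandE.
  rewrite lv0 addr0; rewrite lv0 mul0r addr0 in Eq.
  apply: (@le_trans _ _ ((1 + rho) / 2 * lam th)); last first.
    by rewrite ler_wpM2r ?le_max ?lexx ?orbT// (le_trans (ltW c10)).
  have h3 : (1 - rho) * c1 <= (1 - rho) * lam th by rewrite ler_wpM2l// subr_ge0 ltW.
  move: (Ex f _) (Ex f _) (Ex f _) (lam th) Eq hTV hrho h3 => x1 x2 x3 x4 k1 k2 k3 k4.
  by clear -e2 k1 k2 k3 k4 r0 wf fC C0 AC BC cm0 max_cm B_away; lra.
have [i Hi] : exists i : 'I_p, `|tnth th i| < dl i.
  apply: contrapT => nH; apply: H => i; rewrite leNgt; apply/negP => h.
  by apply: nH; exists i.
have lvM : M <= lv by apply: (level_ge (i := i) M1); rewrite Th mulr1.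
have hg0 : Ex f (fun u => g0 (shift th (s + t * u))) <= c2 * BB.
  rewrite /BB mulrA -(ExZ wf)//; apply: (Ex_le wf) => //; first exact: dominatedZ.
  move=> u; have /andP[_ h] := g0b (shift th (s + t * u)).
  rewrite (le_trans h)// -mulrA ler_wpM2l//.
  by apply: powR_enorm_shift_affine => //; rewrite Th; clear -sC tC r0 wf fC C0 AC BC cm0 max_cm B_away; lra.
apply: (@le_trans _ _ (3 / 4 * (lam th + lv))); last first.
  by rewrite ler_wpM2r ?le_max ?lexx// addr_ge0// (le_trans (ltW c10)).
move: (Ex f _) (Ex f _) (lam th) Eq hg0 lam1 => x1 x2 x4 k1 k2 k3.
by clearbody lv; clear -k1 k2 k3 cBM lvM M1 e1 c10 r0 wf fC C0 AC BC cm0 max_cm B_away; lra.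
Qed.

End drift_multi.

(** The point 0 is treated directly because differentiability, used elsewhere, is available only for
    a positive base. *)
Lemma continuous_normr_powR (R : realType) (r : R) : 0 < r ->
  continuous (fun t : R => `|t| `^ r).
Proof.
move=> r0 x; have [->|x0] := eqVneq x 0.
  apply/cvgrPdist_le => e e0.
  rewrite normr0 powR0 ?gt_eqF//.
  have d0 : 0 < e `^ r^-1 by exact: powR_gt0.
  apply/nbhs_ballP; exists (e `^ r^-1) => //= t; rewrite /ball/= sub0r normrN => /ltW td.
  rewrite sub0r normrN ger0_norm ?powR_ge0//.
  rewrite [leRHS](_ : e = (e `^ r^-1) `^ r); last first.
    by rewrite -powRrM mulVf ?gt_eqF// powRr1// ltW.
  by apply: ge0_ler_powR; rewrite ?nnegrE ?powR_ge0// ltW.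
apply: (@continuous_comp _ _ _ (@Num.norm R R) (fun y => y `^ r)).
  exact: norm_continuous.
apply: differentiable_continuous; apply/derivable1_diffP; apply: derivable_powR.
by rewrite in_itv/= andbT normr_gt0.
Qed.

(** * The drift in dimension one *)

Section drift_one.
Context {R : realType}.
Local Notation vec := (1.-tuple R).
Variables (as_ bs_ : vec -> R) (f : R -> R) (r C : R).
Hypotheses (r0 : 0 < r) (wf : weightable r f).
Hypotheses (C0 : 0 <= C) (AC : forall th, Theta th -> `|star as_ th| <= C)
  (BC : forall th, Theta th -> `|star bs_ th| <= C).

Lemma shift1E (x : vec) z : shift x z = [tuple z | _ < 1].
Proof. by apply: eq_from_tnth => i; rewrite !tnth_mktuple (ord1 i). Qed.

Lemma radial_shift1 (h : vec -> R) x z :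
  radial r h (shift x z) = h [tuple `|z|^-1 * z | _ < 1] * `|z| `^ r.
Proof.
have zE : enorm (shift x z) = `|z|.
  by rewrite /enorm big_ord_recl big_ord0 addr0 shift1E tnth_mktuple sqrtr_sqr.
rewrite /radial zE tscale_shift shift1E//.
Qed.

(** Here [lam] is seen only through the sign of the next value, so its values agree unless the sign
    changes, and then the perturbed value is itself small. No lower bound on the scale enters. *)
Lemma perturbed_drift_one (lam : vec -> R) : drift_lambda as_ bs_ f r lam ->
  perturbed_drift as_ bs_ f r.
Proof.
move=> [mlam [c1 [c2 [c10 [lamb lamc]]]] [rho [rho0 rho1 Hrho]]].
have c20 : 0 <= c2.
  by have /andP[h1 h2] := lamb [tuple 0 | i < 1]; exact: le_trans h2.
pose Ew := Ex f (weight r).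
have Ew0 : 0 <= Ew by apply: (Ex_ge0 wf) => u; exact: weight_ge0.
(* Chosen so that the total error [c2 * e * Ew] is at most half the margin. *)
pose e := (1 - rho) * c1 / 2 / ((c2 + 1) * (Ew + 1)).
have cE0 : 0 < (c2 + 1) * (Ew + 1) by rewrite mulr_gt0// ltr_wpDl.
have e0 : 0 < e by rewrite !divr_gt0// mulr_gt0// subr_gt0.
have eE : c2 * e * Ew <= (1 - rho) * c1 / 2.
  rewrite (@le_trans _ _ (e * ((c2 + 1) * (Ew + 1))))//; last by rewrite /e divfK// gt_eqF.
  rewrite (mulrC c2) -mulrA ler_wpM2l ?(ltW e0)//.
  by apply: ler_pM => //; rewrite lerDl.
clearbody e.
have [d d0 Hd] := segment_unif_continuous (- C) C (continuous_normr_powR r0) e0.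
pose g := radial r lam.
have mg : measurable_fun setT g by exact: measurable_radial.
have gb y : 0 <= g y <= c2 * (enorm y) `^ r.
  rewrite radial_ge0 ?radial_le// => z; first by have /andP[_ h] := lamb z; exact: h.
  by have /andP[] := lamb z.
exists g, ((1 + rho) / 2), d, c1, c2; split.
  split=> //; rewrite divr_ge0 ?addr_ge0//= ltr_pdivrMr// mul1r.
  by rewrite (_ : 2 = 1 + 1)// ltrD2l.
split.
- by move=> c x; exact: radial_tscale.
- by move=> x; have /andP[_ ->] := gb x; rewrite andbT; exact: radial_ge.
move=> th s t Th t0 sa tb.
pose a := star as_ th; pose b := star bs_ th.
have dg s' t' : dominated r (fun u => g (shift th (s' + t' * u))).
  exact: dominated_shift gb.
have dw := dominated_weight r.
have hrho := Hrho th Th.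
rewrite (_ : integrand as_ bs_ r lam th = (fun u => g (shift th (a + b * u)))) in hrho; last first.
  by apply/funext => u; rewrite integrandE.
have lam1 : c1 <= lam th by exact: lamc.
rewrite (_ : g th = lam th); last exact: radial_Theta.
suff H : Ex f (fun u => g (shift th (s + t * u))) <= rho * lam th + c2 * e * Ew.
  apply: (le_trans H).
  have : (1 - rho) * c1 <= (1 - rho) * lam th by rewrite ler_wpM2l// subr_ge0 ltW.
  by move: (lam th) eE => l k1 k2; clear -k1 k2 r0 wf C0 AC BC; lra.
apply: (@le_trans _ _ (Ex f ((fun u => g (shift th (a + b * u))) \+
    (fun u => c2 * e * weight r u)))); last first.
  by rewrite (ExD wf)//; [rewrite (ExZ wf)// lerD2r|exact: dominatedZ].
apply: (Ex_le wf) => //; first by apply: dominatedD => //; exact: dominatedZ.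
move=> u /=; set z := s + t * u; set z' := a + b * u.
(* Dividing by [1 + |u|] brings the unperturbed value into [[-C, C]] and makes the two values
   [d]-close uniformly in [u]; the power [v ^ r] restored afterwards is the weight. *)
pose v := 1 + `|u|.
have v0 : 0 < v by rewrite ltr_wpDr.
have zz : `|z / v - z' / v| <= d.
  rewrite -mulrBl normrM normfV (gtr0_norm v0) ler_pdivrMr//.
  rewrite (_ : z - z' = (s - a) + (t - b) * u); last by rewrite /z /z'; ring.
  rewrite (le_trans (ler_normD _ _))// normrM /v mulrDr mulr1 lerD//.
  by rewrite ler_wpM2r.
have z'C : - C <= z' / v <= C.
  rewrite -ler_norml normrM normfV (gtr0_norm v0) ler_pdivrMr//.
  rewrite (le_trans (ler_normD _ _))// normrM /v mulrDr mulr1 lerD ?AC//.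
  by rewrite ler_wpM2r// BC.
have nv y : `|y / v| `^ r * weight r u = `|y| `^ r.
  rewrite /weight -/v -powRM ?(ltW v0)// normrM normfV (gtr0_norm v0).
  by rewrite divfK// gt_eqF.
have lb y : 0 <= lam y <= c2 by exact: lamb.
rewrite /g !radial_shift1.
have w0 := weight_ge0 r u.
have [zz0|zz0] := ltP 0 (z * z').
  have -> : `|z|^-1 * z = `|z'|^-1 * z'.
    have [z0|z0|z0] := ltrgtP 0 z.
    - have z'0 : 0 < z' by rewrite -(pmulr_rgt0 _ z0).
      by rewrite !gtr0_norm// !mulVf// gt_eqF.
    - have z'0 : z' < 0 by rewrite -(nmulr_rgt0 _ z0).
      by rewrite !ltr0_norm// !invrN !mulNr !mulVf// lt_eqF.
    - by rewrite -z0 mul0r ltxx in zz0.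
  set l := lam _; have /andP[l0 l2] : 0 <= l <= c2 by exact: lb.
  have h : `|z| `^ r <= `|z'| `^ r + e * weight r u.
    rewrite -(nv z) -(nv z') -mulrDl ler_wpM2r//.
    have := Hd (z' / v) (z / v) z'C; rewrite distrC => /(_ zz).
    by rewrite ler_norml => /andP[]; lra.
  rewrite (le_trans (ler_wpM2l l0 h))// mulrDr lerD2l -mulrA ler_wpM2r//.
  by rewrite mulr_ge0// ltW.
(* Without a common strict sign, 0 lies between the two values, so [|z / v|] is at most their
   distance. *)
have zv : `|z / v| <= d.
  rewrite (le_trans _ zz)//.
  have : (z / v) * (z' / v) <= 0.
    by rewrite mulrACA pmulr_lle0// mulr_gt0// invr_gt0.
  move: (z / v) (z' / v) => x y xy.
  have [x0|x0|x0] := ltrgtP 0 x.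
  - have y0 : y <= 0 by rewrite -(pmulr_rle0 _ x0).
    by rewrite (gtr0_norm x0) ger0_norm ?subr_ge0 ?(le_trans y0 (ltW x0))// lerDl oppr_ge0.
  - have y0 : 0 <= y by rewrite -(nmulr_rle0 _ x0).
    rewrite (ltr0_norm x0) ler0_norm ?subr_le0 ?(le_trans (ltW x0) y0)//.
    by rewrite opprB lerDr.
  - by rewrite -x0 normr0.
have hz : `|z| `^ r <= e * weight r u.
  rewrite -(nv z) ler_wpM2r//.
  have := Hd 0 (z / v); rewrite sub0r normrN oppr_le0 C0/= => /(_ isT zv).
  by rewrite normr0 powR0 ?gt_eqF// sub0r normrN ger0_norm// powR_ge0.
have /andP[l0 l2] := lb [tuple `|z|^-1 * z | _ < 1].
have /andP[l0' _] := lb [tuple `|z'|^-1 * z' | _ < 1].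
rewrite (@le_trans _ _ (c2 * e * weight r u))//; last by rewrite lerDr mulr_ge0// powR_ge0.
by rewrite -mulrA; apply: ler_pM => //; rewrite powR_ge0.
Qed.

End drift_one.

(** * The transition operator *)

Lemma powR_1D_le (R : realType) (r t : R) : 0 <= r -> 0 <= t ->
  (1 + t) `^ r <= 2 `^ r * (1 + t `^ r).
Proof.
move=> r0 t0; have p2 : 0 <= 2 `^ r :> R by exact: powR_ge0.
have [t1|t1] := leP t 1.
  rewrite (@le_trans _ _ (2 `^ r))//; last by rewrite ler_peMr// lerDl powR_ge0.
  by apply: ge0_ler_powR; rewrite ?nnegrE ?addr_ge0//; lra.
rewrite (@le_trans _ _ (2 `^ r * t `^ r))//; last by rewrite ler_wpM2l// lerDr.
rewrite -powRM//; apply: ge0_ler_powR; rewrite ?nnegrE ?addr_ge0 ?mulr_ge0//; lra.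
Qed.

(** Needed for a density with bounded support: the comparison of iterates is available only for the
    innovations that keep the chain in a ball. *)
Lemma Ex_le_supp (R : realType) (r : R) (f k l : R -> R) : weightable r f ->
  dominated r k -> dominated r l -> (forall u, f u != 0 -> k u <= l u) ->
  Ex f k <= Ex f l.
Proof.
move=> wf dk dl kl; apply: le_Rintegral => //; [exact: (dominated_integrable wf dk)|exact: (dominated_integrable wf dl)|].
move=> u _; have [->|fu] := eqVneq (f u) 0; first by rewrite !mulr0.
by rewrite ler_wpM2r ?kl//; case: wf.
Qed.

Section transition_operator.
Context {R : realType} {p : nat}.
Local Notation vec := (p.-tuple R).
Variables (r : R) (g : vec -> R) (c1 c3 : R).
Hypotheses (r0 : 0 < r) (mg : measurable_fun setT g) (c10 : 0 < c1) (c30 : 0 <= c3)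
  (gb : forall x, c1 * (enorm x) `^ r <= g x <= c3 * (enorm x) `^ r).
Local Notation V := (fun x => 1 + g x).

Definition Top (a b : vec -> R) (f : R -> R) (h : vec -> R) (x : vec) : R :=
  Ex f (fun u => h (step a b x u)).

Lemma Vdrift_g0 x : 0 <= g x.
Proof.
have /andP[h _] := gb x; apply: le_trans h; rewrite mulr_ge0 ?powR_ge0//.
exact: ltW.
Qed.

Lemma Vdrift_ge1 x : 1 <= V x. Proof. by rewrite lerDl Vdrift_g0. Qed.

Lemma measurable_Vdrift : measurable_fun setT V. Proof. exact: measurable_funD. Qed.

Section one_operator.
Variables (a b : vec -> R) (f : R -> R) (K0 : R).
Hypotheses (ma : measurable_fun setT a) (mb : measurable_fun setT b)
  (wf : weightable r f) (K00 : 0 <= K0).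
Hypothesis ab : forall x, `|a x| + `|b x| + enorm x <= K0 * (1 + enorm x).

Lemma measurable_step : measurable_fun setT (fun xu : vec * R => step a b xu.1 xu.2).
Proof.
apply: measurable_shift.
  apply: measurable_funD; first exact: (measurableT_comp ma measurable_fst).
  apply: measurable_funM; last exact: measurable_snd.
  exact: (measurableT_comp mb measurable_fst).
exact: measurable_fst.
Qed.

Lemma g_step_le x u : g (step a b x u) <= c3 * K0 `^ r * (1 + enorm x) `^ r * weight r u.
Proof.
have /andP[_ h] := gb (step a b x u); apply: (le_trans h).
rewrite -!mulrA ler_wpM2l// mulrA -powRM ?addr_ge0 ?enorm_ge0//.
exact: powR_enorm_shift_affine.
Qed.

Lemma dominated_step (h : vec -> R) x : Vbounded V h ->
  dominated r (fun u => h (step a b x u)).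
Proof.
move=> [mh [c hc]].
have ms : measurable_fun setT (fun u => step a b x u).
  by have := measurableT_comp measurable_step (measurable_pair1 x).
have dV : dominated r (fun u => `|c| * ((fun=> 1) \+ (fun u => g (step a b x u))) u).
  apply: dominatedZ; apply: dominatedD; first exact: (dominated_cst (ltW r0)).
  apply: (dominated_shift (D := c3) r0) => // y.
  by have /andP[_ ->] := gb y; rewrite Vdrift_g0.
apply: dominated_le dV _; first exact: (measurableT_comp mh ms).
move=> u; rewrite (le_trans (hc _))//= ler_wpM2r ?ler_norm//.
by rewrite (le_trans ler01)// Vdrift_ge1.
Qed.

Let KV := Ex f (weight r) * (1 + c3 * K0 `^ r * 2 `^ r * (1 + c1^-1)).

(** A crude bound from linear growth of the coefficients. It makes the operator preserve the class
    of [V]-bounded functions, and later controls the drift inside a ball. *)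
Lemma Top_V_le x : Top a b f V x <= KV * V x.
Proof.
have w1 := dominated_weight r.
have bV := VboundedV measurable_Vdrift Vdrift_ge1.
pose D := 1 + c3 * K0 `^ r * (1 + enorm x) `^ r.
have D0 : 0 <= c3 * K0 `^ r by rewrite mulr_ge0// powR_ge0.
apply: (@le_trans _ _ (Ex f (fun u => D * weight r u))).
  apply: (Ex_le wf); [exact: (dominated_step x bV)|exact: dominatedZ|].
  move=> u; rewrite /D mulrDl mul1r lerD ?g_step_le//.
  exact: weight_ge1 (ltW r0) u.
rewrite (ExZ wf)// mulrC /KV -mulrA ler_wpM2l//.
  by apply: (Ex_ge0 wf) => u; exact: weight_ge0.
rewrite mulrDl mul1r lerD ?Vdrift_ge1//.
rewrite [leRHS](_ : _ = c3 * K0 `^ r * (2 `^ r * ((1 + c1^-1) * (1 + g x)))); last by ring.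
rewrite ler_wpM2l//.
rewrite (le_trans (powR_1D_le (ltW r0) (enorm_ge0 x)))// ler_wpM2l ?powR_ge0//.
rewrite mulrDl mul1r lerD ?Vdrift_ge1//.
rewrite mulrC ler_pdivlMr// mulrC.
by have /andP[h _] := gb x; rewrite (le_trans h)// lerDr.
Qed.

Lemma Vop_Top : Vop V (Top a b f).
Proof.
split.
- move=> h bh; have [mh [c hc]] := bh; split.
    apply: measurable_Ex; last by case: wf.
    exact: (measurableT_comp mh measurable_step).
  exists (`|c| * KV) => x.
  have bV := VboundedV measurable_Vdrift Vdrift_ge1.
  have dV := dominated_step x bV; have dh := dominated_step x bh.
  have hle y : `|h y| <= `|c| * V y.
    by rewrite (le_trans (hc y))// ler_wpM2r ?ler_norm// (le_trans ler01)// Vdrift_ge1.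
  rewrite -mulrA (le_trans _ (ler_wpM2l (normr_ge0 c) (Top_V_le x)))//.
  rewrite /Top -(ExZ wf)// ler_norml; apply/andP; split.
    rewrite -mulN1r -(ExZ wf); last exact: dominatedZ.
    apply: (Ex_le wf) => //; first by do 2 apply: dominatedZ.
    by move=> u; rewrite mulN1r; have := hle (step a b x u); rewrite ler_norml => /andP[].
  apply: (Ex_le wf) => //; first exact: dominatedZ.
  by move=> u; rewrite (le_trans (ler_norm _)).
- by move=> h k x bh bk; rewrite /Top -(ExD wf)//; exact: dominated_step.
- by move=> c h x bh; rewrite /Top -(ExZ wf)//; exact: dominated_step.
- move=> h k x bh bk hk; apply: (Ex_le wf); [exact: dominated_step..|].
  by move=> u; exact: hk.
- move=> k l x mk bl kl k0.
  have ms : measurable_fun setT (fun u => step a b x u).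
    by have := measurableT_comp measurable_step (measurable_pair1 x).
  apply: (Ex_cvg0 wf _ (dominated_step x bl)).
  + by move=> n; exact: (measurableT_comp (mk n) ms).
  + by move=> n u; exact: kl.
  + by move=> u; exact: k0.
Qed.

Lemma Pn_Top n (h : vec -> R) x : Vbounded V h ->
  Pn a b f n (fun y => (h y)%:E) x = (iter n (Top a b f) h x)%:E.
Proof.
move=> bh; elim: n x => // n IH x.
have bn := Vop_stable (Vop_iter n Vop_Top) bh.
rewrite iterS /Top -(Ex_EFin wf); last exact: dominated_step.
change (Pn a b f n.+1 (fun y => (h y)%:E) x) with (\int[lebesgue_measure]_u
  (Pn a b f n (fun y => (h y)%:E) (step a b x u) * (f u)%:E))%E.
by apply: eq_integral => u _; rewrite IH -EFinM.
Qed.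

Lemma Top_ge0 (h : vec -> R) x : (forall y, 0 <= h y) -> 0 <= Top a b f h x.
Proof. by move=> h0; apply: (Ex_ge0 wf). Qed.

Lemma iter_Top_ge0 n (h : vec -> R) x : (forall y, 0 <= h y) -> 0 <= iter n (Top a b f) h x.
Proof. by move=> h0; elim: n x => //= n IH x; exact: Top_ge0. Qed.

End one_operator.
End transition_operator.

(** * Minorization on sublevel sets *)

Section minorization.
Context {R : realType} {p : nat}.
Local Notation vec := (p.-tuple R).
Local Notation mu := (@lebesgue_measure R).
Variables (r : R) (g : vec -> R) (c1 c3 : R).
Hypotheses (r0 : 0 < r) (mg : measurable_fun setT g) (c10 : 0 < c1) (c30 : 0 <= c3)
  (gb : forall x, c1 * (enorm x) `^ r <= g x <= c3 * (enorm x) `^ r).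
Local Notation V := (fun x => 1 + g x).
Variables (a b : vec -> R) (f : R -> R) (K0 : R).
Hypotheses (ma : measurable_fun setT a) (mb : measurable_fun setT b)
  (wf : weightable r f) (K00 : 0 <= K0).
Hypothesis ab : forall x, `|a x| + `|b x| + enorm x <= K0 * (1 + enorm x).
Hypothesis b0 : forall x, 0 < b x.
Hypothesis b_away : loc_bdd_away0 setT b.
Hypothesis f_away : forall u0 : R, exists2 eps : R, 0 < eps & exists2 c : R, 0 < c &
     forall u, `|u - u0| < eps -> c <= f u.
Local Notation P := (Top a b f).

Let mcst (k : R) : measurable_fun setT (fun _ : vec => k).
Proof. exact: measurable_cst. Qed.

(** The density of a comparison chain, not normalized. With coefficients 0 and 1 the entering
    coordinate is the innovation itself, independent of the state. *)
Definition box (c u : R) : R := c * \1_(`[-1, 1]%classic : set R) u.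

Lemma weightable_box c : 0 <= c -> weightable r (box c).
Proof.
move=> c0.
have mI : measurable_fun setT (\1_(`[-1, 1]%classic : set R) : R -> R).
  by apply: measurable_indic; exact: measurable_itv.
split.
- exact: measurable_funM.
- by move=> u; rewrite mulr_ge0// indicE ler0n.
- have iI := @integrable_indic_itv R (-1) 1 true false.
  apply: (le_integrable measurableT _ _ (integrableZl measurableT (2 `^ r * c) iI)).
    apply/measurable_EFinP; apply: measurable_funM; first exact: measurable_weight.
    exact: measurable_funM.
  move=> u _ /=; rewrite lee_fin /box.
  rewrite indicE; case: (boolP (u \in _)) => [|_]; last by rewrite !mulr0.
  rewrite inE/= in_itv/= -ler_norml => u1.
  rewrite !mulr1 !ger0_norm ?mulr_ge0 ?powR_ge0 ?weight_ge0// ler_wpM2r//.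
  apply: ge0_ler_powR; rewrite ?nnegrE ?addr_ge0 ?(ltW r0)//.
  by rewrite (_ : 2 = 1 + 1)// lerD2l.
Qed.

Lemma box_neq0 c u : box c u != 0 -> `|u| <= 1.
Proof.
rewrite /box indicE; case: (boolP (u \in _)) => [|_]; last by rewrite mulr0 eqxx.
by rewrite inE/= in_itv/= -ler_norml.
Qed.

Local Notation Q c := (Top (fun=> 0) (fun=> 1) (box c)).

Lemma Q_growth (x : vec) : `|0 : R| + `|1 : R| + enorm x <= 1 * (1 + enorm x).
Proof. by rewrite normr0 normr1 add0r mul1r. Qed.

Lemma Vop_Q c : 0 <= c -> Vop V (Q c).
Proof.
move=> c0; apply: (Vop_Top r0 mg c10 c30 gb (K0 := 1)) => //; last exact: Q_growth.
exact: weightable_box.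
Qed.

(** The expression is the density at [v] of the entering coordinate. On a ball [a] and [b] are
    bounded and [b] is bounded below, so the arguments of [f] stay in one segment. *)
Lemma density_lower_bound Rb : exists2 c : R, 0 < c &
  forall x v, enorm x <= Rb -> `|v| <= 1 -> c <= f ((v - a x) / b x) / b x.
Proof.
have [h|Rb0] := ltP Rb 0.
  exists 1 => // x v xR; have := le_lt_trans xR h.
  by rewrite ltNge enorm_ge0.
have [bl bl0 Hbl] : exists2 c, 0 < c & forall x : vec, enorm x <= Rb -> c <= b x.
  apply: (compact_lower_bound (D := setT) (B := Rb)) => //.
  apply: (closed_comp (f := fun v => enorm (vec_of_row v)) (D := [set y | y <= Rb])).
    by move=> v _; exact: continuous_enorm_row.
  exact: closed_le.
pose KR := K0 * (1 + Rb).
have KR0 : 0 <= KR by rewrite mulr_ge0// addr_ge0.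
have hab (x : vec) : enorm x <= Rb -> `|a x| <= KR /\ b x <= KR.
  move=> xR; have := ab x.
  have : K0 * (1 + enorm x) <= KR by rewrite ler_wpM2l// lerD2l.
  have := enorm_ge0 x; have := normr_ge0 (a x); have := normr_ge0 (b x).
  have := ler_norm (b x).
  by move=> h1 h2 h3 h4 h5 h6; split; lra.
have [cf cf0 Hcf] := segment_lower_bound ((1 + KR) / bl) f_away.
have KR1 : 0 < KR + 1 by rewrite ltr_wpDl.
exists (cf / (KR + 1)); first by rewrite divr_gt0.
move=> x v xR v1; have [ax bx] := hab x xR.
have bx0 := b0 x.
apply: ler_pM; rewrite ?invr_ge0 ?(ltW cf0) ?(ltW KR1)//.
  apply: Hcf; rewrite normrM normfV (gtr0_norm bx0) ler_pdivrMr//.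
  rewrite (@le_trans _ _ (1 + KR))//.
    by rewrite (le_trans (ler_normB _ _))// lerD.
  by rewrite mulrAC ler_pdivlMr// ler_wpM2l ?Hbl// addr_ge0.
by rewrite lef_pV2 ?posrE// (le_trans bx)// lerDl.
Qed.

Lemma Q_le_Top (c Rb : R) (h : vec -> R) (x : vec) : 0 < c ->
  (forall x v, enorm x <= Rb -> `|v| <= 1 -> c <= f ((v - a x) / b x) / b x) ->
  Vbounded V h -> (forall y, 0 <= h y) -> enorm x <= Rb -> Q c h x <= P h x.
Proof.
move=> c0 Hc bh h0 xR.
have bx0 := b0 x; have [mf f0 _] := wf; have [mh _] := bh.
have dP := dominated_step r0 mg c10 gb ma mb x bh.
have dQ := dominated_step r0 mg c10 gb (mcst 0) (mcst 1) x bh.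
have wb := weightable_box (ltW c0).
have mk : measurable_fun setT (fun u => h (step a b x u) * f u).
  by apply: measurable_funM => //; case: dP.
rewrite -lee_fin /Top -(Ex_EFin wf dP) -(Ex_EFin wb dQ).
have bi0 : 0 < (b x)^-1 by rewrite invr_gt0.
rewrite [leRHS](integral_affine (- a x / b x) bi0 mk); last first.
  by move=> u; rewrite mulr_ge0.
apply: le_integral_real.
- by apply: measurable_funM; [case: dQ|case: wb].
- apply: measurable_funM => //; apply: (measurableT_comp mk).
  by apply: measurable_funD => //; apply: measurable_funM.
move=> v; rewrite mulr_ge0//=; last by case: wb.
have -> : step a b x (- a x / b x + (b x)^-1 * v) = shift x v.
  by rewrite /step; congr shift; field; rewrite gt_eqF.
have -> : step (fun=> 0) (fun=> 1) x v = shift x v.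
  by rewrite /step; congr shift; ring.
have -> : - a x / b x + (b x)^-1 * v = (v - a x) / b x by ring.
rewrite -mulrA ler_wpM2l// /box indicE.
case: (boolP (v \in _)) => [|_]; last by rewrite mulr0 mulr_ge0// ltW.
by rewrite inE/= in_itv/= -ler_norml mulr1 => v1; exact: Hc xR v1.
Qed.

(** A comparison step enlarges the norm by at most 1, since its innovation lies in [[-1, 1]]. The
    [n] steps still to be made are reserved in [enorm x + n%:R <= Rb], so the density bound applies
    at each of them. *)
Lemma iter_Q_le_Top (c Rb : R) (h : vec -> R) : 0 < c ->
  (forall x v, enorm x <= Rb -> `|v| <= 1 -> c <= f ((v - a x) / b x) / b x) ->
  Vbounded V h -> (forall y, 0 <= h y) -> forall n x, enorm x + n%:R <= Rb ->
  iter n (Q c) h x <= iter n P h x.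
Proof.
move=> c0 Hc bh h0; elim=> [//|n IH] x xR.
have oP := Vop_Top r0 mg c10 c30 gb ma mb wf K00 ab.
have oQ := Vop_Q (ltW c0).
have bP := Vop_stable (Vop_iter n oP) bh.
have bQ := Vop_stable (Vop_iter n oQ) bh.
rewrite !iterS (@le_trans _ _ (Q c (iter n P h) x))//.
  apply: (Ex_le_supp (weightable_box (ltW c0))).
  - exact: (dominated_step r0 mg c10 gb (mcst 0) (mcst 1) x bQ).
  - exact: (dominated_step r0 mg c10 gb (mcst 0) (mcst 1) x bP).
  - move=> u /box_neq0 u1; apply: IH.
    rewrite (le_trans _ xR)// -natr1 addrA addrAC lerD2r.
    have -> : step (fun=> 0) (fun=> 1) x u = shift x u.
      by rewrite /step; congr shift; ring.
    by rewrite (le_trans (enorm_shift_le _ _))// [leLHS]addrC lerD2l.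
apply: (@Q_le_Top c Rb) => //; first by move=> y; exact: (iter_Top_ge0 a b wf).
by rewrite (le_trans _ xR)// lerDl.
Qed.

(** A coordinate [i] survives [n] shifts only if [i + n < p], and the innovations of the comparison
    chain do not look at the state. For [n = p] the condition is void and the starting point is
    forgotten. *)
Lemma iter_Q_agree (c : R) (h : vec -> R) n (x y : vec) :
  (forall i, (i + n < p)%N -> nth 0 x i = nth 0 y i) ->
  iter n (Q c) h x = iter n (Q c) h y.
Proof.
elim: n x y => [|n IH] x y xy.
  by congr h; apply: eq_from_tnth => i; rewrite !(tnth_nth 0) xy// addn0.
rewrite !iterS /Top /Ex; apply: eq_Rintegral => u _; congr (_ * _); apply: IH => i ip.
have ip' : (i < p)%N by apply: leq_ltn_trans ip; exact: leq_addr.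
rewrite /step -!(tnth_nth 0 _ (Ordinal ip')) !tnth_mktuple/=.
case: i ip ip' => //= i ip _; apply: xy.
by rewrite addnS -addSn.
Qed.

(** The functional is the [p]-step comparison operator evaluated at the zero vector, of total mass
    [(2 * c) ^+ p]. *)
Lemma Top_minorization R0 : exists nu : (vec -> R) -> R,
  [/\ forall h k, Vbounded V h -> Vbounded V k -> nu (h \+ k) = nu h + nu k,
      forall c h, Vbounded V h -> nu (fun y => c * h y) = c * nu h,
      forall h, Vbounded V h -> (forall y, 0 <= h y) -> 0 <= nu h,
      0 < nu (fun=> 1) &
      forall h x, Vbounded V h -> (forall y, 0 <= h y) -> V x <= R0 ->
        nu h <= iter p P h x].
Proof.
(* By [c1 * |x| ^ r <= g x], the sublevel set of [V] lies in the ball of this radius; [p] is added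
   below for the growth over [p] steps. *)
pose r1 := (`|R0| / c1) `^ r^-1.
have VR (x : vec) : V x <= R0 -> enorm x <= r1.
  move=> Vx.
  have h : (enorm x) `^ r <= `|R0| / c1.
    rewrite ler_pdivlMr// mulrC; have /andP[h1 _] := gb x.
    by have := ler_norm R0; lra.
  rewrite -[leLHS]powRr1 ?enorm_ge0// -(@divff _ r) ?gt_eqF// powRrM.
  apply: ge0_ler_powR; rewrite ?nnegrE ?invr_ge0 ?powR_ge0 ?(ltW r0)//.
  by rewrite divr_ge0// ltW.
have [c c0 Hc] := density_lower_bound (r1 + p%:R).
have oQ := Vop_Q (ltW c0); have oQp := Vop_iter p oQ.
pose x0 : vec := [tuple 0 | i < p].
exists (fun h => iter p (Q c) h x0); split.
- by move=> h k bh bk; rewrite (VopD oQp).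
- by move=> k h bh; rewrite (VopZ oQp).
- by move=> h bh h0; exact: (iter_Top_ge0 _ _ (weightable_box (ltW c0))).
- have bV1 k : Vbounded V (fun=> k).
    exact: (Vbounded_cst (Vdrift_ge1 c10 gb)).
  have mI : measurable (`[-1, 1]%classic : set R) by exact: measurable_itv.
  have E1 : Ex (box c) (fun=> 1) = 2 * c.
    have wb := weightable_box (ltW c0).
    have := Ex_EFin wb (dominated_cst (ltW r0) 1).
    rewrite (_ : (\int[mu]_u _)%E = (2 * c)%:E); first by move=> [].
    under eq_integral do rewrite mul1r.
    rewrite integral_realZ//; last exact: ltW.
    rewrite integral_indic// setIT.
    have E := lebesgue_measure_itv (`[-1, 1] : interval R); rewrite /= in E.
    rewrite [X in (_ * X)%E]E lte_fin ifT; last by lra.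
    by rewrite -EFinD -EFinM; congr EFin; lra.
  have QE n x : iter n (Q c) (fun=> 1) x = (2 * c) ^+ n.
    elim: n x => [//|n IH] x; rewrite iterS (_ : iter n _ _ = fun=> (2 * c) ^+ n).
      rewrite /Top (_ : (fun u : R => (2 * c) ^+ n) = (fun u => (2 * c) ^+ n * (fun=> 1) u)).
        rewrite (ExZ (weightable_box (ltW c0))) ?E1 ?exprSr//.
        exact: (dominated_cst (ltW r0)).
      by apply/funext => u; rewrite mulr1.
    exact/funext.
  by rewrite QE exprn_gt0// mulr_gt0.
- move=> h x bh h0 Vx.
  rewrite (@iter_Q_agree c h p x0 x); last by move=> i; rewrite ltnNge leq_addl.
  by apply: iter_Q_le_Top Hc _ _ _ _ _ => //; rewrite lerD2r VR.
Qed.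

End minorization.

(** * Behaviour at infinity and the theorem *)

Lemma weightable_density (R : realType) (r : R) (f : R -> R) : 0 < r ->
  measurable_fun setT f -> (forall u, 0 <= f u) ->
  (\int[lebesgue_measure]_u (f u)%:E = 1)%E ->
  (\int[lebesgue_measure]_u (powR `|u| r * f u)%:E < +oo)%E ->
  weightable r f /\ Ex f (fun=> 1) = 1.
Proof.
move=> r0 mf f0 f1 fr.
have mp : measurable_fun setT (fun u : R => `|u| `^ r * f u).
  apply: measurable_funM => //.
  by apply: (measurableT_comp (measurable_powR r)).
have If : lebesgue_measure.-integrable setT (EFin \o f).
  apply/integrableP; split; first exact/measurable_EFinP.
  under eq_integral do rewrite /= ger0_norm//.
  by rewrite f1 ltry.
have Ifr : lebesgue_measure.-integrable setT (EFin \o (fun u : R => `|u| `^ r * f u)).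
  apply/integrableP; split; first exact/measurable_EFinP.
  by under eq_integral do rewrite /= ger0_norm ?mulr_ge0 ?powR_ge0//.
split.
  split=> //.
  apply: (le_integrable measurableT _ _
    (integrableZl measurableT (2 `^ r) (integrableD measurableT If Ifr))).
    apply/measurable_EFinP; apply: measurable_funM => //; exact: measurable_weight.
  move=> u _ /=; rewrite lee_fin.
  have w0 := weight_ge0 r u.
  rewrite ger0_norm ?mulr_ge0// ger0_norm; last first.
    by rewrite mulr_ge0 ?powR_ge0// addr_ge0// mulr_ge0// powR_ge0.
  rewrite -[X in _ * (X + _)]mul1r -mulrDl mulrA ler_wpM2r//.
  by apply: powR_1D_le => //; exact: ltW.
rewrite /Ex /Rintegral (_ : (\int[_]_x _)%E = 1%E)//.
by under eq_integral do rewrite mul1r.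
Qed.

Section limits_at_infinity.
Context {R : realType} {p : nat}.
Local Notation vec := (p.-tuple R).

Lemma star_Theta (a_ : vec -> R) th : Theta th -> star a_ th = a_ th.
Proof. by move=> Th; rewrite /star Th oner_eq0 invr1 tscale1 mulr1. Qed.

(** The limit coefficient inherits measurability from [a], as a pointwise limit along the scales
    [n.+1]. *)
Lemma measurable_star (a as_ : vec -> R) : measurable_fun setT a ->
  (forall eps : R, 0 < eps -> exists W : R, forall w : R, W < w ->
     forall th, Theta th -> `|a (tscale w th) / w - as_ th| <= eps) ->
  measurable_fun setT (star as_).
Proof.
move=> ma lim_a.
have mth : measurable_fun setT (fun x : vec => tscale (enorm x)^-1 x).
  apply: measurable_tscale => //.
  rewrite (_ : (fun _ => _) = (fun x : vec => (enorm x) `^ (-1))).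
    exact: (measurableT_comp (measurable_powR (-1)) measurable_enorm).
  by apply/funext => x; rewrite powR_inv1// enorm_ge0.
pose h n (x : vec) := a (tscale n.+1%:R (tscale (enorm x)^-1 x)) / n.+1%:R * enorm x.
apply: (@measurable_fun_cvg _ _ _ _ h).
- move=> n; apply: measurable_funM; last exact: measurable_enorm.
  apply: measurable_funM => //; apply: (measurableT_comp ma).
  exact: measurable_tscale.
- move=> x _; rewrite /star; case: eqP => [x0|/eqP x0].
    by rewrite /h x0; under eq_fun do rewrite mulr0; exact: cvg_cst.
  apply: cvgM; last exact: cvg_cst.
  apply/cvgrPdist_le => e e0; have [W HW] := lim_a e e0.
  exists (Num.Def.archi_bound `|W|) => // n /= hn; rewrite distrC; apply: HW.
    rewrite (le_lt_trans (ler_norm _))// (lt_le_trans (archi_boundP _))//.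
    by rewrite ler_nat ltnW.
  exact: Theta_normalize.
Qed.

Lemma closed_Theta : closed [set v | Theta (@vec_of_row R p v)].
Proof.
apply: (closed_comp (f := fun v => enorm (vec_of_row v)) (D := [set 1])).
  by move=> v _; exact: continuous_enorm_row.
exact: closed_eq.
Qed.

Lemma max_away0 (A B : vec -> R) :
  loc_bdd_away0 [set x | x != [tuple (0 : R) | _ < p]] (fun x => Num.max `|A x| (B x)) ->
  exists2 c : R, 0 < c & forall th, Theta th -> c <= Num.max `|A th| (B th).
Proof.
move=> H; apply: (compact_lower_bound (B := 1) H).
- move=> x Tx /=; apply/eqP => x0.
  have : enorm x = 0.
    by rewrite /enorm big1 ?sqrtr0// => i _; rewrite x0 tnth_mktuple expr0n.
  by rewrite Tx => /eqP; rewrite oner_eq0.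
- exact: closed_Theta.
- by move=> x ->.
Qed.

(** The part of the sphere with every coordinate above its threshold is compact and avoids [H0]. *)
Lemma away0_off_H0 (B : vec -> R) (dl : nat -> R) :
  loc_bdd_away0 (~` H0) B -> (forall i, 0 < dl i) ->
  exists2 eta : R, 0 < eta & forall th : vec, Theta th ->
    (forall i : 'I_p, dl i <= `|tnth th i|) -> eta <= B th.
Proof.
move=> HB dl0.
pose K := [set th : vec | Theta th /\ forall i : 'I_p, dl i <= `|tnth th i|].
have [eta eta0 Heta] : exists2 c : R, 0 < c & forall x, K x -> c <= B x.
  apply: (compact_lower_bound (B := 1) HB).
  - move=> x [_ Kx] [i xi]; have := Kx i; rewrite xi normr0 leNgt.
    by rewrite dl0.
  - rewrite (_ : [set v | _] = [set v | Theta (vec_of_row v)] `&`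
        \bigcap_(i in [set: 'I_p]) [set v | dl i <= `|tnth (@vec_of_row R p v) i|]).
      apply: closedI; first exact: closed_Theta.
      apply: closed_bigI => i _.
      apply: (closed_comp (f := fun v : 'rV[R]_p => `|tnth (vec_of_row v) i|)
        (D := [set y | dl i <= y])); last exact: closed_ge.
      move=> v _; rewrite (_ : (fun _ => _) = (fun v : 'rV[R]_p => `|v ord0 i|)).
        apply: (@continuous_comp _ _ _ (fun v : 'rV[R]_p => v ord0 i) (@Num.norm R R)).
          exact: coord_continuous.
        exact: norm_continuous.
      by apply/funext => w; rewrite tnth_mktuple.
    apply/seteqP; split=> v /=; first by move=> [h1 h2]; split=> // i _; exact: h2.
    by move=> [h1 h2]; split=> // i; exact: h2.
  - by move=> x [-> _].
by exists eta => // th Th h; apply: Heta.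
Qed.

End limits_at_infinity.

Section ergodicity.
Context {R : realType} {p : nat}.
Local Notation vec := (p.-tuple R).
Variables (a b : vec -> R) (f : R -> R) (as_ bs_ : vec -> R) (r : R).
Hypotheses (r0 : 0 < r) (p0 : (0 < p)%N).
Hypotheses (ma : measurable_fun setT a) (mb : measurable_fun setT b).
Hypotheses (wf : weightable r f) (f1 : Ex f (fun=> 1) = 1).
Hypothesis f_away : forall u0 : R, exists2 eps : R, 0 < eps & exists2 c : R, 0 < c &
     forall u, `|u - u0| < eps -> c <= f u.
Hypotheses (b0 : forall x, 0 < b x) (b_away : loc_bdd_away0 setT b).
Hypotheses (a_growth : exists C : R, forall x, `|a x / (1 + enorm x)| <= C)
  (b_growth : exists C : R, forall x, `|b x / (1 + enorm x)| <= C).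
Hypotheses
  (lim_a : forall eps : R, 0 < eps -> exists W : R, forall w : R, W < w ->
     forall th, Theta th -> `|a (tscale w th) / w - as_ th| <= eps)
  (lim_b : forall eps : R, 0 < eps -> exists W : R, forall w : R, W < w ->
     forall th, Theta th -> `|b (tscale w th) / w - bs_ th| <= eps).

(** Outside a ball the perturbed drift applies after dividing by [|x|]; inside it [Top_V_le] is
    enough. The [r]th moment is finite because [|x| ^ r] is bounded by a multiple of [V], and such
    functions are integrable for the stationary law. *)
Lemma ergodic_of_perturbed_drift : perturbed_drift as_ bs_ f r ->
  exists V : vec -> R, measurable_fun setT V /\
    (exists K L M : R, 0 < K /\
       forall x, K * powR (enorm x) r <= V x <= L + M * powR (enorm x) r) /\
    exists G : probability vec R,
      V_unif_ergodic_with a b f V G /\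
      (\int[G]_x (powR (enorm x) r)%:E < +oo)%E.
Proof.
move=> [g [rho [d [c1 [c3' [[mg /andP[rho0 rho1] d0 c10] [ghom gb' gdrift]]]]]]].
pose c3 := `|c3'|; have c30 : 0 <= c3 by exact: normr_ge0.
have gb x : c1 * (enorm x) `^ r <= g x <= c3 * (enorm x) `^ r.
  have /andP[-> h] := gb' x; rewrite (le_trans h)// /c3 ler_wpM2r ?powR_ge0//.
  exact: ler_norm.
have [Ca HCa] := a_growth; have [Cb HCb] := b_growth.
pose K0 := `|Ca| + `|Cb| + 1.
have K00 : 0 <= K0 by rewrite !addr_ge0.
have growth (k : vec -> R) (D : R) (y : vec) : `|k y / (1 + enorm y)| <= D -> `|k y| <= `|D| * (1 + enorm y).
  have e1 : 0 < 1 + enorm y by rewrite ltr_wpDr// enorm_ge0.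
  rewrite normrM normfV (gtr0_norm e1) ler_pdivrMr// => /le_trans; apply.
  by rewrite ler_wpM2r ?(ltW e1)// ler_norm.
have ab x : `|a x| + `|b x| + enorm x <= K0 * (1 + enorm x).
  have := growth a Ca x (HCa x); have := growth b Cb x (HCb x).
  by rewrite /K0 !mulrDl mul1r => h1 h2; rewrite lerD ?lerD// lerDr.
pose V := fun x => 1 + g x.
have mV : measurable_fun setT V by exact: measurable_Vdrift.
have V1 := Vdrift_ge1 c10 gb.
have g0 := Vdrift_g0 c10 gb.
pose P := Top a b f.
have oP : Vop V P by exact: (Vop_Top r0 mg c10 c30 gb ma mb wf K00 ab).
have P1 x : P (fun=> 1) x = 1 by [].
pose KV := Ex f (weight r) * (1 + c3 * K0 `^ r * 2 `^ r * (1 + c1^-1)).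
have PV x : P V x <= KV * V x by exact: (Top_V_le r0 mg c10 c30 gb ma mb wf K00 ab).
have [Wa HWa] := lim_a d0; have [Wb HWb] := lim_b d0.
pose W := `|Wa| + `|Wb|.
have W0 : 0 <= W by rewrite addr_ge0.
have bgV : Vbounded V V by exact: VboundedV.
have bg : Vbounded V g.
  apply: (Vbounded_le mg bgV) => x.
  by rewrite ger0_norm// lerDr.
have b1 : Vbounded V (fun=> 1) by exact: Vbounded_cst.
have far x : W < enorm x -> P g x <= rho * g x.
  move=> Wx; have x0 : 0 < enorm x by exact: le_lt_trans Wx.
  pose th := tscale (enorm x)^-1 x.
  have Th : Theta th by apply: Theta_normalize; exact: lt0r_neq0.
  have xE : x = tscale (enorm x) th by rewrite tscale_normalize// lt0r_neq0.
  have hg : g x = (enorm x) `^ r * g th by rewrite {1}xE ghom.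
  (* A step from [x] is [|x|] times a step from the direction [th] with coefficients [a x / |x|] and
     [b x / |x|]; homogeneity of [g] then takes [|x| ^ r] out of the expectation. *)
  have step_E u : step a b x u =
      tscale (enorm x) (shift th (a x / enorm x + b x / enorm x * u)).
    rewrite tscale_shift -xE /step; congr shift; field.
    exact: lt0r_neq0.
  rewrite /P /Top.
  rewrite (_ : (fun u => _) = (fun u => (enorm x) `^ r *
      g (shift th (a x / enorm x + b x / enorm x * u)))); last first.
    by apply/funext => u; rewrite step_E ghom.
  rewrite (ExZ wf); last first.
    apply: (dominated_shift (D := c3) r0) => // y.
    by have /andP[_ ->] := gb y; rewrite g0.
  rewrite hg mulrCA ler_wpM2l ?powR_ge0//; apply: gdrift => //.
  - by rewrite divr_ge0 ?enorm_ge0// ltW.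
  - rewrite star_Theta// {1}xE; apply: HWa => //.
    by rewrite (le_lt_trans (ler_norm _))// (le_lt_trans _ Wx)// lerDl.
  - rewrite star_Theta// {1}xE; apply: HWb => //.
    by rewrite (le_lt_trans (ler_norm _))// (le_lt_trans _ Wx)// lerDr.
have KV0 : 0 <= KV.
  rewrite mulr_ge0 ?(Ex_ge0 wf)//; first by move=> u; exact: weight_ge0.
  by rewrite addr_ge0 ?mulr_ge0 ?powR_ge0 ?addr_ge0 ?invr_ge0// ltW.
(* The second summand bounds [P V] on the ball of radius [W]; the 1 is the constant part of [V],
   which the drift of [g] does not contract. *)
pose K := 1 + KV * (1 + c3 * W `^ r).
have K10 : 0 <= K.
  by rewrite addr_ge0// mulr_ge0// addr_ge0// mulr_ge0// powR_ge0.
have drift x : P V x <= rho * V x + K.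
  have [xW|Wx] := leP (enorm x) W.
    rewrite (le_trans (PV x))// (@le_trans _ _ K)//; last first.
      by rewrite lerDr mulr_ge0// (le_trans ler01 (V1 x)).
    rewrite (@le_trans _ _ (KV * (1 + c3 * W `^ r)))//; last by rewrite lerDr.
    rewrite ler_wpM2l// lerD2l; have /andP[_ h] := gb x.
    rewrite (le_trans h)// ler_wpM2l//.
    by apply: ge0_ler_powR; rewrite ?nnegrE ?enorm_ge0 ?(ltW r0).
  have -> : P V x = 1 + P g x by have := VopD oP x b1 bg; rewrite P1.
  have := far x Wx; rewrite /V /K => h.
  have : 0 <= KV * (1 + c3 * W `^ r).
    by rewrite mulr_ge0// addr_ge0// mulr_ge0// powR_ge0.
  by move: (P g x) h (KV * _) => y h z z0; rewrite mulrDr mulr1; lra.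
have minor := Top_minorization r0 mg c10 c30 gb ma mb wf K00 ab b0 b_away f_away.
have [G [Gstat Gint [C [rho' [rho'1 Grate]]]]] :=
  harris_ergodic mV V1 oP P1 rho0 rho1 K10 drift p0 minor [tuple 0 | i < p].
have Pn_E n h x : Vbounded V h ->
    Pn a b f n (fun y => (h y)%:E) x = (iter n P h x)%:E.
  exact: (Pn_Top r0 mg c10 c30 gb ma mb wf K00 ab).
exists V; split=> //; split.
  exists c1, 1, c3; split=> // x; have /andP[h1 h2] := gb x.
  by rewrite lerD2l h2 andbT (le_trans h1)// lerDr.
exists G; split.
  split.
    move=> A mA; rewrite Gstat//; apply: eq_integral => x _.
    by rewrite (Pn_E 1%N)//; exact: Vbounded_indic.
  exists C, rho'; split=> // n x h mh hV.
  have bh : Vbounded V h by apply: Vbounded_le hV.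
  by rewrite Pn_E//; exact: Grate.
have bn : Vbounded V (fun x => (enorm x) `^ r).
  split; first exact: (measurableT_comp (measurable_powR r) measurable_enorm).
  exists c1^-1 => x; rewrite ger0_norm ?powR_ge0// ler_pdivlMl//.
  by have /andP[h _] := gb x; rewrite (le_trans h)// lerDr.
have /integrableP[_] := Gint _ bn.
apply: le_lt_trans; rewrite le_eqVlt; apply/orP; left; apply/eqP.
by apply: eq_integral => x _; rewrite /= ger0_norm// powR_ge0.
Qed.

End ergodicity.

Lemma perturbed_drift_of_lambda (R : realType) (p : nat) (as_ bs_ : p.-tuple R -> R)
    (f : R -> R) (r C Cf : R) (lam : p.-tuple R -> R) :
  (0 < p)%N -> 0 < r -> weightable r f -> (forall u, f u <= Cf) -> 0 <= C ->
  (forall th, Theta th -> `|star as_ th| <= C) ->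
  (forall th, Theta th -> `|star bs_ th| <= C) ->
  ((1 < p)%N ->
     loc_bdd_away0 [set x | x != [tuple (0 : R) | _ < p]]
       (fun x => Num.max `|star as_ x| (star bs_ x)) /\
     loc_bdd_away0 (~` H0) (star bs_)) ->
  drift_lambda as_ bs_ f r lam -> perturbed_drift as_ bs_ f r.
Proof.
case: p as_ bs_ lam => // -[|q] as_ bs_ lam _ r0 wf fC C0 AC BC A5 dl.
  exact: (perturbed_drift_one r0 wf C0 AC BC dl).
have [/max_away0[cm cm0 max_cm] HB] := A5 isT.
apply: (perturbed_drift_multi r0 wf fC C0 AC BC cm0 max_cm _ dl) => dls dls0.
exact: away0_off_H0.
Qed.

Theorem theorem3p5 (R : realType) (p : nat)
    (a b : p.-tuple R -> R) (f : R -> R) (as_ bs_ : p.-tuple R -> R) (r : R) :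
  (0 < p)%N ->
  (* the model: a, b measurable *)
  measurable_fun setT a -> measurable_fun setT b ->
  (* A.1: e_t has Lebesgue density f, locally bounded away from 0 *)
  measurable_fun setT f -> (forall u, 0 <= f u) ->
  (\int[lebesgue_measure]_u (f u)%:E = 1)%E ->
  (forall u0 : R, exists2 eps : R, 0 < eps & exists2 c : R, 0 < c &
     forall u, `|u - u0| < eps -> c <= f u) ->
  (* A.1: b positive, locally bounded, locally bounded away from 0 *)
  (forall x, 0 < b x) -> loc_bounded setT b -> loc_bdd_away0 setT b ->
  (* A.2 *)
  (exists C : R, forall u, (1 + `|u|) * f u <= C) ->
  (exists2 r0 : R, 0 < r0 &
     (\int[lebesgue_measure]_u (powR `|u| r0 * f u)%:E < +oo)%E) ->
  (* A.3 *)
  (exists C : R, forall x, `|a x / (1 + enorm x)| <= C) ->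
  (exists C : R, forall x, `|b x / (1 + enorm x)| <= C) ->
  (* A.4 *)
  (exists C : R, forall th, Theta th -> `|as_ th| <= C) ->
  (exists C : R, forall th, Theta th -> `|bs_ th| <= C) ->
  (forall eps : R, 0 < eps -> exists W : R, forall w : R, W < w ->
     forall th, Theta th -> `|a (tscale w th) / w - as_ th| <= eps) ->
  (forall eps : R, 0 < eps -> exists W : R, forall w : R, W < w ->
     forall th, Theta th -> `|b (tscale w th) / w - bs_ th| <= eps) ->
  (* A.5 *)
  ((1 < p)%N ->
     loc_bdd_away0 [set x | x != [tuple (0 : R) | _ < p]]
       (fun x => Num.max `|star as_ x| (star bs_ x)) /\
     loc_bdd_away0 (~` H0) (star bs_)) ->
  (* A.6 *)
  ((1 < p)%N -> exists (m : nat) (c : 'I_m -> p.-tuple R),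
     (forall j, c j != [tuple (0 : R) | _ < p]) /\
     forall x, (forall j, tdot (c j) x != 0) ->
       cont_at (star as_) x /\ cont_at (star bs_) x) ->
  (* E|e_1|^r < oo for some r > 0 *)
  0 < r ->
  (\int[lebesgue_measure]_u (powR `|u| r * f u)%:E < +oo)%E ->
  let cond_i :=
    exists lam : p.-tuple R -> R,
      measurable_fun Theta lam /\
      (exists2 c1 : R, 0 < c1 & exists c2 : R,
         forall th, Theta th -> c1 <= lam th <= c2) /\
      (exists2 c : R, c < 1 & forall th, Theta th ->
         (\int[lebesgue_measure]_u
            ((lam (thnext as_ bs_ th u) / lam th * powR (wfun as_ bs_ th u) r)%:E
             * (f u)%:E) <= c%:E)%E) in
  let cond_ii :=
    (limn_esup (fun n : nat =>
       ereal_sup [set poweR (Gn as_ bs_ f r n th) (n%:R)^-1 | th in Theta]) < 1%:E)%E in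
  let conclusion :=
    exists V : p.-tuple R -> R, measurable_fun setT V /\
      (exists K L M : R, 0 < K /\
         forall x, K * powR (enorm x) r <= V x <= L + M * powR (enorm x) r) /\
      exists G : probability (p.-tuple R) R,
        V_unif_ergodic_with a b f V G /\
        (\int[G]_x (powR (enorm x) r)%:E < +oo)%E in
  (cond_i <-> cond_ii) /\ (cond_i -> conclusion) /\ (cond_ii -> conclusion).
Proof.
move=> p0 ma mb mf f0 f1 f_away b0 _ b_away [Cf fC] _ a_growth b_growth.
move=> [Ca asC] [Cb bsC] lim_a lim_b A5 _ r0 fr cond_i cond_ii conclusion.
have [wf Ef1] := weightable_density r0 mf f0 f1 fr.
have mA := measurable_star ma lim_a; have mB := measurable_star mb lim_b.
pose C := Num.max `|Ca| `|Cb|.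
have C0 : 0 <= C by rewrite le_max normr_ge0.
have AC th : Theta th -> `|star as_ th| <= C.
  move=> Th; rewrite star_Theta// le_max (le_trans (asC th Th))//.
  exact: ler_norm.
have BC th : Theta th -> `|star bs_ th| <= C.
  move=> Th; rewrite star_Theta// le_max orbC (le_trans (bsC th Th))//.
  exact: ler_norm.
have f_le u : f u <= Cf.
  by rewrite (le_trans _ (fC u))// ler_peMl// lerDl.
have i_lambda : cond_i -> exists lam, drift_lambda as_ bs_ f r lam.
  move=> [lam [mlam [lam_bd lam_drift]]]; exists (lam \_ Theta).
  exact: (cond_i_drift r0 wf mA mB C0 AC BC mlam lam_bd lam_drift).
have i_ii : cond_i -> cond_ii.
  move=> /i_lambda[lam dl].
  have [D [c [D0 c0 c1 H]]] := drift_collapsed_iter r0 wf mA mB C0 AC BC dl.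
  exact: (iter_cond_ii r0 wf mA mB C0 AC BC D0 c0 c1 H).
have ii_i : cond_ii -> cond_i.
  move=> /(cond_ii_iter r0 wf mA mB C0 AC BC)[N [rho [rho0 rho1 H]]].
  have [lam dl] := drift_of_iter r0 wf mA mB C0 AC BC rho0 rho1 H.
  by exists lam; exact: (drift_cond_i r0 wf mA mB C0 AC BC dl).
have i_concl : cond_i -> conclusion.
  move=> /i_lambda[lam dl].
  apply: (ergodic_of_perturbed_drift r0 p0 ma mb wf Ef1 f_away b0 b_away
    a_growth b_growth lim_a lim_b).
  exact: (perturbed_drift_of_lambda p0 r0 wf f_le C0 AC BC A5 dl).
by split; [split|split=> // /ii_i].
Qed.
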